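(* Let $N\ge 2$ and $p>q>1$, and let $m>q$. Let $g:\mathbb R\to\mathbb R$ be continuous and let $f:\mathbb R\times\mathbb R^N\to\mathbb R$ be a continuous function satisfying $|f(t,\xi)|\leq g(t)|\xi|^m$ for all $(t,\xi)\in\mathbb R\times\mathbb R^N$. Then every bounded solution $u$ of $$-\Delta_pu-\Delta_q u=f(u,\nabla u)\quad\text{in }\mathbb R^N$$ is constant.
   Context: $\Delta_r u=\mathrm{div}(|\nabla u|^{r-2}\nabla u)$ denotes the $r$-Laplacian. A solution of $-\Delta_p u-\Delta_q u=f(u,\nabla u)$ in $\mathbb R^N$ means a function $u\in C^1(\mathbb R^N)$ such that $\int |\nabla u|^{p-2}\nabla u\cdot\nabla\varphi\,dx+\int|\nabla u|^{q-2}\nabla u\cdot\nabla\varphi\,dx=\int f(u,\nabla u)\varphi\,dx$ for all $\varphi\in C^1_c(\mathbb R^N)$. No sign condition is imposed on $u$. *)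

(* Defs.v *)
From HB Require Import structures.
From mathcomp Require Import all_boot all_order all_algebra.
From mathcomp Require Import all_classical all_reals all_analysis.
Set Implicit Arguments. Unset Strict Implicit. Unset Printing Implicit Defensive.
Import Order.TTheory GRing.Theory Num.Theory numFieldNormedType.Exports.
Local Open Scope ring_scope.

(* Euclidean inner product and Euclidean norm on R^N
   (the library norm on 'rV is the max-norm, so we define |.| explicitly). *)
Definition dotv (R : realType) (N : nat) (a b : 'rV[R]_N) : R :=
  \sum_(i < N) a 0 i * b 0 i.
Definition enorm (R : realType) (N : nat) (a : 'rV[R]_N) : R :=
  Num.sqrt (dotv a a).

Definition ebasis (R : realType) (N : nat) (i : 'I_N) : 'rV[R]_N :=
  \row_(j < N) (i == j)%:R.

Definition grad (R : realType) (N : nat) (u : 'rV[R]_N -> R) (x : 'rV[R]_N)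
  : 'rV[R]_N := \row_(i < N) ('D_(ebasis R i) u x).

Definition C1 (R : realType) (N : nat) (u : 'rV[R]_N -> R) : Prop :=
  (forall x, differentiable u x) /\ continuous (grad u).

Definition C1c (R : realType) (N : nat) (phi : 'rV[R]_N -> R) : Prop :=
  C1 phi /\ exists r : R, forall x, r < enorm x -> phi x = 0.

(* Integral over R^N, as an iterated Lebesgue integral over the coordinates
   (all integrands below are continuous with compact support, for which this
   coincides with the N-dimensional Lebesgue integral, by Fubini). *)
Fixpoint iter_int (R : realType) (k : nat) (F : (nat -> R) -> R) (x : nat -> R)
  : R :=
  match k with
  | 0 => F x
  | k'.+1 => Rintegral (@lebesgue_measure R) setT
               (fun t => iter_int k' F (fun j => if j == k' then t else x j))
  end.

Definition integralRN (R : realType) (N : nat) (G : 'rV[R]_N -> R) : R :=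
  iter_int N (fun y => G (\row_(i < N) y (i : nat))) (fun _ => 0).

Definition rflux (R : realType) (N : nat) (r : R) (xi : 'rV[R]_N) : 'rV[R]_N :=
  (enorm xi `^ (r - 2)) *: xi.

Definition is_solution (R : realType) (N : nat) (p q : R)
  (f : R -> 'rV[R]_N -> R) (u : 'rV[R]_N -> R) : Prop :=
  C1 u /\
  forall phi : 'rV[R]_N -> R, C1c phi ->
    integralRN (fun x => dotv (rflux p (grad u x)) (grad phi x))
    + integralRN (fun x => dotv (rflux q (grad u x)) (grad phi x))
    = integralRN (fun x => f (u x) (grad u x) * phi x).

(* Main.v *)
(* Doubling of variables of Ishii-Lions type, carried out in weak form because [u]
   is only C^1.  If [u] is not constant, then
   u(x) - u(y) - a |x - y|^gam has a positive supremum for all small [a], where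
   gam = (m-q)/(m-q+1) < 1; quadratic penalties of size [kap] make it a strict
   maximum at some (x1, y1).  Compare v(x, y) = u(x) - u(y) with the penalty Psi
   near this point on R^N x R^N: since v has no mixed derivatives d_x d_y, a
   constant coupling matrix can be added to the equation for free.  A slightly
   damped reflection along x1 - y1 keeps the coupled operator monotone near the
   common gradient, while the concavity of r^gam makes Psi a strict
   supersolution: the gain is of order |b|^(q-1) / |x1 - y1| with
   b = grad_x a |x - y|^gam, and it beats |b|^m for small [a] precisely because
   gam solves the critical ODE, which is possible as m > q.  Testing with the
   squared positive part of v - Psi - (max - small) gives a contradiction. *)

Require Import Defs.
From HB Require Import structures.
From mathcomp Require Import all_boot all_order all_algebra.
From mathcomp Require Import all_classical all_reals all_analysis.
From mathcomp Require Import ring lra.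
Set Implicit Arguments. Unset Strict Implicit. Unset Printing Implicit Defensive.
Import Order.TTheory GRing.Theory Num.Theory numFieldNormedType.Exports.
Local Open Scope ring_scope.

(** * Integrals of compactly supported functions of one variable *)

(** Both gradients of u at the maximum lie within a fixed fraction of |b| from b, and b is nonzero.
    On the small support of the test function the fluxes are therefore smooth and elliptic, for
    exponents above and below 2 alike. Tolerances are relative to |b|, so by homogeneity they do not
    depend on the maximum point, which is known only after [kap] is fixed. The equation is tested in
    x with y frozen, and in y with x frozen. For one of them this requires exchanging the order of
    integration, hence the Fubini theorem for iterated integrals. The damping is forced: with the
    exact reflection the coupled quadratic form is only semidefinite and has a kernel, which leaves
    no room for the variation of the fluxes near b. A fraction [del] of the coupling is given up,
    small enough for the gain to survive. *)

Definition lint (R : realType) (f : R -> R) : R :=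
  Rintegral (@lebesgue_measure R) setT f.

Lemma restrict_supp (R : realType) (f : R -> R) (K : R) :
  (forall t, K < `|t| -> f t = 0) -> f = f \_ `[- K, K]%classic.
Proof.
move=> f0; apply/funext => t; rewrite patchE; case: ifPn => // tK.
apply: f0; rewrite ltNge; apply: contra tK => tK.
by rewrite inE /= in_itv /= -ler_norml.
Qed.

Lemma integrable_itv_cts (R : realType) (f : R -> R) (a b : R) :
  continuous f ->
  (@lebesgue_measure R).-integrable `[a, b]%classic (EFin \o f).
Proof.
move=> fc; apply: continuous_compact_integrable; first exact: segment_compact.
exact: continuous_subspaceT.
Qed.

Lemma integrable_cts (R : realType) (f : R -> R) (K : R) : continuous f ->
  (forall t, K < `|t| -> f t = 0) ->
  (@lebesgue_measure R).-integrable setT (EFin \o f).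
Proof.
move=> fc f0; rewrite (restrict_supp f0) -restrict_EFin.
have mI : measurable `[- K, K]%classic by [].
have := (@integrable_mkcond _ _ R (@lebesgue_measure R) `[- K, K]%classic (EFin \o f) mI).1. move=> H; apply: H.
exact: integrable_itv_cts.
Qed.

Lemma lint_itv (R : realType) (f : R -> R) (K : R) :
  (forall t, K < `|t| -> f t = 0) ->
  lint f = \int[@lebesgue_measure R]_(t in `[- K, K]) f t.
Proof. by move=> f0; rewrite Rintegral_mkcond -(restrict_supp f0). Qed.

Lemma Rintegral_near_cst (R : realType) (f : R -> R) (a b c e : R) :
  a <= b -> continuous f -> (forall t, a <= t <= b -> `|f t - c| <= e) ->
  `|\int[@lebesgue_measure R]_(t in `[a, b]) f t - (b - a) * c| <= (b - a) * e.
Proof.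
move=> ab fc fe.
have E r : \int[@lebesgue_measure R]_(t in `[a, b]) r = (b - a) * r.
  rewrite Rintegral_cst //= (lebesgue_measure_itv `[a, b]) /= lte_fin.
  case: ltP => ab'; first by rewrite /= mulrC.
  have -> : b = a by lra.
  by rewrite /= mulr0 subrr mul0r.
have mc r : (@lebesgue_measure R).-integrable `[a, b]%classic (EFin \o (fun=> r)).
  by apply: integrable_itv_cts => x; exact: cvg_cst.
have If := @integrable_itv_cts R f a b fc.
rewrite -!E -RintegralB //.
have cd : continuous (fun x => f x - c).
  by move=> x; apply: cvgB; [exact: fc | exact: cvg_cst].
apply: (le_trans (le_normr_Rintegral _ _)); [by []|exact: integrable_itv_cts|].
apply: le_Rintegral => //; first by apply: (@integrable_itv_cts R (fun x => `|f x - c|)) => x; apply: cvg_norm; exact: cd.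
Qed.

Lemma Rintegral_itv_split (R : realType) (f : R -> R) (a b c : R) :
  continuous f -> a <= b -> b <= c ->
  \int[@lebesgue_measure R]_(t in `[a, c]) f t =
  \int[@lebesgue_measure R]_(t in `[a, b]) f t +
  \int[@lebesgue_measure R]_(t in `[b, c]) f t.
Proof.
move=> fc ab bc.
have := @Rintegral_itvB R f (BLeft a) (BRight c) b.
rewrite Rintegral_itv_obnd_cbnd; last first.
  apply: (integrableS _ _ _ (@integrable_itv_cts R f b c fc)) => //.
  by apply: subset_itvr; rewrite bnd_simp.
move=> <- //; last exact: integrable_itv_cts.
by rewrite addrC subrK.
Qed.

Lemma riemann_sum (R : realType) (f : R -> R) (a h e : R) (n : nat) :
  0 <= h -> continuous f ->
  (forall s t, `|s - t| <= h -> `|f s - f t| <= e) ->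
  `|\int[@lebesgue_measure R]_(t in `[a, a + n%:R * h]) f t
    - \sum_(k < n) h * f (a + k%:R * h)| <= n%:R * h * e.
Proof.
move=> h0 fc fe; elim: n => [|n IH].
  rewrite big_ord0 !mul0r subr0 addr0 set_itv1 Rintegral_set1 normr0 //.
have nh : 0 <= n%:R * h by rewrite mulr_ge0.
have S : n.+1%:R * h = n%:R * h + h by rewrite -natr1 mulrDl mul1r.
rewrite big_ord_recr /= S addrA.
rewrite (@Rintegral_itv_split R f a (a + n%:R * h)) ?lerDl //.
have := @Rintegral_near_cst R f (a + n%:R * h) (a + n%:R * h + h)
  (f (a + n%:R * h)) e.
rewrite lerDl => /(_ h0 fc) H.
have {H} : `|\int[@lebesgue_measure R]_(t in `[a + n%:R * h, a + n%:R * h + h]) f t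
   - h * f (a + n%:R * h)| <= h * e.
  have E : a + n%:R * h + h - (a + n%:R * h) = h by lra.
  rewrite E in H; apply: H => t /andP[t1 t2]; apply: fe.
  by rewrite ger0_norm; lra.
move=> H; rewrite mulrDl; apply: le_trans (lerD IH H).
apply: le_trans (ler_normD _ _); rewrite le_eqVlt; apply/orP; left; apply/eqP.
by congr (`| _ |); lra.
Qed.

Lemma lint_riemann (R : realType) (f : R -> R) (K e : R) (n : nat) :
  0 <= K -> (0 < n)%N -> continuous f -> (forall t, K < `|t| -> f t = 0) ->
  (forall s t, `|s - t| <= 2 * K / n%:R -> `|f s - f t| <= e) ->
  `|lint f - \sum_(k < n) 2 * K / n%:R * f (- K + k%:R * (2 * K / n%:R))|
    <= 2 * K * e.
Proof.
move=> K0 n0 fc f0 fe; rewrite (lint_itv f0).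
have n1 : n%:R != 0 :> R by rewrite pnatr_eq0 -lt0n.
have h0 : 0 <= 2 * K / n%:R by rewrite !mulr_ge0 // invr_ge0.
have := @riemann_sum R f (- K) (2 * K / n%:R) e n h0 fc fe.
have -> : n%:R * (2 * K / n%:R) = 2 * K by rewrite mulrC divfK.
by have -> : - K + 2 * K = K by lra.
Qed.

Lemma lintD (R : realType) (f g : R -> R) (K : R) :
  continuous f -> continuous g ->
  (forall t, K < `|t| -> f t = 0) -> (forall t, K < `|t| -> g t = 0) ->
  lint (fun t => f t + g t) = lint f + lint g.
Proof.
move=> fc gc f0 g0; rewrite /lint RintegralD //; exact: (@integrable_cts _ _ K).
Qed.

Lemma lintZ (R : realType) (f : R -> R) (K r : R) :
  continuous f -> (forall t, K < `|t| -> f t = 0) ->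
  lint (fun t => r * f t) = r * lint f.
Proof.
move=> fc f0; rewrite /lint RintegralZl //; exact: (@integrable_cts _ _ K).
Qed.

Lemma lint_ge0 (R : realType) (f : R -> R) :
  (forall t, 0 <= f t) -> 0 <= lint f.
Proof. by move=> f0; exact: Rintegral_ge0. Qed.

Lemma lint_gt0 (R : realType) (f : R -> R) (K t0 : R) :
  continuous f -> (forall t, K < `|t| -> f t = 0) ->
  (forall t, 0 <= f t) -> 0 < f t0 -> 0 < lint f.
Proof.
move=> fc f0 fge ft0.
have : \forall t \near t0, f t0 / 2 < f t.
  by apply: (cvgr_gt _ (fc t0)); lra.
move=> /nbhs_ballP[d /= d0 Hd].
have Hf t : t0 - d / 2 <= t <= t0 + d / 2 -> f t0 / 2 <= f t.
  move=> /andP[t1 t2]; apply/ltW/Hd; rewrite /ball /= distrC ltr_norml.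
  by apply/andP; split; lra.
pose L := Num.max K (`|t0| + d).
have LK : K <= L by rewrite le_max lexx.
have Lt : `|t0| + d <= L by rewrite le_max lexx orbT.
have t0L : - `|t0| <= t0 <= `|t0| by rewrite -ler_norml.
have t0p := normr_ge0 t0.
rewrite (@lint_itv _ _ L); last by move=> t tL; apply: f0; lra.
have mid : 0 < \int[@lebesgue_measure R]_(t in `[t0 - d / 2, t0 + d / 2]) f t.
  have := @Rintegral_near_cst R (fun=> f t0 / 2) (t0 - d / 2) (t0 + d / 2)
    (f t0 / 2) 0.
  have cc : continuous (fun _ : R => f t0 / 2) by move=> x; exact: cvg_cst.
  rewrite (_ : t0 + d / 2 - (t0 - d / 2) = d); last by lra.
  rewrite mulr0 => /(_ _ cc) H.
  have {}H : \int[@lebesgue_measure R]_(t in `[t0 - d / 2, t0 + d / 2]) (f t0 / 2)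
      = d * (f t0 / 2).
    apply/eqP; rewrite -subr_eq0 -normr_le0; apply: H; first by lra.
    by move=> t _; rewrite subrr normr0.
  apply: (@lt_le_trans _ _ (d * (f t0 / 2))).
    by rewrite mulr_gt0 // divr_gt0.
  rewrite -H; apply: le_Rintegral => //; try exact: integrable_itv_cts.
have ge a b : 0 <= \int[@lebesgue_measure R]_(t in `[a, b]) f t.
  by apply: Rintegral_ge0 => t _.
have [l1 l2 l3] : [/\ - L <= t0 - d / 2, t0 - d / 2 <= t0 + d / 2 &
    t0 + d / 2 <= L] by clear -d0 Lt t0L t0p; split; lra.
rewrite (@Rintegral_itv_split R f _ (t0 - d / 2)) //; last exact: le_trans l3.
rewrite (@Rintegral_itv_split R f (t0 - d / 2) (t0 + d / 2)) //.
by apply: ltr_wpDl => //; apply: ltr_pwDl.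
Qed.

Lemma lint_norm_le (R : realType) (f : R -> R) (K e : R) :
  0 <= K -> continuous f -> (forall t, K < `|t| -> f t = 0) ->
  (forall t, `|f t| <= e) -> `|lint f| <= 2 * K * e.
Proof.
move=> K0 fc f0 fe; rewrite (lint_itv f0).
have := @Rintegral_near_cst R f (- K) K 0 e.
rewrite mulr0 subr0 opprK (_ : K + K = 2 * K); last by lra.
by apply => //; [lra | move=> t _; rewrite subr0].
Qed.

Lemma lint_deriv (R : realType) (F f : R -> R) (K : R) :
  continuous f -> (forall t, K < `|t| -> F t = 0) ->
  (forall t, K < `|t| -> f t = 0) ->
  (forall t : R, is_derive t (1 : R) F (f t)) -> lint f = 0.
Proof.
(* [F] vanishes only strictly beyond [K], so the endpoints are put at distance [L > K]; the maximum
   with 0 covers a negative [K]. *)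
move=> fc F0 f0 Ff; pose L := Num.max K 0 + 1.
have K1 : K <= Num.max K 0 by rewrite le_max lexx.
have K0 : 0 <= Num.max K 0 by rewrite le_max lexx orbT.
have KL : K < L by rewrite /L; lra.
have L0 : 0 < L by rewrite /L; lra.
rewrite (@lint_itv _ _ L); last by move=> t tL; apply: f0; lra.
have Fc : continuous F.
  move=> t; apply: differentiable_continuous; apply/derivable1_diffP.
  exact: (@ex_derive _ _ _ _ _ _ _ (Ff t)).
rewrite /Rintegral (@continuous_FTC2 _ _ F); last first.
- by move=> t _; rewrite derive1E; exact: derive_val.
- split.
  + by move=> t _; exact: (@ex_derive _ _ _ _ _ _ _ (Ff t)).
  + exact: cvg_at_right_filter (Fc _).
  + exact: cvg_at_left_filter (Fc _).
- exact: continuous_subspaceT.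
- lra.
by rewrite !F0 ?subee // ?normrN ger0_norm //; lra.
Qed.

Lemma lint_eq0 (R : realType) (f : R -> R) : (forall t, f t = 0) -> lint f = 0.
Proof.
move=> f0; rewrite (_ : f = fun=> 0); last exact/funext.
apply/eqP; rewrite -normr_le0.
have := @lint_norm_le R (fun=> 0) 0 0 (lexx _); rewrite !mulr0; apply => //.
  by move=> x; exact: cvg_cst.
by move=> t; rewrite normr0.
Qed.

Lemma lintB (R : realType) (f g : R -> R) (K : R) :
  continuous f -> continuous g ->
  (forall t, K < `|t| -> f t = 0) -> (forall t, K < `|t| -> g t = 0) ->
  lint (fun t => f t - g t) = lint f - lint g.
Proof.
move=> fc gc f0 g0; rewrite -mulN1r -(lintZ _ gc g0).
have gNc : continuous (fun t => -1 * g t).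
  by move=> t; apply: cvgM; [exact: cvg_cst | exact: gc].
rewrite -(@lintD _ f _ K) //; last by move=> t /g0 ->; rewrite mulr0.
by congr lint; apply/funext => t; rewrite mulN1r.
Qed.

Lemma continuous_sum (R : realType) (T : topologicalType) (n : nat)
    (f : 'I_n -> T -> R) (x : T) :
  (forall k, {for x, continuous (f k)}) ->
  {for x, continuous (fun t => \sum_(k < n) f k t)}.
Proof.
elim: n f => [|n IH] f fc.
  rewrite (_ : (fun _ => _) = fun=> 0); first exact: cvg_cst.
  by apply/funext => t; rewrite big_ord0.
rewrite (_ : (fun _ => _) =
    fun t => \sum_(k < n) f (widen_ord (leqnSn n) k) t + f ord_max t); last first.
  by apply/funext => t; rewrite big_ord_recr.
by apply: cvgD; [apply: IH => k; exact: fc | exact: fc].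
Qed.

Lemma lint_sum (R : realType) (n : nat) (f : 'I_n -> R -> R) (K : R) :
  (forall k, continuous (f k)) ->
  (forall k t, K < `|t| -> f k t = 0) ->
  lint (fun t => \sum_(k < n) f k t) = \sum_(k < n) lint (f k).
Proof.
elim: n f => [|n IH] f fc f0.
  by rewrite big_ord0 lint_eq0 // => t; rewrite big_ord0.
rewrite big_ord_recr /= -IH //; last by move=> k t tK; exact: f0.
rewrite -(@lintD _ _ _ K) //.
- by congr lint; apply/funext => t; rewrite big_ord_recr.
- by move=> x; apply: continuous_sum => k; exact: fc.
- by move=> t tK; apply: big1 => k _; exact: f0.
- exact: f0.
Qed.

Lemma modulus_continuous (R : realType) (f : R -> R) :
  (forall e : R, 0 < e -> exists2 d : R, 0 < d &
     forall s t, `|s - t| <= d -> `|f s - f t| <= e) -> continuous f.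
Proof.
move=> H x; apply/cvgrPdist_le => e e0; have [d d0 Hd] := H e e0.
apply/nbhs_ballP; exists d => //= y xy; apply: Hd.
by move: xy; rewrite /ball /= => /ltW.
Qed.

(* Both iterated integrals are compared with the same one-variable Riemann sum. *)
Lemma lint_swap (R : realType) (G : R -> R -> R) (K : R) :
  0 <= K ->
  (forall s t, K < `|s| -> G s t = 0) -> (forall s t, K < `|t| -> G s t = 0) ->
  (forall e : R, 0 < e -> exists2 d : R, 0 < d & forall s s' t t',
     `|s - s'| <= d -> `|t - t'| <= d -> `|G s t - G s' t'| <= e) ->
  lint (fun s => lint (G s)) = lint (fun t => lint (G^~ t)).
Proof.
move=> K0 G1 G2 Gu.
have c1 s : continuous (G s).
  apply: modulus_continuous => e /Gu[d d0 H]; exists d => // t t' tt'.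
  by apply: H => //; rewrite subrr normr0 ltW.
have c2 t : continuous (G^~ t).
  apply: modulus_continuous => e /Gu[d d0 H]; exists d => // s s' ss'.
  by apply: H => //; rewrite subrr normr0 ltW.
have A0 s : K < `|s| -> lint (G s) = 0.
  by move=> sK; apply: lint_eq0 => t; exact: G1.
have B0 t : K < `|t| -> lint (G^~ t) = 0.
  by move=> sK; apply: lint_eq0 => s; exact: G2.
have Au e d : (forall s s' t t',
     `|s - s'| <= d -> `|t - t'| <= d -> `|G s t - G s' t'| <= e) -> 0 <= d ->
     forall s s', `|s - s'| <= d -> `|lint (G s) - lint (G s')| <= 2 * K * e.
  move=> H d0 s s' ss'; rewrite -(@lintB _ _ _ K) //; try exact: G2.
  apply: lint_norm_le => //.
  - by move=> t; apply: cvgB; exact: c1.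
  - by move=> t tK; rewrite !G2 // subrr.
  - by move=> t; apply: H => //; rewrite subrr normr0.
have Bu e d : (forall s s' t t',
     `|s - s'| <= d -> `|t - t'| <= d -> `|G s t - G s' t'| <= e) -> 0 <= d ->
     forall s s', `|s - s'| <= d -> `|lint (G^~ s) - lint (G^~ s')| <= 2 * K * e.
  move=> H d0 s s' ss'; rewrite -(@lintB _ _ _ K) //; try by move=> ? ?; exact: G1.
  apply: lint_norm_le => //.
  - by move=> t; apply: cvgB; exact: c2.
  - by move=> t tK; rewrite !G1 // subrr.
  - by move=> t; apply: H => //; rewrite subrr normr0.
have Kd e : 0 < e -> 0 < e / (2 * K + 1) by move=> e0; rewrite divr_gt0 //; lra.
have Kle e : 0 < e -> 2 * K * (e / (2 * K + 1)) <= e.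
  move=> e0; rewrite mulrCA ger_pMr // ler_pdivrMr; lra.
have Ac : continuous (fun s => lint (G s)).
  apply: modulus_continuous => e e0; have [d d0 H] := Gu _ (Kd e e0).
  by exists d => // s t st; apply: le_trans (Kle e e0); apply: (Au _ d) => //; exact: ltW.
have Bc : continuous (fun s => lint (G^~ s)).
  apply: modulus_continuous => e e0; have [d d0 H] := Gu _ (Kd e e0).
  by exists d => // s t st; apply: le_trans (Kle e e0); apply: (Bu _ d) => //; exact: ltW.
(* Each iterated integral differs from the common Riemann sum by at most (2K)^2 e, which gives 8 K^2
   e for the pair. *)
suff main e : 0 < e ->
    `|lint (fun s => lint (G s)) - lint (fun t => lint (G^~ t))| <= 8 * K ^+ 2 * e.
  apply/eqP; rewrite -subr_eq0 -normr_le0; apply/ler_addgt0Pr => e e0.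
  rewrite add0r; have P : 0 < 8 * K ^+ 2 + 1 by have := sqr_ge0 K; lra.
  apply: (le_trans (main (e / (8 * K ^+ 2 + 1)) _)); first by rewrite divr_gt0.
  by rewrite mulrCA ger_pMr // ler_pdivrMr //; lra.
move=> e0; have [d d0 H] := Gu _ e0.
pose n := (Num.bound (2 * K / d)).+1.
have n0 : 0 < n%:R :> R by rewrite ltr0n.
have hd : 2 * K / n%:R <= d.
  rewrite ler_pdivrMr // -ler_pdivrMl // mulrC ltW //.
  have /archi_boundP H' : 0 <= 2 * K / d by rewrite !mulr_ge0 // invr_ge0 ltW.
  by apply: lt_le_trans H' _; rewrite ler_nat.
have h0 : 0 <= 2 * K / n%:R by rewrite !mulr_ge0 // invr_ge0 ltW.
pose x (k : 'I_n) := - K + k%:R * (2 * K / n%:R).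
have R1 : `|lint (fun s => lint (G s)) -
    \sum_(k < n) 2 * K / n%:R * lint (G (x k))| <= 2 * K * (2 * K * e).
  apply: lint_riemann => // s t st; apply: (Au _ d) => //; first exact: ltW.
  exact: le_trans hd.
have R2 : `|lint (fun t => lint (G^~ t)) -
    \sum_(k < n) 2 * K / n%:R * lint (G (x k))| <= 2 * K * (2 * K * e).
  have gc k : continuous (fun t => 2 * K / n%:R * G (x k) t).
    by move=> t; apply: cvgM; [exact: cvg_cst | exact: c1].
  have g0 k t : K < `|t| -> 2 * K / n%:R * G (x k) t = 0.
    by move=> tK; rewrite G2 // mulr0.
  under eq_bigr do rewrite -(lintZ _ (@c1 _) (@G2 _)).
  rewrite -(@lint_sum _ _ _ K) // -(@lintB _ _ _ K) //.
  - apply: lint_norm_le => //.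
    + move=> t; apply: cvgB; first exact: Bc.
      by apply: continuous_sum => k; exact: gc.
    + by move=> t tK; rewrite B0 // big1 ?subrr // => k _; exact: g0.
    + move=> t; apply: lint_riemann => //; first by move=> s; exact: G1.
      move=> s s' ss'; apply: H; last by rewrite subrr normr0 ltW.
      exact: le_trans hd.
  - by move=> t; apply: continuous_sum => k; exact: gc.
  - by move=> t tK; apply: big1 => k _; exact: g0.
have -> : 8 * K ^+ 2 * e = 2 * K * (2 * K * e) + 2 * K * (2 * K * e) by ring.
apply: le_trans (lerD R1 R2); rewrite [X in _ <= _ + X]distrC.
by apply: le_trans (ler_normD _ _); rewrite subrKA.
Qed.

(** * Iterated integrals over coordinates *)

Definition upd (R : Type) (I : eqType) (z : I -> R) (j : I) (t : R) : I -> R :=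
  fun i => if i == j then t else z i.

(** Uniform continuity is measured on the coordinates of [J] alone, which also forces [F] to depend
    on no other coordinate. In this form the class is stable under integrating out one
    coordinate. *)
Definition Cc (R : realType) (I : eqType) (J : pred I) (F : (I -> R) -> R) :=
  (exists K : R, forall z j, J j -> K < `|z j| -> F z = 0) /\
  (forall e : R, 0 < e -> exists2 d : R, 0 < d &
     forall z w, (forall j, J j -> `|z j - w j| <= d) -> `|F z - F w| <= e).

Definition coord_int (R : realType) (I : eqType) (j : I) (F : (I -> R) -> R) :
  (I -> R) -> R := fun z => lint (fun t => F (upd z j t)).

(** The head of the list is the outermost integral. *)
Definition coords_int (R : realType) (I : eqType) (l : seq I)
  (F : (I -> R) -> R) : (I -> R) -> R := foldr (@coord_int R I) F l.

Lemma upd_same (R : Type) (I : eqType) (z : I -> R) (j : I) : upd z j (z j) = z.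
Proof. by apply/funext => i; rewrite /upd; case: eqP => [->|]. Qed.

Lemma upd_comm (R : Type) (I : eqType) (z : I -> R) (i j : I) (s t : R) :
  i != j -> upd (upd z i s) j t = upd (upd z j t) i s.
Proof.
move=> ij; apply/funext => k; rewrite /upd; case: eqP => // ->.
by rewrite eq_sym (negbTE ij).
Qed.

Lemma upd_close (R : realType) (I : eqType) (J : pred I) (z w : I -> R) (j : I)
    (s t d : R) : (forall i, [predD1 J & j] i -> `|z i - w i| <= d) ->
  `|s - t| <= d -> forall i, J i -> `|upd z j s i - upd w j t i| <= d.
Proof.
move=> H st i Ji; rewrite /upd; case: eqVneq => // ij.
by apply: H; rewrite /= ij.
Qed.

Lemma Cc_supp (R : realType) (I : eqType) (J : pred I) (F : (I -> R) -> R) :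
  Cc J F -> exists2 K : R, 0 <= K & forall z j, J j -> K < `|z j| -> F z = 0.
Proof.
move=> [[K FK] _]; exists (Num.max K 0); first by rewrite le_max lexx orbT.
move=> z j Jj Kz; apply: (FK z j Jj); apply: le_lt_trans Kz.
by rewrite le_max lexx.
Qed.

Lemma upd_supp (R : realType) (I : eqType) (J : pred I) (F : (I -> R) -> R)
    (K : R) (z : I -> R) (j : I) :
  (forall z j, J j -> K < `|z j| -> F z = 0) -> J j ->
  forall t, K < `|t| -> F (upd z j t) = 0.
Proof. by move=> FK Jj t tK; apply: (FK _ j) => //; rewrite /upd eqxx. Qed.

Lemma Cc_slice (R : realType) (I : eqType) (J : pred I) (F : (I -> R) -> R)
    (z : I -> R) (j : I) : Cc J F -> J j -> continuous (fun t => F (upd z j t)).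
Proof.
move=> [_ Fu] Jj; apply: modulus_continuous => e e0.
have [d d0 H] := Fu _ e0; exists d => // s t st; apply: H.
by apply: upd_close => // i _; rewrite subrr normr0 ltW.
Qed.

Lemma CcD (R : realType) (I : eqType) (J : pred I) (F G : (I -> R) -> R) :
  Cc J F -> Cc J G -> Cc J (fun z => F z + G z).
Proof.
move=> [[K FK] Fu] [[L GL] Gu]; split.
  exists (Num.max K L) => z j Jj; rewrite gt_max => /andP[Kz Lz].
  by rewrite (FK z j) // (GL z j) // addr0.
move=> e e0; have e2 : 0 < e / 2 by lra.
have [d d0 Hd] := Fu _ e2; have [d' d0' Hd'] := Gu _ e2.
exists (Num.min d d'); first by rewrite lt_min d0 d0'.
move=> z w H; rewrite (_ : _ - _ = (F z - F w) + (G z - G w)); last by ring.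
have -> : e = e / 2 + e / 2 by lra.
apply: le_trans (ler_normD _ _) _; apply: lerD.
  by apply: Hd => j /H; rewrite le_min => /andP[].
by apply: Hd' => j /H; rewrite le_min => /andP[].
Qed.

Lemma CcZ (R : realType) (I : eqType) (J : pred I) (r : R) (F : (I -> R) -> R) :
  Cc J F -> Cc J (fun z => r * F z).
Proof.
move=> [[K FK] Fu]; split.
  by exists K => z j Jj Kz; rewrite (FK z j) // mulr0.
move=> e e0; have r0 : 0 < `|r| + 1 by have := normr_ge0 r; lra.
have [d d0 Hd] := Fu _ (divr_gt0 e0 r0).
exists d => // z w H; rewrite -mulrBr normrM.
apply: le_trans (ler_wpM2l (normr_ge0 _) (Hd _ _ H)) _.
rewrite mulrCA ger_pMr // ler_pdivrMr //; lra.
Qed.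

(** The slices live in [-K, K], so integration multiplies the modulus of continuity by at most 2K,
    and the dependence on [j] disappears. *)
Lemma Cc_int (R : realType) (I : eqType) (J : pred I) (F : (I -> R) -> R)
    (j : I) : Cc J F -> J j -> Cc [predD1 J & j] (coord_int j F).
Proof.
move=> FC Jj; have [K K0 FK] := Cc_supp FC; have [_ Fu] := FC; split.
  exists K => z i /= /andP[ij Ji] Kz; apply: lint_eq0 => t; apply: (FK _ i) => //.
  by rewrite /upd (negbTE ij).
move=> e e0; have K1 : 0 < 2 * K + 1 by lra.
have [d d0 Hd] := Fu _ (divr_gt0 e0 K1).
exists d => // z w H; rewrite /coord_int.
have sz := @upd_supp _ _ _ _ _ z _ FK Jj.
have sw := @upd_supp _ _ _ _ _ w _ FK Jj.
rewrite -(@lintB _ _ _ K) //; try exact: Cc_slice FC Jj.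
apply: (@le_trans _ _ (2 * K * (e / (2 * K + 1)))).
  apply: lint_norm_le => //.
  - by move=> t; apply: cvgB; apply: Cc_slice FC Jj _.
  - by move=> t tK; rewrite sz // sw // subrr.
  - move=> t; apply: Hd; apply: upd_close => //.
    by rewrite subrr normr0 ltW.
rewrite mulrCA ger_pMr // ler_pdivrMr //; lra.
Qed.

Lemma Cc_ints (R : realType) (I : eqType) (J : pred I) (F : (I -> R) -> R)
    (l : seq I) : Cc J F -> uniq l -> {in l, forall i, J i} ->
  Cc [predD J & l] (coords_int l F).
Proof.
move=> FC; elim: l => [|j l IH] /=.
  by move=> _ _; rewrite (_ : ([predD J & [::]] : pred I) = J) //; exact/funext.
move=> /andP[jl ul] Jl.
rewrite (_ : ([predD J & j :: l] : pred I) = [predD1 [predD J & l] & j]); last first.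
  by apply/funext => i /=; rewrite !inE negb_or andbA.
apply: Cc_int; last by rewrite /= jl; apply: Jl; exact: mem_head.
by apply: IH => // i il; apply: Jl; rewrite inE il orbT.
Qed.

Lemma coord_intD (R : realType) (I : eqType) (J : pred I) (F G : (I -> R) -> R)
    (j : I) : Cc J F -> Cc J G -> J j ->
  coord_int j (fun z => F z + G z) = fun z => coord_int j F z + coord_int j G z.
Proof.
move=> FC GC Jj; have [K K0 FK] := Cc_supp FC; have [L L0 GL] := Cc_supp GC.
apply/funext => z; apply: (@lintD _ _ _ (Num.max K L)).
- exact: Cc_slice FC Jj.
- exact: Cc_slice GC Jj.
- by move=> t; rewrite gt_max => /andP[tK _]; exact: (upd_supp z FK Jj tK).
- by move=> t; rewrite gt_max => /andP[_ tL]; exact: (upd_supp z GL Jj tL).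
Qed.

Lemma coords_intD (R : realType) (I : eqType) (J : pred I)
    (F G : (I -> R) -> R) (l : seq I) : Cc J F -> Cc J G -> uniq l ->
  {in l, forall i, J i} ->
  coords_int l (fun z => F z + G z) =
  fun z => coords_int l F z + coords_int l G z.
Proof.
move=> FC GC; elim: l => //= j l IH /andP[jl ul] Jl.
have Jl' : {in l, forall i, J i} by move=> i il; apply: Jl; rewrite inE il orbT.
rewrite IH // (@coord_intD _ _ [predD J & l]) //; try exact: Cc_ints.
by rewrite /= jl; apply: Jl; exact: mem_head.
Qed.

Lemma coords_intZ (R : realType) (I : eqType) (J : pred I) (r : R)
    (F : (I -> R) -> R) (l : seq I) : Cc J F -> uniq l ->
  {in l, forall i, J i} ->
  coords_int l (fun z => r * F z) = fun z => r * coords_int l F z.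
Proof.
move=> FC; elim: l => //= j l IH /andP[jl ul] Jl.
have Jl' : {in l, forall i, J i} by move=> i il; apply: Jl; rewrite inE il orbT.
have JJ : [predD J & l] j by rewrite /= jl; apply: Jl; exact: mem_head.
have FC' := Cc_ints FC ul Jl'; have [K K0 FK] := Cc_supp FC'.
rewrite IH //; apply/funext => z; apply: (@lintZ _ _ K).
- exact: Cc_slice FC' JJ.
- exact: (upd_supp z FK JJ).
Qed.

Lemma coord_int_swap (R : realType) (I : eqType) (J : pred I)
    (F : (I -> R) -> R) (i j : I) : Cc J F -> J i -> J j -> i != j ->
  coord_int i (coord_int j F) = coord_int j (coord_int i F).
Proof.
move=> FC Ji Jj ij; have [K K0 FK] := Cc_supp FC; have [_ Fu] := FC.
apply/funext => z; rewrite /coord_int.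
transitivity (lint (fun t => lint (fun s => F (upd (upd z i s) j t)))); last first.
  by congr lint; apply/funext => t; congr lint; apply/funext => s; rewrite upd_comm.
apply: (@lint_swap _ (fun s t => F (upd (upd z i s) j t)) K) => //.
- by move=> s t sK; apply: (FK _ i) => //; rewrite /upd (negbTE ij) eqxx.
- by move=> s t tK; apply: (FK _ j) => //; rewrite /upd eqxx.
move=> e e0; have [d d0 Hd] := Fu _ e0; exists d => // s s' t t' ss' tt'.
apply: Hd; apply: upd_close => // k /= /andP[kj Jk].
by apply: (@upd_close _ _ J) => // k' _; rewrite subrr normr0 ltW.
Qed.

Lemma coords_int_swap1 (R : realType) (I : eqType) (J : pred I)
    (F : (I -> R) -> R) (l : seq I) (j : I) : Cc J F -> uniq (j :: l) ->
  {in j :: l, forall i, J i} ->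
  coord_int j (coords_int l F) = coords_int l (coord_int j F).
Proof.
move=> FC; elim: l => //= i l IH /andP[]; rewrite inE negb_or => /andP[ji jl].
move=> /andP[il ul] Jl.
have Jl' : {in l, forall i, J i} by move=> k kl; apply: Jl; rewrite !inE kl !orbT.
rewrite (@coord_int_swap _ _ [predD J & l]) //.
- rewrite IH ?jl // => k; rewrite inE => /orP[/eqP->|kl]; last exact: Jl'.
  by apply: Jl; rewrite mem_head.
- exact: Cc_ints.
- by rewrite /= jl; apply: Jl; exact: mem_head.
- by rewrite /= il; apply: Jl; rewrite !inE eqxx orbT.
Qed.

Lemma coords_int_cat (R : realType) (I : eqType) (l1 l2 : seq I)
    (F : (I -> R) -> R) :
  coords_int (l1 ++ l2) F = coords_int l1 (coords_int l2 F).
Proof. exact: foldr_cat. Qed.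

Lemma coords_int_swap (R : realType) (I : eqType) (J : pred I)
    (F : (I -> R) -> R) (l1 l2 : seq I) : Cc J F -> uniq (l1 ++ l2) ->
  {in l1 ++ l2, forall i, J i} ->
  coords_int l1 (coords_int l2 F) = coords_int l2 (coords_int l1 F).
Proof.
elim: l1 => //= j l1 IH FC /andP[jl ul] Jl.
have Jl' : {in l1 ++ l2, forall i, J i}.
  by move=> i il; apply: Jl; rewrite inE il orbT.
rewrite IH //; apply: (@coords_int_swap1 _ _ [predD J & l1]).
- apply: Cc_ints => //; first by move: ul; rewrite cat_uniq => /andP[].
  by move=> i il; apply: Jl'; rewrite mem_cat il.
- move: jl ul; rewrite mem_cat negb_or /= cat_uniq => /andP[_ ->].
  by move=> /and3P[].
- move=> i; rewrite inE => /orP[/eqP->|il] /=.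
    apply/andP; split; last by apply: Jl; exact: mem_head.
    by move: jl; rewrite mem_cat negb_or => /andP[].
  apply/andP; split; last by apply: Jl'; rewrite mem_cat il orbT.
  move: ul; rewrite cat_uniq => /and3P[_ /hasPn H _].
  exact: H.
Qed.

Lemma coords_int_ge0 (R : realType) (I : eqType) (F : (I -> R) -> R)
    (l : seq I) (z : I -> R) : (forall z, 0 <= F z) -> 0 <= coords_int l F z.
Proof. by move=> F0; elim: l z => //= j l IH z; apply: lint_ge0. Qed.

(** Positivity at [z] survives each integration because the slice through [z] in direction [j]
    passes through [z] itself at parameter [z j]. *)
Lemma coords_int_gt0 (R : realType) (I : eqType) (J : pred I)
    (F : (I -> R) -> R) (l : seq I) (z : I -> R) : Cc J F -> uniq l ->
  {in l, forall i, J i} -> (forall z, 0 <= F z) -> 0 < F z ->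
  0 < coords_int l F z.
Proof.
move=> FC + + F0 Fz; elim: l => //= j l IH /andP[jl ul] Jl.
have Jl' : {in l, forall i, J i} by move=> i il; apply: Jl; rewrite inE il orbT.
have JJ : [predD J & l] j by rewrite /= jl; apply: Jl; exact: mem_head.
have FC' := Cc_ints FC ul Jl'; have [K K0 FK] := Cc_supp FC'.
apply: (@lint_gt0 _ _ K (z j)).
- exact: Cc_slice FC' JJ.
- exact: (upd_supp z FK JJ).
- by move=> t; exact: coords_int_ge0.
- by rewrite upd_same; exact: IH.
Qed.

Lemma coords_int_eq0 (R : realType) (I : eqType) (l : seq I)
    (F : (I -> R) -> R) : (forall z, F z = 0) ->
  forall z, coords_int l F z = 0.
Proof. by move=> F0; elim: l => //= j l IH z; apply: lint_eq0. Qed.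

(** Commuting the integrals brings the one over [j] to the innermost place, where the fundamental
    theorem of calculus makes it vanish. *)
Lemma coords_int_deriv (R : realType) (I : eqType) (J : pred I)
    (F D : (I -> R) -> R) (l : seq I) (j : I) : Cc J F -> Cc J D -> uniq l ->
  {in l, forall i, J i} -> j \in l ->
  (forall (z : I -> R) (t : R),
     is_derive t (1 : R) (fun s => F (upd z j s)) (D (upd z j t))) ->
  forall z, coords_int l D z = 0.
Proof.
move=> FC DC ul Jl jl FD z.
have [l1 [l2 El]] : exists l1 l2, l = l1 ++ j :: l2.
  by case/splitPr: jl => l1 l2; exists l1, l2.
have ul2 : uniq (j :: l2) by move: ul; rewrite El cat_uniq => /and3P[].
rewrite El coords_int_cat /= (@coords_int_swap1 _ _ J) //; last first.
  by move=> i il; apply: Jl; rewrite El mem_cat il orbT.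
apply: coords_int_eq0; apply: coords_int_eq0 => {}z.
have [K K0 FK] := Cc_supp FC; have [L L0 DL] := Cc_supp DC.
have Jj := Jl _ jl.
apply: (@lint_deriv _ (fun t => F (upd z j t)) _ (Num.max K L)) => //.
- exact: Cc_slice DC Jj.
- by move=> t; rewrite gt_max => /andP[tK _]; exact: (upd_supp z FK Jj tK).
- by move=> t; rewrite gt_max => /andP[_ tL]; exact: (upd_supp z DL Jj tL).
Qed.

(** * Compactly supported continuous functions on R^N and R^N x R^N *)

Definition ccont (R : realType) (T : normedModType R) (G : T -> R) : Prop :=
  continuous G /\ exists r : R, forall z, r < `|z| -> G z = 0.

Lemma closed_ball_rV_compact (R : realType) (N : nat) (r : R) :
  compact [set x : 'rV[R]_N | `|x| <= r]%classic.
Proof.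
apply: bounded_closed_compact.
  exists r; split; first exact: num_real.
  by move=> s rs x /= xr; apply: le_trans xr (ltW rs).
apply: (@closed_comp _ _ (fun x : 'rV[R]_N => `|x|) [set t | t <= r]%classic).
  by move=> x _; exact: norm_continuous.
exact: closed_le.
Qed.

Lemma closed_ball_pair_compact (R : realType) (N : nat) (r : R) :
  compact [set z : 'rV[R]_N * 'rV[R]_N | `|z| <= r]%classic.
Proof.
rewrite (_ : [set z | _]%classic =
  ([set x : 'rV[R]_N | `|x| <= r] `*` [set x : 'rV[R]_N | `|x| <= r])%classic).
  by apply: compact_setX; exact: closed_ball_rV_compact.
by apply/seteqP; split => -[x y] /=; rewrite prod_normE /= ge_max => /andP.
Qed.

(** Heine-Cantor by the near-covering form of compactness. Only one of the two points has to lie in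
    [A]: by symmetry either may, and when neither does both values are 0. *)
Lemma compact_supp_modulus (R : realType) (T : normedModType R) (A : set T)
    (G : T -> R) : compact A -> continuous G -> (forall z, ~ A z -> G z = 0) ->
  forall e : R, 0 < e -> exists2 d : R, 0 < d &
    forall z w, `|z - w| <= d -> `|G z - G w| <= e.
Proof.
move=> Ac Gc G0 e e0.
suff [d d0 H] : exists2 d : R, 0 < d &
    forall z, A z -> forall w, `|z - w| <= d -> `|G z - G w| <= e.
  exists d => // z w zw; have [Az|nAz] := pselect (A z); first exact: H.
  have [Aw|nAw] := pselect (A w); first by rewrite distrC H // distrC.
  by rewrite !G0 // subrr normr0 ltW.
have := (compact_near_coveringP A).1 Ac R (0^'+)%classic
  (fun d z => forall w, `|z - w| <= d -> `|G z - G w| <= e) _.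
case.
  move=> z Az; have e2 : 0 < e / 2 by lra.
  have /cvgrPdist_le/(_ _ e2)/nbhs_ballP[d /= d0 Hd] := Gc z.
  exists (ball z (d / 2), [set h : R | h < d / 2]%classic) => /=.
    split; first by apply: nbhsx_ballx; lra.
    by apply: nbhs_right_lt; lra.
  move=> [z' h] [/= zz' hd] w z'w.
  have Gz' : `|G z - G z'| <= e / 2.
    by apply: Hd; apply: (@le_ball _ _ _ (d / 2)) zz'; lra.
  have Gw : `|G z - G w| <= e / 2.
    apply: Hd; rewrite -ball_normE /=; move: zz'; rewrite -ball_normE /= => zz'.
    rewrite -(subrK z' z) -addrA; apply: le_lt_trans (ler_normD _ _) _; lra.
  rewrite -(subrK (G z) (G z')) -addrA; apply: le_trans (ler_normD _ _) _.
  by rewrite distrC; lra.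
move=> d /= d0 Hd; exists (d / 2); first by lra.
move=> z Az w zw; apply: (Hd (d / 2)) => //=; last by lra.
by rewrite sub0r normrN gtr0_norm; lra.
Qed.

Lemma row_coord_norm (R : realType) (N : nat) (x : 'rV[R]_N) (i : 'I_N) :
  `|x 0 i| <= `|x|.
Proof.
rewrite -[leRHS]/(mx_norm x) mx_normrE.
exact: (le_bigmax _ (fun ij : 'I_1 * 'I_N => `|x ij.1 ij.2|) (0, i)).
Qed.

Lemma row_norm_le (R : realType) (N : nat) (x : 'rV[R]_N) (d : R) : 0 <= d ->
  (forall i, `|x 0 i| <= d) -> `|x| <= d.
Proof.
move=> d0 H; rewrite -[leLHS]/(mx_norm x) mx_normrE.
by apply: bigmax_le => // -[j i] _ /=; rewrite ord1.
Qed.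

Definition rowof (R : realType) (N : nat) (z : nat -> R) : 'rV[R]_N :=
  \row_(i < N) z i.

Definition ofrow (R : realType) (N : nat) (x : 'rV[R]_N) : nat -> R :=
  fun n => if insub n is Some i then x 0 i else 0.

Lemma ofrowK (R : realType) (N : nat) (x : 'rV[R]_N) : rowof N (ofrow x) = x.
Proof. by apply/rowP => i; rewrite mxE /ofrow valK. Qed.

Lemma ccont_Cc1 (R : realType) (N : nat) (G : 'rV[R]_N -> R) : ccont G ->
  Cc (fun n => n < N)%N (fun z => G (rowof N z)).
Proof.
move=> [Gc [r Gr]]; split.
  exists r => z j jN zj; apply: Gr; apply: lt_le_trans zj _.
  by have := row_coord_norm (rowof N z) (Ordinal jN); rewrite mxE.
have /= := compact_supp_modulus (@closed_ball_rV_compact R N r) Gc.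
move=> H e e0; have [|d d0 Hd] := H _ _ e0.
  by move=> z /negP; rewrite -ltNge; exact: Gr.
exists d => // z w zw; apply: Hd; apply: row_norm_le; first exact: ltW.
by move=> i; rewrite !mxE; exact: zw.
Qed.

(** The doubled space is indexed by [bool * nat], with [true] for x and [false] for y, so that
    exchanging two N-fold integrals becomes a permutation of a single list of coordinates. *)
Definition join (R : realType) (X Y : nat -> R) : bool * nat -> R :=
  fun bn => if bn.1 then X bn.2 else Y bn.2.

Definition lift2 (R : realType) (N : nat) (G : 'rV[R]_N -> 'rV[R]_N -> R)
  (z : bool * nat -> R) : R :=
  G (rowof N (fun n => z (true, n))) (rowof N (fun n => z (false, n))).

Lemma ccont_Cc2 (R : realType) (N : nat) (G : 'rV[R]_N -> 'rV[R]_N -> R) :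
  ccont (fun z : 'rV[R]_N * 'rV[R]_N => G z.1 z.2) ->
  Cc (fun bn : bool * nat => bn.2 < N)%N (lift2 G).
Proof.
move=> [Gc [r Gr]]; split.
  exists r => z [b j] jN zj; apply: (Gr (_, _)); apply: lt_le_trans zj _.
  rewrite prod_normE /= le_max; apply/orP.
  case: b jN => jN; [left|right].
    have := row_coord_norm (rowof N (fun n => z (true, n))) (Ordinal jN).
    by rewrite mxE.
  have := row_coord_norm (rowof N (fun n => z (false, n))) (Ordinal jN).
  by rewrite mxE.
have /= := compact_supp_modulus (@closed_ball_pair_compact R N r) Gc.
move=> H e e0; have [|d d0 Hd] := H _ _ e0.
  by move=> z /negP; rewrite -ltNge; exact: Gr.
exists d => // z w zw; apply: (Hd (_, _) (_, _)).
rewrite prod_normE /= ge_max; apply/andP; split;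
  (apply: row_norm_le; first exact: ltW); move=> i; rewrite !mxE.
  exact: (zw (true, i : nat) (ltn_ord i)).
exact: (zw (false, i : nat) (ltn_ord i)).
Qed.

(** Descending, since [iter_int] integrates over the highest index outermost. *)
Definition down (k : nat) : seq nat := rev (iota 0 k).

Lemma downS (k : nat) : down k.+1 = k :: down k.
Proof. by rewrite /down -addn1 iotaD rev_cat. Qed.

Lemma down_uniq (k : nat) : uniq (down k).
Proof. by rewrite rev_uniq iota_uniq. Qed.

Lemma mem_down (k i : nat) : (i \in down k) = (i < k)%N.
Proof. by rewrite mem_rev mem_iota. Qed.

Lemma iter_int_coords (R : realType) (k : nat) (F : (nat -> R) -> R) x :
  iter_int k F x = coords_int (down k) F x.
Proof.
elim: k x => // k IH x; rewrite downS /=.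
by congr Rintegral; apply/funext => t; exact: IH.
Qed.

Lemma iter_int_join_l (R : realType) (k : nat) (F : (bool * nat -> R) -> R) X Y :
  iter_int k (fun X => F (join X Y)) X =
  coords_int (map (pair true) (down k)) F (join X Y).
Proof.
elim: k X => // k IH X; rewrite downS /=.
congr Rintegral; apply/funext => t; rewrite IH; congr (coords_int _ _ _).
by apply/funext => -[[] n].
Qed.

Lemma iter_int_join_r (R : realType) (k : nat) (F : (bool * nat -> R) -> R) X Y :
  iter_int k (fun Y => F (join X Y)) Y =
  coords_int (map (pair false) (down k)) F (join X Y).
Proof.
elim: k Y => // k IH Y; rewrite downS /=.
congr Rintegral; apply/funext => t; rewrite IH; congr (coords_int _ _ _).
by apply/funext => -[[] n].
Qed.

Definition integral2 (R : realType) (N : nat) (G : 'rV[R]_N -> 'rV[R]_N -> R) : R :=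
  integralRN (fun x => integralRN (fun y => G x y)).

Lemma integral2_coords (R : realType) (N : nat) (G : 'rV[R]_N -> 'rV[R]_N -> R) :
  integral2 G = coords_int (map (pair true) (down N))
    (coords_int (map (pair false) (down N)) (lift2 G)) (join (fun=> 0) (fun=> 0)).
Proof.
rewrite -iter_int_join_l /integral2 /integralRN.
congr (iter_int _ _ _); apply/funext => X.
by rewrite -iter_int_join_r.
Qed.

Lemma integral2_coords_swap (R : realType) (N : nat) (G : 'rV[R]_N -> 'rV[R]_N -> R) :
  integral2 (fun x y => G y x) = coords_int (map (pair false) (down N))
    (coords_int (map (pair true) (down N)) (lift2 G)) (join (fun=> 0) (fun=> 0)).
Proof.
rewrite -iter_int_join_r /integral2 /integralRN.
congr (iter_int _ _ _); apply/funext => X.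
by rewrite -iter_int_join_l.
Qed.

Definition allc (N : nat) : seq (bool * nat) :=
  map (pair true) (down N) ++ map (pair false) (down N).

Lemma allc_uniq (N : nat) : uniq (allc N).
Proof.
rewrite /allc cat_uniq !map_inj_uniq ?down_uniq; try by move=> x y [].
by rewrite andbT /=; apply/hasPn => -[b n] /mapP[i _ [-> ->]]; apply/mapP => -[].
Qed.

Lemma allc_bound (N : nat) : {in allc N, forall bn, (bn.2 < N)%N}.
Proof.
by move=> bn; rewrite mem_cat => /orP[] /mapP[n]; rewrite mem_down => nN ->.
Qed.

Lemma integral2_allc (R : realType) (N : nat) (G : 'rV[R]_N -> 'rV[R]_N -> R) :
  integral2 G = coords_int (allc N) (lift2 G) (join (fun=> 0) (fun=> 0)).
Proof. by rewrite integral2_coords coords_int_cat. Qed.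

Lemma integral2_swap (R : realType) (N : nat) (G : 'rV[R]_N -> 'rV[R]_N -> R) :
  ccont (fun z : 'rV[R]_N * 'rV[R]_N => G z.1 z.2) ->
  integral2 G = integral2 (fun x y => G y x).
Proof.
move=> /ccont_Cc2 GC; rewrite integral2_coords integral2_coords_swap.
by rewrite (coords_int_swap GC (allc_uniq N) (@allc_bound N)).
Qed.

Lemma integral2D (R : realType) (N : nat) (G H : 'rV[R]_N -> 'rV[R]_N -> R) :
  ccont (fun z : 'rV[R]_N * 'rV[R]_N => G z.1 z.2) ->
  ccont (fun z : 'rV[R]_N * 'rV[R]_N => H z.1 z.2) ->
  integral2 (fun x y => G x y + H x y) = integral2 G + integral2 H.
Proof.
move=> /ccont_Cc2 GC /ccont_Cc2 HC; rewrite !integral2_allc.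
by rewrite (congr1 (@^~ _) (coords_intD GC HC (allc_uniq N) (@allc_bound N))).
Qed.

Lemma integral2Z (R : realType) (N : nat) (r : R) (G : 'rV[R]_N -> 'rV[R]_N -> R) :
  ccont (fun z : 'rV[R]_N * 'rV[R]_N => G z.1 z.2) ->
  integral2 (fun x y => r * G x y) = r * integral2 G.
Proof.
move=> /ccont_Cc2 GC; rewrite !integral2_allc.
by rewrite (congr1 (@^~ _) (coords_intZ r GC (allc_uniq N) (@allc_bound N))).
Qed.

Lemma integral2_ge0 (R : realType) (N : nat) (G : 'rV[R]_N -> 'rV[R]_N -> R) :
  (forall x y, 0 <= G x y) -> 0 <= integral2 G.
Proof. by move=> G0; rewrite integral2_allc; apply: coords_int_ge0 => z; exact: G0. Qed.

(** Lets the base point of a full iterated integral be moved to a point where the integrand is known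
    to be positive. *)
Lemma coords_int_indep (R : realType) (I : eqType) (J : pred I)
    (F : (I -> R) -> R) (l : seq I) (z w : I -> R) : Cc J F ->
  (forall i, J i -> i \notin l -> z i = w i) ->
  coords_int l F z = coords_int l F w.
Proof.
move=> FC; elim: l z w => [|j l IH] z w zw /=.
  have [_ Fu] := FC; apply/eqP; rewrite -subr_eq0 -normr_le0.
  apply/ler_addgt0Pr => e e0; rewrite add0r; have [d d0 Hd] := Fu _ e0.
  by apply: Hd => i Ji; rewrite zw // subrr normr0 ltW.
congr lint; apply/funext => t; apply: IH => i Ji il; rewrite /upd.
by case: eqVneq => // ij; apply: zw => //; rewrite inE negb_or ij.
Qed.

Lemma integral2_gt0 (R : realType) (N : nat) (G : 'rV[R]_N -> 'rV[R]_N -> R) x y :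
  ccont (fun z : 'rV[R]_N * 'rV[R]_N => G z.1 z.2) ->
  (forall x y, 0 <= G x y) -> 0 < G x y -> 0 < integral2 G.
Proof.
move=> /ccont_Cc2 GC G0 Gxy; rewrite integral2_allc.
rewrite (@coords_int_indep _ _ _ _ _ _ (join (ofrow x) (ofrow y)) GC); last first.
  move=> [b n] /= nN; rewrite /allc mem_cat negb_or; case: b => /andP[].
    by rewrite map_f // mem_down.
  by rewrite [X in _ -> ~~ X -> _]map_f // mem_down.
apply: (coords_int_gt0 GC (allc_uniq N) (@allc_bound N)).
  by move=> z; exact: G0.
by rewrite /lift2 /join /= -/(rowof N (ofrow x)) -/(rowof N (ofrow y)) !ofrowK.
Qed.

Lemma integralRN_eq0 (R : realType) (N : nat) (G : 'rV[R]_N -> R) :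
  (forall x, G x = 0) -> integralRN G = 0.
Proof.
by move=> G0; rewrite /integralRN iter_int_coords; apply: coords_int_eq0 => z.
Qed.

Lemma integralRND (R : realType) (N : nat) (G H : 'rV[R]_N -> R) :
  ccont G -> ccont H ->
  integralRN (fun x => G x + H x) = integralRN G + integralRN H.
Proof.
move=> /ccont_Cc1 GC /ccont_Cc1 HC; rewrite /integralRN !iter_int_coords.
rewrite (congr1 (@^~ _) (coords_intD GC HC (down_uniq N) _)) // => i.
by rewrite mem_down.
Qed.

Lemma integralRNZ (R : realType) (N : nat) (r : R) (G : 'rV[R]_N -> R) :
  ccont G -> integralRN (fun x => r * G x) = r * integralRN G.
Proof.
move=> /ccont_Cc1 GC; rewrite /integralRN !iter_int_coords.
rewrite (congr1 (@^~ _) (coords_intZ r GC (down_uniq N) _)) // => i.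
by rewrite mem_down.
Qed.

Lemma is_derive_line (R : realType) (V : normedModType R) (f : V -> R)
    (x v : V) (t c d : R) : is_derive (x + (t - c) *: v) v f d ->
  is_derive t (1 : R) (fun s => f (x + (s - c) *: v)) d.
Proof.
have E : (fun h : R => h^-1 *: ((fun s => f (x + (s - c) *: v)) (h *: (1 : R) + t)
    - f (x + (t - c) *: v))) =
  (fun h : R => h^-1 *: (f (h *: v + (x + (t - c) *: v)) - f (x + (t - c) *: v))).
  apply/funext => h; congr (_ *: (f _ - _)).
  by rewrite [h *: 1]mulr1 -addrA scalerDl addrCA.
move=> [H1 H2]; split; first by rewrite /derivable /= E.
by rewrite /derive /= E.
Qed.

Lemma integralRN_deriv (R : realType) (N : nat) (G D : 'rV[R]_N -> R) (i : 'I_N) :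
  ccont G -> ccont D -> (forall x, is_derive x (ebasis R i) G (D x)) ->
  integralRN D = 0.
Proof.
move=> /ccont_Cc1 GC /ccont_Cc1 DC GD.
rewrite /integralRN iter_int_coords.
apply: (coords_int_deriv (j := i : nat) GC DC (down_uniq N)).
- by move=> n; rewrite mem_down.
- by rewrite mem_down.
move=> z t.
have E s : rowof N (upd z i s) = rowof N z + (s - z i) *: ebasis R i.
  apply/rowP => j; rewrite !mxE /upd -val_eqE /= eq_sym.
  by case: eqP => [->|_]; rewrite ?mulr1 ?mulr0 ?addr0 // addrC subrK.
under eq_fun do rewrite E.
by apply: is_derive_line; rewrite -E.
Qed.

(** * Euclidean calculus and the flux *)

Lemma dotvC (R : realType) (N : nat) (a b : 'rV[R]_N) : dotv a b = dotv b a.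
Proof. by apply: eq_bigr => i _; rewrite mulrC. Qed.

Lemma dotvDl (R : realType) (N : nat) (a b c : 'rV[R]_N) :
  dotv (a + b) c = dotv a c + dotv b c.
Proof. by rewrite /dotv -big_split /=; apply: eq_bigr => i _; rewrite !mxE mulrDl. Qed.

Lemma dotvZl (R : realType) (N : nat) (r : R) (a b : 'rV[R]_N) :
  dotv (r *: a) b = r * dotv a b.
Proof. by rewrite /dotv big_distrr /=; apply: eq_bigr => i _; rewrite !mxE mulrA. Qed.

Lemma dotvDr (R : realType) (N : nat) (a b c : 'rV[R]_N) :
  dotv a (b + c) = dotv a b + dotv a c.
Proof. by rewrite dotvC dotvDl !(dotvC a). Qed.

Lemma dotvZr (R : realType) (N : nat) (r : R) (a b : 'rV[R]_N) :
  dotv a (r *: b) = r * dotv a b.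
Proof. by rewrite dotvC dotvZl (dotvC a). Qed.

Lemma dotvNl (R : realType) (N : nat) (a b : 'rV[R]_N) :
  dotv (- a) b = - dotv a b.
Proof. by rewrite -scaleN1r dotvZl mulN1r. Qed.

Lemma dotvNr (R : realType) (N : nat) (a b : 'rV[R]_N) :
  dotv a (- b) = - dotv a b.
Proof. by rewrite dotvC dotvNl dotvC. Qed.

Lemma dotv_ge0 (R : realType) (N : nat) (a : 'rV[R]_N) : 0 <= dotv a a.
Proof. by apply: sumr_ge0 => i _; rewrite -expr2 sqr_ge0. Qed.

Lemma dotv_eq0 (R : realType) (N : nat) (a : 'rV[R]_N) :
  (dotv a a == 0) = (a == 0).
Proof.
apply/eqP/eqP => [H|->]; last first.
  by rewrite /dotv big1 // => i _; rewrite mxE mul0r.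
apply/rowP => i; rewrite mxE; apply/eqP; rewrite -sqrf_eq0 expr2.
move/eqP: H; rewrite psumr_eq0 => [/allP /(_ i)|j _]; last by rewrite -expr2 sqr_ge0.
by rewrite mem_index_enum /= => /(_ isT).
Qed.

Lemma dotv_gt0 (R : realType) (N : nat) (a : 'rV[R]_N) :
  (0 < dotv a a) = (a != 0).
Proof. by rewrite lt_def dotv_ge0 andbT dotv_eq0. Qed.

Lemma enorm_ge0 (R : realType) (N : nat) (a : 'rV[R]_N) : 0 <= enorm a.
Proof. exact: sqrtr_ge0. Qed.

Lemma enorm_sqr (R : realType) (N : nat) (a : 'rV[R]_N) : enorm a ^+ 2 = dotv a a.
Proof. by rewrite sqr_sqrtr // dotv_ge0. Qed.

Lemma enorm_eq0 (R : realType) (N : nat) (a : 'rV[R]_N) : (enorm a == 0) = (a == 0).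
Proof. by rewrite -sqrf_eq0 enorm_sqr dotv_eq0. Qed.

Lemma enorm_gt0 (R : realType) (N : nat) (a : 'rV[R]_N) : (0 < enorm a) = (a != 0).
Proof. by rewrite lt_def enorm_ge0 andbT enorm_eq0. Qed.

Lemma enormZ (R : realType) (N : nat) (r : R) (a : 'rV[R]_N) :
  enorm (r *: a) = `|r| * enorm a.
Proof.
by rewrite /enorm dotvZl dotvZr mulrA -expr2 sqrtrM ?sqr_ge0 // sqrtr_sqr.
Qed.

Lemma enormN (R : realType) (N : nat) (a : 'rV[R]_N) : enorm (- a) = enorm a.
Proof. by rewrite /enorm dotvNl dotvNr opprK. Qed.

(** Cauchy-Schwarz, from the square of |b| a - |a| b. *)
Lemma dotv_le (R : realType) (N : nat) (a b : 'rV[R]_N) :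
  dotv a b <= enorm a * enorm b.
Proof.
have [->|b0] := eqVneq b 0.
  rewrite -(scale0r 0) dotvZr mul0r; apply: mulr_ge0; exact: enorm_ge0.
have [->|a0] := eqVneq a 0.
  rewrite -(scale0r 0) dotvZl mul0r; apply: mulr_ge0; exact: enorm_ge0.
have := dotv_ge0 (enorm b *: a - enorm a *: b).
rewrite dotvDl !dotvDr !dotvNl !dotvNr !dotvZl !dotvZr -!enorm_sqr (dotvC b a).
rewrite -enorm_gt0 in a0; rewrite -enorm_gt0 in b0.
set A := enorm a in a0 *; set B := enorm b in b0 *; set D := dotv a b.
move=> H; have P : 0 < A * B by exact: mulr_gt0.
have : 0 <= (2 * (A * B)) * (A * B - D) by nra.
by rewrite pmulr_rge0 ?subr_ge0 //; lra.
Qed.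

Lemma dotv_norm_le (R : realType) (N : nat) (a b : 'rV[R]_N) :
  `|dotv a b| <= enorm a * enorm b.
Proof. by rewrite ler_norml lerNl -dotvNl -{1}(enormN a) !dotv_le. Qed.

Lemma enormD (R : realType) (N : nat) (a b : 'rV[R]_N) :
  enorm (a + b) <= enorm a + enorm b.
Proof.
rewrite -(@ler_pXn2r _ 2) ?nnegrE ?addr_ge0 ?enorm_ge0 //.
rewrite sqrrD !enorm_sqr dotvDl !dotvDr (dotvC b a).
by have := dotv_le a b; lra.
Qed.

Lemma coord_le_enorm (R : realType) (N : nat) (a : 'rV[R]_N) i : `|a 0 i| <= enorm a.
Proof.
rewrite -(@ler_pXn2r _ 2) ?nnegrE ?enorm_ge0 // enorm_sqr real_normK ?num_real //.
rewrite /dotv (bigD1 i) //= -expr2 lerDl.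
by apply: sumr_ge0 => j _; rewrite -expr2 sqr_ge0.
Qed.

Lemma norm_le_enorm (R : realType) (N : nat) (a : 'rV[R]_N) : `|a| <= enorm a.
Proof. by apply: row_norm_le; [exact: enorm_ge0 | exact: coord_le_enorm]. Qed.

(** Powers of the norm become powers of a quadratic polynomial, which can be differentiated wherever
    it is positive. *)
Lemma enorm_powR (R : realType) (N : nat) (a : 'rV[R]_N) (r : R) :
  enorm a `^ r = dotv a a `^ (r / 2).
Proof. by rewrite /enorm -powR12_sqrt ?dotv_ge0 // -powRrM mulrC. Qed.

(** The differential of [rflux r] at a nonzero [xi], applied to [h]. Up to the factor r it is also
    the Hessian of |xi|^r, and it serves for the barrier in that role. *)
Definition Dflux (R : realType) (N : nat) (r : R) (xi h : 'rV[R]_N) : 'rV[R]_N :=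
  (enorm xi `^ (r - 2)) *: h + ((r - 2) * enorm xi `^ (r - 4) * dotv xi h) *: xi.

Definition is_vderive (R : realType) (N : nat) (t : R) (c : R -> 'rV[R]_N)
  (d : 'rV[R]_N) := forall j, is_derive t (1 : R) (fun s => c s 0 j) (d 0 j).

Lemma is_derive_bigsum (R : realType) (n : nat) (f : 'I_n -> R -> R) (d : 'I_n -> R)
    (t : R) : (forall k, is_derive t (1 : R) (f k) (d k)) ->
  is_derive t (1 : R) (fun s => \sum_(k < n) f k s) (\sum_(k < n) d k).
Proof.
move=> H; rewrite (_ : (fun s => _) = \sum_(k < n) f k).
  exact: is_derive_sum.
by apply/funext => s; rewrite fct_sumE.
Qed.

Lemma is_derive_mulf (R : realType) (V : normedModType R) (f g : V -> R)
    (x v : V) (a b c : R) : is_derive x v f a -> is_derive x v g b ->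
  c = a * g x + f x * b -> is_derive x v (fun s => f s * g s) c.
Proof.
move=> H G ->; apply: (is_derive_eq (is_deriveM H G)).
by rewrite /GRing.scale /= addrC (mulrC a).
Qed.

Lemma is_derive_powf (R : realType) (f : R -> R) (t a r c : R) :
  is_derive t (1 : R) f a -> 0 < f t -> c = r * f t `^ (r - 1) * a ->
  is_derive t (1 : R) (fun s => f s `^ r) c.
Proof. by move=> H f0 ->; exact: is_derive1_comp (is_derive1_powR r f0) H. Qed.

Lemma is_derive_dotv (R : realType) (N : nat) (t : R) (c e : R -> 'rV[R]_N)
    (d f : 'rV[R]_N) : is_vderive t c d -> is_vderive t e f ->
  is_derive t (1 : R) (fun s => dotv (c s) (e s)) (dotv d (e t) + dotv (c t) f).
Proof.
move=> cd ef; rewrite /dotv -big_split /=; apply: is_derive_bigsum => k.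
exact: is_derive_mulf (cd k) (ef k) _.
Qed.

Lemma is_derive_enorm_pow (R : realType) (N : nat) (t r : R) (c : R -> 'rV[R]_N)
    (d : 'rV[R]_N) : is_vderive t c d -> c t != 0 ->
  is_derive t (1 : R) (fun s => enorm (c s) `^ r)
    (r * enorm (c t) `^ (r - 2) * dotv (c t) d).
Proof.
move=> cd c0; rewrite (_ : (fun s => _) = fun s => dotv (c s) (c s) `^ (r / 2)).
  have Q0 : 0 < dotv (c t) (c t) by rewrite dotv_gt0.
  apply: (is_derive_powf (is_derive_dotv cd cd)) => //.
  rewrite enorm_powR (dotvC d).
  rewrite (_ : (r - 2) / 2 = r / 2 - 1); last by lra.
  by field.
by apply/funext => s; rewrite enorm_powR.
Qed.

Lemma is_vderive_rflux (R : realType) (N : nat) (t r : R) (c : R -> 'rV[R]_N)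
    (d : 'rV[R]_N) : is_vderive t c d -> c t != 0 ->
  is_vderive t (fun s => rflux r (c s)) (Dflux r (c t) d).
Proof.
move=> cd c0 j; have H := is_derive_enorm_pow (r - 2) cd c0.
rewrite (_ : (fun s => _) = fun s => enorm (c s) `^ (r - 2) * c s 0 j); last first.
  by apply/funext => s; rewrite !mxE.
apply: (is_derive_mulf H (cd j)); rewrite !mxE.
rewrite (_ : r - 2 - 2 = r - 4); last by lra.
by ring.
Qed.

(** * The squared positive part, continuity of the fluxes, and C^1 test functions *)

Lemma near_eq_differentiable (R : realType) (V W : normedModType R) (f g : V -> W)
    (x : V) : (\forall y \near x, f y = g y) -> differentiable f x ->
  differentiable g x.
Proof.
move=> fg /diff_locallyP[fc fd].
have gx : g x = f x by rewrite (nbhs_singleton fg).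
have gd : g \o shift x = cst (g x) + 'd f x +o_ 0 id.
  apply/eqaddoP => _/posnumP[e].
  move/eqaddoP : fd => /(_ _ (gt0 e)) fd.
  have fg0 : \forall h \near (0 : V), f (h + x) = g (h + x).
    by move: fg; rewrite (near_shift 0) /= subr0.
  apply: filterS2 fg0 fd => h E; rewrite /= !fctE /= gx E; exact.
have E := diff_unique fc gd.
by apply/diff_locallyP; rewrite E.
Qed.

(** The square makes the positive part C^1, as a test function has to be. *)
Definition sqpos (R : realType) (t : R) : R := Num.max t 0 ^+ 2.

Lemma sqpos_ge0 (R : realType) (t : R) : 0 <= sqpos t.
Proof. exact: sqr_ge0. Qed.

Lemma sqpos_eq0 (R : realType) (t : R) : t <= 0 -> sqpos t = 0.
Proof. by move=> t0; rewrite /sqpos max_r // expr0n. Qed.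

Lemma is_derive_quadratic (R : realType) (f : R -> R) (t d C : R) :
  (forall h, `|f (t + h) - f t - d * h| <= C * h ^+ 2) ->
  is_derive t (1 : R) f d.
Proof.
move=> H; suff L : ((fun h : R => h^-1 *: (f (h *: (1 : R) + t) - f t)) @ 0^' --> d)%classic.
  apply: DeriveDef; last by apply/cvg_lim.
  by apply/cvg_ex; exists d.
apply/cvgrPdist_le => e e0.
have C0 : 0 < `|C| + 1 by have := normr_ge0 C; lra.
near=> h.
have h0 : h != 0 by near: h; exact: nbhs_dnbhs_neq.
have hn : 0 < `|h| by rewrite normr_gt0.
have he : `|h| <= e / (`|C| + 1).
  by near: h; apply: dnbhs0_le; exact: divr_gt0.
rewrite (_ : d - _ = - (h^-1 * (f (t + h) - f t - d * h))); last first.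
  by rewrite /GRing.scale /= mulr1 (addrC h); field.
rewrite normrN normrM normfV ler_pdivrMl //.
apply: le_trans (H h) _; rewrite -real_normK ?num_real // expr2 mulrCA ler_pM2l //.
rewrite ler_pdivlMr // in he; apply: le_trans he.
rewrite mulrC ler_pM2l //; have := ler_norm C; lra.
Unshelve. all: by end_near. Qed.

(** The remainder is at most h^2 for every [t], the kink at 0 included. *)
Lemma is_derive_sqpos (R : realType) (t : R) :
  is_derive t (1 : R) (@sqpos R) (2 * Num.max t 0).
Proof.
apply: (@is_derive_quadratic _ _ _ _ 1) => h; rewrite /sqpos mul1r.
rewrite ler_norml; have := sqr_ge0 h.
case: (lerP t 0) => t0; case: (lerP (t + h) 0) => th0; nra.
Qed.

Lemma cvg_sum (R : realType) (T : Type) (F : set_system T) (FF : Filter F) (n : nat)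
    (f : 'I_n -> T -> R) (a : 'I_n -> R) :
  (forall k, f k x @[x --> F] --> a k)%classic ->
  ((\sum_(k < n) f k x) @[x --> F] --> \sum_(k < n) a k)%classic.
Proof.
elim: n f a => [|n IH] f a fa.
  rewrite big_ord0 (_ : (fun x => _) = fun=> 0); first exact: cvg_cst.
  by apply/funext => t; rewrite big_ord0.
rewrite big_ord_recr /= (_ : (fun x => _) =
    fun t => \sum_(k < n) f (widen_ord (leqnSn n) k) t + f ord_max t); last first.
  by apply/funext => t; rewrite big_ord_recr.
by apply: cvgD; [apply: IH => k; exact: fa | exact: fa].
Qed.

Lemma cvg_coord (R : realType) (N : nat) (T : Type) (F : set_system T)
    (FF : Filter F) (f : T -> 'rV[R]_N) (a : 'rV[R]_N) (i : 'I_N) :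
  (f x @[x --> F] --> a)%classic -> (f x 0 i @[x --> F] --> a 0 i)%classic.
Proof. by move=> fa; apply: (cvg_comp _ (fun v : 'rV[R]_N => v 0 i) fa); exact: coord_continuous. Qed.

Lemma cvg_dotv (R : realType) (N : nat) (T : Type) (F : set_system T)
    (FF : Filter F) (f g : T -> 'rV[R]_N) (a b : 'rV[R]_N) :
  (f x @[x --> F] --> a)%classic -> (g x @[x --> F] --> b)%classic ->
  (dotv (f x) (g x) @[x --> F] --> dotv a b)%classic.
Proof. by move=> fa gb; apply: cvg_sum => i; apply: cvgM; exact: cvg_coord. Qed.

Lemma cvg_enorm (R : realType) (N : nat) (T : Type) (F : set_system T)
    (FF : Filter F) (f : T -> 'rV[R]_N) (a : 'rV[R]_N) :
  (f x @[x --> F] --> a)%classic -> (enorm (f x) @[x --> F] --> enorm a)%classic.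
Proof.
move=> fa; apply: (cvg_comp _ (@Num.sqrt R) (cvg_dotv FF fa fa)).
exact: sqrt_continuous.
Qed.

Lemma powR_cont (R : realType) (r t : R) : 0 < t -> {for t, continuous (@powR R ^~ r)}.
Proof.
move=> t0; apply: differentiable_continuous; apply/derivable1_diffP.
exact: (@ex_derive _ _ _ _ _ _ _ (is_derive1_powR r t0)).
Qed.

Lemma cvg_enorm_pow (R : realType) (N : nat) (T : Type) (F : set_system T)
    (FF : Filter F) (f : T -> 'rV[R]_N) (a : 'rV[R]_N) (r : R) : a != 0 ->
  (f x @[x --> F] --> a)%classic ->
  (enorm (f x) `^ r @[x --> F] --> enorm a `^ r)%classic.
Proof.
move=> a0 fa; apply: (cvg_comp _ (@powR R ^~ r) (cvg_enorm FF fa)).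
by apply: powR_cont; rewrite enorm_gt0.
Qed.

Lemma cvg_rflux (R : realType) (N : nat) (T : Type) (F : set_system T)
    (FF : Filter F) (f : T -> 'rV[R]_N) (a : 'rV[R]_N) (r : R) : a != 0 ->
  (f x @[x --> F] --> a)%classic ->
  (rflux r (f x) @[x --> F] --> rflux r a)%classic.
Proof. by move=> a0 fa; apply: cvgZ => //; exact: cvg_enorm_pow. Qed.

Lemma cvg_Dflux (R : realType) (N : nat) (T : Type) (F : set_system T)
    (FF : Filter F) (f h : T -> 'rV[R]_N) (a b : 'rV[R]_N) (r : R) : a != 0 ->
  (f x @[x --> F] --> a)%classic -> (h x @[x --> F] --> b)%classic ->
  (Dflux r (f x) (h x) @[x --> F] --> Dflux r a b)%classic.
Proof.
move=> a0 fa hb; apply: cvgD; apply: cvgZ => //; first exact: cvg_enorm_pow.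
apply: cvgM; last exact: cvg_dotv.
by apply: cvgM; [exact: cvg_cst | exact: cvg_enorm_pow].
Qed.

Lemma is_derive_of_line (R : realType) (V : normedModType R) (f : V -> R)
    (x v : V) (d : R) :
  is_derive (0 : R) (1 : R) (fun s => f (x + s *: v)) d -> is_derive x v f d.
Proof.
have E : (fun h : R => h^-1 *: ((fun s => f (x + s *: v)) (h *: (1 : R) + 0)
    - f (x + 0 *: v))) = (fun h : R => h^-1 *: (f (h *: v + x) - f x)).
  apply/funext => h; rewrite scale0r !addr0; congr (_ *: (f _ - _)).
  by rewrite [h *: 1]mulr1 addrC.
by move=> [H1 H2]; split; [move: H1; rewrite /derivable /= E |
  move: H2; rewrite /derive /= E].
Qed.

Lemma is_vderive_line (R : realType) (N : nat) (x v : 'rV[R]_N) (t : R) :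
  is_vderive t (fun s => x + s *: v) v.
Proof.
move=> j; rewrite (_ : (fun s => _) = fun s : R => x 0 j + s * v 0 j); last first.
  by apply/funext => s; rewrite !mxE.
apply: (@is_derive_eq _ _ _ _ _ _ _ (0 + (1 * v 0 j + t * 0))); last first.
  by rewrite add0r mulr0 addr0 mul1r.
by apply: is_deriveD; apply: (@is_derive_mulf _ _ id (cst (v 0 j)) _ _ 1 0).
Qed.

Lemma differentiable_enorm_pow (R : realType) (N : nat) (a : 'rV[R]_N) (r : R) :
  a != 0 -> differentiable (fun x : 'rV[R]_N => enorm x `^ r) a.
Proof.
move=> a0; rewrite (_ : (fun x => _) =
  (@powR R ^~ (r / 2)) \o (fun x : 'rV[R]_N => dotv x x)); last first.
  by apply/funext => x /=; rewrite enorm_powR.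
apply: differentiable_comp; last first.
  apply/derivable1_diffP; have a1 : 0 < dotv a a by rewrite dotv_gt0.
  exact: (@ex_derive _ _ _ _ _ _ _ (is_derive1_powR (r / 2) a1)).
rewrite (_ : (fun x => _) = \sum_(i < N) (fun x : 'rV[R]_N => x 0 i * x 0 i)).
  apply: differentiable_sum => i; apply: differentiableM; exact: differentiable_coord.
by apply/funext => x; rewrite fct_sumE.
Qed.

Lemma grad_is_derive (R : realType) (N : nat) (u : 'rV[R]_N -> R) (x : 'rV[R]_N) i :
  differentiable u x -> is_derive x (ebasis R i) u (grad u x 0 i).
Proof.
by move=> du; rewrite mxE; apply: DeriveDef => //; exact: diff_derivable.
Qed.

Lemma cvg_pos_part (R : realType) (T : Type) (F : set_system T) (FF : Filter F)
    (f : T -> R) (a : R) : (f x @[x --> F] --> a)%classic ->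
  (Num.max (f x) 0 @[x --> F] --> Num.max a 0)%classic.
Proof.
move=> fa; apply: (cvg_comp _ (fun t => Num.max t 0) fa).
by apply: (@continuous_max _ R id (fun=> 0)) => //; exact: cvg_cst.
Qed.

Lemma cvg_pos_scale (R : realType) (N : nat) (T : Type) (F : set_system T)
    (FF : Filter F) (f : T -> R) (h : T -> 'rV[R]_N) (a : R) (b : 'rV[R]_N) :
  (f x @[x --> F] --> a)%classic -> (h x @[x --> F] --> b)%classic ->
  ((2 * Num.max (f x) 0) *: h x @[x --> F] --> (2 * Num.max a 0) *: b)%classic.
Proof.
move=> fa hb; apply: cvgZ => //.
by apply: cvgM; [exact: cvg_cst | exact: cvg_pos_part].
Qed.

Lemma cvg_sub_flux (R : realType) (N : nat) (T : Type) (F : set_system T)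
    (FF : Filter F) (f h : T -> 'rV[R]_N) (a b : 'rV[R]_N) (c r : R) : b != 0 ->
  (f x @[x --> F] --> a)%classic -> (h x @[x --> F] --> b)%classic ->
  (f x - c *: rflux r (h x) @[x --> F] --> a - c *: rflux r b)%classic.
Proof.
move=> b0 fa hb; apply: cvgB => //.
by apply: cvgZ; [exact: cvg_cst | exact: cvg_rflux].
Qed.

(** The term |x - y|^gam may be singular at x = y, but [w y < 0] makes [W] negative near [y], so its
    squared positive part vanishes there and the singularity is never seen. *)
Lemma C1_penalized (R : realType) (N : nat) (w : 'rV[R]_N -> R) (y : 'rV[R]_N)
    (a gam : R) : C1 w -> 0 <= a -> w y < 0 ->
  let W x := w x - a * enorm (x - y) `^ gam in
  C1 (fun x => sqpos (W x)) /\
  forall x, grad (fun x => sqpos (W x)) x =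
    (2 * Num.max (W x) 0) *: (grad w x - (a * gam) *: rflux gam (x - y)).
Proof.
move=> [dw cw] a0 wy W.
have wc x : {for x, continuous w} by exact: differentiable_continuous.
have Ww x : W x <= w x by rewrite /W lerBlDr lerDl mulr_ge0 // powR_ge0.
have Wy : \forall x \near y, W x < 0.
  have : \forall x \near y, w x < 0 by apply: (cvgr_lt _ (wc y)).
  by apply: filterS => x; exact: le_lt_trans.
have Wy0 : \forall x \near y, 0 = sqpos (W x).
  by apply: filterS Wy => x Wx; rewrite sqpos_eq0 // ltW.
have dW x : x != y -> differentiable W x.
  rewrite -subr_eq0 => xy; apply: differentiableB => //.
  apply: differentiableM; first exact: differentiable_cst.
  apply: (differentiable_comp (g := fun x => enorm x `^ gam)).
    by apply: differentiableB => //; exact: differentiable_cst.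
  exact: differentiable_enorm_pow.
have dphi x : differentiable (fun x => sqpos (W x)) x.
  have [->|xy] := eqVneq x y.
    exact: near_eq_differentiable Wy0 (differentiable_cst _ _).
  apply: (differentiable_comp (dW _ xy)); apply/derivable1_diffP.
  exact: (@ex_derive _ _ _ _ _ _ _ (is_derive_sqpos (W x))).
have gphi x : grad (fun x => sqpos (W x)) x =
    (2 * Num.max (W x) 0) *: (grad w x - (a * gam) *: rflux gam (x - y)).
  apply/rowP => i; rewrite mxE; apply: derive_val.
  have [->|xy] := eqVneq x y.
    rewrite max_r ?(ltW (nbhs_singleton Wy)) // mulr0 scale0r mxE.
    exact: near_eq_is_derive Wy0 (is_derive_cst _ _ _).
  apply: is_derive_of_line.
  pose c (s : R) := (x - y) + s *: ebasis R i.
  have c0 : c 0 = x - y by rewrite /c scale0r addr0.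
  have cE : (fun s : R => x + s *: ebasis R i - y) = c.
    by apply/funext => s; rewrite /c addrAC.
  have D1 : is_derive (0 : R) (1 : R) (fun s => w (x + s *: ebasis R i)) (grad w x 0 i).
    have := @is_derive_line _ _ w x (ebasis R i) 0 0 (grad w x 0 i).
    rewrite subrr scale0r addr0 => /(_ (grad_is_derive _ (dw x))).
    by under eq_fun do rewrite subr0.
  have D2 : is_derive (0 : R) (1 : R)
      (fun s => enorm (x + s *: ebasis R i - y) `^ gam)
      (gam * enorm (x - y) `^ (gam - 2) * dotv (x - y) (ebasis R i)).
    have := @is_derive_enorm_pow _ _ 0 gam c _ (@is_vderive_line _ _ (x - y) _ 0).
    rewrite c0 subr_eq0 => /(_ xy); rewrite -cE; exact.
  have dotE : dotv (x - y) (ebasis R i) = (x - y) 0 i.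
    rewrite /dotv (bigD1 i) //= !mxE eqxx mulr1 big1 ?addr0 // => j ji.
    by rewrite !mxE eq_sym (negbTE ji) mulr0.
  have D3 : is_derive (0 : R) (1 : R) (fun s => W (x + s *: ebasis R i))
     (grad w x 0 i - a * (gam * enorm (x - y) `^ (gam - 2) * (x - y) 0 i)).
    apply: is_deriveB => //; apply: (is_derive_mulf (is_derive_cst a _ _) D2).
    by rewrite mul0r add0r dotE.
  have S : is_derive (W (x + 0 *: ebasis R i)) (1 : R) (@sqpos R)
      (2 * Num.max (W x) 0).
    by rewrite scale0r addr0; exact: is_derive_sqpos.
  have H := @is_derive1_comp _ (@sqpos R) (fun s => W (x + s *: ebasis R i)) _ _ _ S D3.
  apply: (@is_derive_eq _ _ _ _ _ _ _ _ H).
  by rewrite !mxE; ring.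
split=> //; split=> // x; rewrite (funext gphi).
have [->|xy] := eqVneq x y.
  have Z : \forall z \near y, (2 * Num.max (W z) 0) *:
      (grad w z - (a * gam) *: rflux gam (z - y)) = 0.
    by apply: filterS Wy => z Wz; rewrite max_r ?ltW // mulr0 scale0r.
  have := @near_cst_continuous _ _ _ _ _ Z; exact.
have FF := @nbhs_filter _ x.
apply: (cvg_pos_scale FF); first exact: differentiable_continuous (dW _ xy).
apply: (cvg_sub_flux FF); first by rewrite subr_eq0.
- exact: cw.
- by apply: cvgB; [exact: cvg_id | exact: cvg_cst].
Qed.

(** * Monotonicity and the reflection coupling *)

Lemma dotvBl (R : realType) (N : nat) (a b c : 'rV[R]_N) :
  dotv (a - b) c = dotv a c - dotv b c.
Proof. by rewrite dotvDl dotvNl. Qed.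

Lemma dotvBr (R : realType) (N : nat) (a b c : 'rV[R]_N) :
  dotv a (b - c) = dotv a b - dotv a c.
Proof. by rewrite dotvDr dotvNr. Qed.

Lemma powR_sub2 (R : realType) (x r : R) : 0 < x -> x `^ (r - 2) = x `^ r / x ^+ 2.
Proof.
move=> x0; rewrite powRD; last by rewrite (gt_eqF x0) implybT.
by rewrite powRN powR_mulrn // ltW.
Qed.

(** Both the power of the length and the squared component along a vector are stable in a relative
    sense, with [theta] independent of [b]: everything reduces to the ratio of the lengths and to
    the angle between [z] and [b]. *)
Lemma flux_stable (R : realType) (N : nat) (r eps : R) : 0 < eps ->
  exists2 theta : R, 0 < theta & forall b z : 'rV[R]_N, b != 0 ->
    enorm (z - b) <= theta * enorm b ->
    [/\ z != 0, `|enorm z `^ r - enorm b `^ r| <= eps * enorm b `^ r &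
     forall X, `|dotv z X ^+ 2 / enorm z ^+ 2 - dotv b X ^+ 2 / enorm b ^+ 2|
       <= eps * dotv X X].
Proof.
move=> eps0.
have /cvgrPdist_le/(_ _ eps0)/nbhs_ballP[d /= d0 Hd] := @powR_cont R r 1 ltr01.
exists (Num.min (d / 2) (Num.min (1 / 2) (eps / 8))).
  by rewrite !lt_min !divr_gt0.
set theta := Num.min _ _ => b z b0 zb.
have [t1 t2 t3] : [/\ theta <= d / 2, theta <= 1 / 2 & theta <= eps / 8].
  by rewrite /theta; split; rewrite !ge_min lexx ?orbT.
have B0 : 0 < enorm b by rewrite enorm_gt0.
have zle : enorm z - enorm b <= enorm (z - b).
  by rewrite lerBlDr -{1}(subrK b z) enormD.
have ble : enorm b - enorm z <= enorm (z - b).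
  by rewrite lerBlDr -(enormN (z - b)) opprB -{1}(subrK z b) enormD.
have [th1 th2] : theta * enorm b <= 1 / 2 * enorm b /\
    theta * enorm b <= eps / 8 * enorm b by split; apply: ler_wpM2r => //; exact: ltW.
have Z0 : 0 < enorm z by lra.
have zne : z != 0 by rewrite -enorm_gt0.
split=> //.
  (* By homogeneity only the continuity of t^r at t = 1 is needed. *)
  pose nu := enorm z / enorm b.
  have Ez : enorm z = nu * enorm b by rewrite /nu divfK // gt_eqF.
  have nu0 : 0 <= nu by rewrite /nu divr_ge0 // ltW.
  rewrite {1}Ez powRM ?(ltW B0) // -{2}(mul1r (enorm b `^ r)) -mulrBl normrM.
  rewrite (ger0_norm (powR_ge0 _ _)); apply: ler_wpM2r; first exact: powR_ge0.
  have := Hd nu; rewrite powR1 distrC; apply; rewrite /ball /=.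
  have -> : 1 - nu = (enorm b - enorm z) / enorm b.
    by rewrite /nu; field; rewrite gt_eqF.
  rewrite normf_div (ger0_norm (ltW B0)) ltr_pdivrMr //.
  have : `|enorm b - enorm z| <= theta * enorm b by rewrite ler_norml; lra.
  by move=> /le_lt_trans; apply; rewrite ltr_pM2r //; lra.
move=> X.
set Z := enorm z in Z0 zle ble *; set B := enorm b in B0 th1 th2 zle ble zb *.
have DX := dotv_le X X; have X0 := enorm_ge0 X; rewrite -enorm_sqr.
set x := enorm X in X0 *.
(* A difference of squares; its first factor is small because the unit vectors along [z] and [b] are
   close. *)
have E1 : dotv z X ^+ 2 / Z ^+ 2 - dotv b X ^+ 2 / B ^+ 2 =
  (dotv (B *: z - Z *: b) X) * (B * dotv z X + Z * dotv b X) / (Z ^+ 2 * B ^+ 2).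
  by rewrite dotvBl !dotvZl; field; rewrite !gt_eqF.
have H1 : `|dotv (B *: z - Z *: b) X| <= 2 * (theta * B) * B * x.
  apply: le_trans (dotv_norm_le _ _) _; apply: ler_wpM2r => //.
  have -> : B *: z - Z *: b = B *: (z - b) + (B - Z) *: b.
    by rewrite scalerBr scalerBl addrA subrK.
  apply: le_trans (enormD _ _) _; rewrite !enormZ (ger0_norm (ltW B0)) -/B.
  have : `|B - Z| <= theta * B by rewrite ler_norml; lra.
  by move=> H; nra.
have H2 : `|B * dotv z X + Z * dotv b X| <= 2 * (B * Z * x).
  apply: le_trans (ler_normD _ _) _; rewrite !normrM.
  rewrite (ger0_norm (ltW B0)) (ger0_norm (ltW Z0)).
  have := dotv_norm_le z X; have := dotv_norm_le b X; rewrite -/Z -/B -/x => h1 h2.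
  have := ler_wpM2l (ltW Z0) h1; have := ler_wpM2l (ltW B0) h2; lra.
have P : 0 < Z ^+ 2 * B ^+ 2 by rewrite mulr_gt0 // exprn_gt0.
rewrite E1 normrM normfV (ger0_norm (ltW P)) ler_pdivrMr // normrM.
apply: le_trans (ler_pM _ _ H1 H2) _ => //.
have HZ : B <= 2 * Z by lra.
have x2 : 0 <= x ^+ 2 by exact: sqr_ge0.
have tB : 0 <= theta * B by exact: le_trans (enorm_ge0 _) zb.
have -> : 2 * (theta * B) * B * x * (2 * (B * Z * x)) =
  (theta * B) * (4 * B * Z * B) * x ^+ 2 by ring.
have -> : eps * x ^+ 2 * (Z ^+ 2 * B ^+ 2) = eps / 8 * B * (4 * (2 * Z) * Z * B) * x ^+ 2.
  by field.
apply: ler_wpM2r => //; apply: ler_pM => //.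
  by rewrite !mulr_ge0 // ltW.
apply: ler_wpM2r; first exact: ltW.
have BZ := ler_wpM2r (ltW Z0) HZ; lra.
Qed.

Lemma is_vderive_cst (R : realType) (N : nat) (X : 'rV[R]_N) (t : R) :
  is_vderive t (fun=> X) 0.
Proof. by move=> j; rewrite mxE; exact: is_derive_cst. Qed.

(** The quadratic form of [Dflux s b] with the factor |b|^(s-2) removed. *)
Definition qform (R : realType) (N : nat) (s : R) (b X : 'rV[R]_N) : R :=
  dotv X X + (s - 2) * (dotv b X ^+ 2 / enorm b ^+ 2).

Lemma dotv_sqr_le (R : realType) (N : nat) (b X : 'rV[R]_N) : b != 0 ->
  dotv b X ^+ 2 / enorm b ^+ 2 <= dotv X X.
Proof.
move=> b0; have B0 : 0 < enorm b by rewrite enorm_gt0.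
rewrite ler_pdivrMr ?exprn_gt0 // -enorm_sqr -exprMn mulrC -[leLHS]real_normK ?num_real //.
rewrite ler_pXn2r ?nnegrE ?mulr_ge0 ?enorm_ge0 //; exact: dotv_norm_le.
Qed.

(** The eigenvalues are 1 across [b] and s - 1 along [b]. *)
Lemma qform_ge (R : realType) (N : nat) (s : R) (b X : 'rV[R]_N) : 1 < s -> b != 0 ->
  Num.min 1 (s - 1) * dotv X X <= qform s b X.
Proof.
move=> s1 b0; rewrite /qform; have := dotv_sqr_le X b0; have X0 := dotv_ge0 X.
have : 0 <= dotv b X ^+ 2 / enorm b ^+ 2 by rewrite divr_ge0 // sqr_ge0.
set be := _ / _ => be0 bX; case: (lerP 2 s) => s2.
  have -> : Num.min 1 (s - 1) = 1 by apply: min_l; lra.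
  by nra.
have -> : Num.min 1 (s - 1) = s - 1 by apply: min_r; lra.
by nra.
Qed.

Lemma dotv_Dflux (R : realType) (N : nat) (s : R) (z X : 'rV[R]_N) : z != 0 ->
  dotv (Dflux s z X) X = enorm z `^ (s - 2) * qform s z X.
Proof.
move=> z0; have Z0 : 0 < enorm z by rewrite enorm_gt0.
rewrite dotvDl !dotvZl (_ : s - 4 = s - 2 - 2) ?powR_sub2 //; last by lra.
rewrite /qform; field.
by rewrite gt_eqF.
Qed.

(** Mean value theorem along the segment from [xi'] to [xi]. By convexity the segment stays in the
    ball around [b], which avoids the origin, and there the linearized flux is a relative
    perturbation of the one at [b]. *)
Lemma flux_monotone (R : realType) (N : nat) (s del : R) : 1 < s -> 0 < del ->
  del < 1 ->
  exists2 theta : R, 0 < theta & forall b xi xi' : 'rV[R]_N, b != 0 ->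
    enorm (xi - b) <= theta * enorm b -> enorm (xi' - b) <= theta * enorm b ->
    (1 - del) * (enorm b `^ (s - 2) * qform s b (xi - xi')) <=
    dotv (rflux s xi - rflux s xi') (xi - xi').
Proof.
move=> s1 del0 del1.
pose mu := Num.min 1 (s - 1).
have mu0 : 0 < mu by rewrite /mu lt_min ltr01; lra.
have s2 : 0 < `|s - 2| + 1 by have := normr_ge0 (s - 2); lra.
(* Half of [del] pays for the power of the length and half for the direction, the latter measured
   against the ellipticity constant [mu]; indeed (1 - del/2)^2 >= 1 - del. The summand 1 in the
   denominator covers s = 2. *)
pose eps := Num.min (del / 2) (del / 2 * mu / (`|s - 2| + 1)).
have eps0 : 0 < eps.
  by rewrite /eps lt_min !divr_gt0 // !mulr_gt0 // ?divr_gt0 // invr_gt0.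
have eps1 : eps <= del / 2 by rewrite /eps ge_min lexx.
have eps2 : `|s - 2| * eps <= del / 2 * mu.
  have : eps <= del / 2 * mu / (`|s - 2| + 1) by rewrite /eps ge_min lexx orbT.
  rewrite ler_pdivlMr // mulrDr; have := mulr_ge0 (ltW eps0) (normr_ge0 (s - 2)).
  lra.
have [theta th0 H] := @flux_stable R N (s - 2) eps eps0.
exists theta => // b xi xi' b0 h h'; set X := xi - xi'.
pose c (t : R) := xi' + t *: X.
have cin (t : R) : 0 <= t <= 1 -> enorm (c t - b) <= theta * enorm b.
  move=> /andP[t0 t1].
  have -> : c t - b = t *: (xi - b) + (1 - t) *: (xi' - b).
    by rewrite /c /X; apply/rowP => j; rewrite !mxE; ring.
  apply: le_trans (enormD _ _) _; rewrite !enormZ !ger0_norm ?subr_ge0 //.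
  have t1' : 0 <= 1 - t by lra.
  have := ler_wpM2l t0 h; have := ler_wpM2l t1' h'; lra.
pose g (t : R) := dotv (rflux s (c t)) X.
have gd (t : R) : 0 <= t <= 1 ->
    is_derive t (1 : R) g (enorm (c t) `^ (s - 2) * qform s (c t) X).
  move=> /cin /(H _ _ b0)[ct0 _ _]; rewrite -dotv_Dflux //.
  have D := is_derive_dotv (is_vderive_rflux s (@is_vderive_line _ _ xi' X t) ct0)
    (@is_vderive_cst _ _ X t).
  by apply: (is_derive_eq D); rewrite -(scale0r X) dotvZr mul0r addr0.
pose dg (t : R) := enorm (c t) `^ (s - 2) * qform s (c t) X.
have gd' (t : R) : t \in `]0, 1[ -> is_derive t (1 : R) g (dg t).
  by rewrite in_itv /= => /andP[a1 a2]; apply: gd; rewrite !ltW.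
have gc : {within `[0, 1], continuous g}%classic.
  apply: derivable_within_continuous => t; rewrite in_itv /= => t01.
  exact: (@ex_derive _ _ _ _ _ _ _ (gd t t01)).
have [t t01 E] := MVT_segment ler01 gd' gc.
have {E} -> : dotv (rflux s xi - rflux s xi') X =
    enorm (c t) `^ (s - 2) * qform s (c t) X.
  rewrite dotvBl; move: E; rewrite subr0 mulr1 /g /dg /c => <-.
  have EX : xi' + X = xi by rewrite /X addrC subrK.
  by rewrite scale0r scale1r addr0 EX.
move: t01; rewrite in_itv /= => /cin /(H _ _ b0)[ct0 H1 H2].
have := H2 X; have := qform_ge X s1 b0; rewrite -/mu /qform.
set al := dotv (c t) X ^+ 2 / _; set be := dotv b X ^+ 2 / _.
set B := enorm b `^ _ in H1 *; set Z := enorm (c t) `^ _ in H1 *.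
have B0 : 0 <= B by exact: powR_ge0.
have X0 := dotv_ge0 X; set x := dotv X X in X0 *.
move=> Q0 ab.
have S : `|(s - 2) * (al - be)| <= del / 2 * (x + (s - 2) * be).
  rewrite normrM; apply: le_trans (ler_wpM2l (normr_ge0 _) ab) _.
  rewrite mulrA; apply: le_trans (ler_wpM2r X0 eps2) _.
  have d20 : 0 <= del / 2 by lra.
  by have := ler_wpM2l d20 Q0; rewrite mulrA.
have Q1 : 0 <= x + (s - 2) * be.
  by apply: le_trans Q0; rewrite mulr_ge0 // ltW.
have ZB : (1 - del / 2) * B <= Z.
  have := ler_wpM2r B0 eps1; move: H1; rewrite ler_norml; lra.
have QQ : (1 - del / 2) * (x + (s - 2) * be) <= x + (s - 2) * al.
  move: S; rewrite ler_norml; lra.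
have d2 : 0 <= 1 - del / 2 by lra.
apply: le_trans (ler_pM _ _ ZB QQ); rewrite ?mulr_ge0 //.
have : 0 <= B * (x + (s - 2) * be) by rewrite mulr_ge0.
set y := x + _ => By; nra.
Qed.

(* The Hessian-weighted reflection across the hyperplane orthogonal to [b]:
   eigenvalue [|b|^(s-2)] on that hyperplane and [- (s-1) |b|^(s-2)] along [b]. *)
Definition cpl (R : realType) (N : nat) (s : R) (b v : 'rV[R]_N) : 'rV[R]_N :=
  enorm b `^ (s - 2) *: (v - (s * (dotv b v / enorm b ^+ 2)) *: b).

Lemma cplD (R : realType) (N : nat) (s : R) (b v w : 'rV[R]_N) :
  cpl s b (v + w) = cpl s b v + cpl s b w.
Proof. by apply/rowP => i; rewrite !mxE dotvDr; ring. Qed.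

Lemma cplZ (R : realType) (N : nat) (s r : R) (b v : 'rV[R]_N) :
  cpl s b (r *: v) = r *: cpl s b v.
Proof. by apply/rowP => i; rewrite !mxE dotvZr; ring. Qed.

Lemma cplN (R : realType) (N : nat) (s : R) (b v : 'rV[R]_N) :
  cpl s b (- v) = - cpl s b v.
Proof. by rewrite -scaleN1r cplZ scaleN1r. Qed.

Lemma cpl_sym (R : realType) (N : nat) (s : R) (b v w : 'rV[R]_N) :
  dotv (cpl s b v) w = dotv v (cpl s b w).
Proof. by rewrite dotvZl dotvBl dotvZl dotvZr dotvBr dotvZr (dotvC v b); ring. Qed.

(** Split X = X' + al e and Y = Y' + be e with e the unit vector along [b]. Apart from the factor
    |b|^(s-2), the right side minus the left is |X' - Y'|^2 + (s - 1)(al + be)^2. This is where the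
    reflected sign along [b] is used. *)
Lemma cpl_le (R : realType) (N : nat) (s : R) (b X Y : 'rV[R]_N) :
  1 < s -> b != 0 ->
  2 * dotv (cpl s b X) Y <= enorm b `^ (s - 2) * (qform s b X + qform s b Y).
Proof.
move=> s1 b0; have B0 : 0 < enorm b by rewrite enorm_gt0.
rewrite dotvZl mulrCA; apply: ler_wpM2l; first exact: powR_ge0.
pose al := dotv b X / enorm b; pose be := dotv b Y / enorm b.
have Q v : dotv b v ^+ 2 / enorm b ^+ 2 = (dotv b v / enorm b) ^+ 2.
  by rewrite expr_div_n.
rewrite /qform !Q -/al -/be dotvBl dotvZl.
have -> : s * (dotv b X / enorm b ^+ 2) * dotv b Y = s * (al * be).
  by rewrite /al /be; field; rewrite gt_eqF.
have := dotv_ge0 ((X - (al / enorm b) *: b) - (Y - (be / enorm b) *: b)).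
have -> : dotv ((X - (al / enorm b) *: b) - (Y - (be / enorm b) *: b))
     ((X - (al / enorm b) *: b) - (Y - (be / enorm b) *: b)) =
   dotv X X + dotv Y Y - 2 * dotv X Y - (al - be) ^+ 2.
  rewrite !(dotvBl, dotvBr, dotvZl, dotvZr) (dotvC Y X) (dotvC X b) (dotvC Y b).
  rewrite -(enorm_sqr b) /al /be; field; rewrite gt_eqF //.
have := sqr_ge0 (al + be); nra.
Qed.

(** * Traces against the Hessian of the barrier, and the gain from the coupling *)

Lemma dotv_ebasis (R : realType) (N : nat) (a : 'rV[R]_N) i :
  dotv a (ebasis R i) = a 0 i.
Proof.
rewrite /dotv (bigD1 i) //= !mxE eqxx mulr1 big1 ?addr0 // => j ji.
by rewrite !mxE eq_sym (negbTE ji) mulr0.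
Qed.

(** The matrix c I - k z z^T has the shape of the Hessian of a radial function; this sum and the
    next ones are traces of products with it. *)
Lemma trace_rank1 (R : realType) (N : nat) (c k : R) (z v w : 'rV[R]_N) :
  \sum_(i < N) dotv v (c *: ebasis R i - (k * z 0 i) *: z) * w 0 i =
  c * dotv v w - k * (dotv v z * dotv z w).
Proof.
have E i : dotv v (c *: ebasis R i - (k * z 0 i) *: z) * w 0 i =
    c * (v 0 i * w 0 i) - k * dotv v z * (z 0 i * w 0 i).
  by rewrite dotvBr !dotvZr dotv_ebasis; ring.
under eq_bigr do rewrite E.
by rewrite sumrB -!mulr_sumr mulrA.
Qed.

Lemma trace_id (R : realType) (N : nat) (c k : R) (z : 'rV[R]_N) :
  \sum_(i < N) (c *: ebasis R i - (k * z 0 i) *: z) 0 i =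
  c * N%:R - k * dotv z z.
Proof.
under eq_bigr do rewrite !mxE eqxx mulr1.
rewrite sumrB sumr_const card_ord -[c *+ N]mulr_natr /dotv mulr_sumr.
by congr (_ - _); apply: eq_bigr => i _; rewrite mulrA.
Qed.

Lemma trace_Dflux (R : realType) (N : nat) (s c k : R) (z v : 'rV[R]_N) : v != 0 ->
  \sum_(i < N) Dflux s v (c *: ebasis R i - (k * z 0 i) *: z) 0 i =
  enorm v `^ (s - 2) * (c * N%:R - k * dotv z z +
     (s - 2) * (c - k * (dotv v z ^+ 2 / enorm v ^+ 2))).
Proof.
move=> v0; have V0 : 0 < enorm v by rewrite enorm_gt0.
have E i : Dflux s v (c *: ebasis R i - (k * z 0 i) *: z) 0 i =
  enorm v `^ (s - 2) * (c *: ebasis R i - (k * z 0 i) *: z) 0 i +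
  (s - 2) * enorm v `^ (s - 4) *
    (dotv v (c *: ebasis R i - (k * z 0 i) *: z) * v 0 i).
  by rewrite mxE [X in X + _]mxE [X in _ + X]mxE mulrA.
under eq_bigr do rewrite E.
rewrite big_split /= -!mulr_sumr trace_id trace_rank1.
rewrite (_ : s - 4 = s - 2 - 2) ?powR_sub2 //; last by lra.
rewrite (dotvC z v) -(enorm_sqr v); field.
by rewrite gt_eqF.
Qed.

Lemma trace_cpl (R : realType) (N : nat) (s c k h : R) (z : 'rV[R]_N) :
  z != 0 -> 0 < h ->
  \sum_(i < N) cpl s (h *: z) (c *: ebasis R i - (k * z 0 i) *: z) 0 i =
  enorm (h *: z) `^ (s - 2) * (c * N%:R - k * dotv z z - s * (c - k * dotv z z)).
Proof.
move=> z0 h0; have Z0 : 0 < enorm z by rewrite enorm_gt0.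
set b := h *: z; have bE : enorm b = h * enorm z.
  by rewrite enormZ ger0_norm // ltW.
have E i : cpl s b (c *: ebasis R i - (k * z 0 i) *: z) 0 i =
  enorm b `^ (s - 2) * (c *: ebasis R i - (k * z 0 i) *: z) 0 i -
  enorm b `^ (s - 2) * s / enorm b ^+ 2 *
    (dotv b (c *: ebasis R i - (k * z 0 i) *: z) * b 0 i).
  rewrite mxE [X in _ * X]mxE mulrDr; congr (_ + _).
  by rewrite !mxE; ring.
under eq_bigr do rewrite E.
rewrite sumrB -!mulr_sumr trace_id trace_rank1 bE /b.
rewrite !dotvZl !dotvZr -enorm_sqr; field.
by rewrite !gt_eqF.
Qed.

(** The Hessian h I - k z z^T has eigenvalue h across [z] and - h (1 - gam) along [z]. With b = h z
    and sig = (s - 1)(1 - gam), its trace against [Dflux s b] is h |b|^(s-2) (N - 1 - sig), while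
    against [cpl s b] it is h |b|^(s-2) (N - 1 + sig), since the reflection reverses the concave
    direction. Twice the second minus twice the first is 4 sig h |b|^(s-2); part of this is spent on
    the damping, on [kap], and on replacing b by [z1] and [z2]. *)
Lemma coupling_gain (R : realType) (N : nat) (s gam del : R) :
  1 < s -> 0 < gam -> gam < 1 -> 0 < del -> del < 1 ->
  del * (N%:R + s) <= (s - 1) * (1 - gam) / 2 ->
  exists theta kap0 : R, [/\ 0 < theta, 0 < kap0 &
    forall (z z1 z2 : 'rV[R]_N) (h kap k : R), z != 0 -> 0 < h -> 0 <= kap ->
    kap <= kap0 * h ->
    enorm (z1 - h *: z) <= theta * enorm (h *: z) ->
    enorm (z2 - h *: z) <= theta * enorm (h *: z) ->
    k = h * (2 - gam) / enorm z ^+ 2 ->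
    (s - 1) * (1 - gam) * (h * enorm (h *: z) `^ (s - 2)) <=
    2 * ((1 - del) *
      \sum_(i < N) cpl s (h *: z) (h *: ebasis R i - (k * z 0 i) *: z) 0 i)
    - \sum_(i < N) Dflux s z1 ((h + 4 * kap) *: ebasis R i - (k * z 0 i) *: z) 0 i
    - \sum_(i < N) Dflux s z2 ((h + 4 * kap) *: ebasis R i - (k * z 0 i) *: z) 0 i].
Proof.
move=> s1 g0 g1 del0 del1 delN.
pose sig := (s - 1) * (1 - gam); pose K := N%:R + s + 2 : R.
have sig0 : 0 < sig by rewrite mulr_gt0; lra.
have sig_s : sig <= s - 1 by rewrite /sig; nra.
have N0 : 0 <= N%:R :> R by [].
have K0 : 0 < K by rewrite /K; lra.
(* Each direct trace is allowed the error 7 eps K: 3 eps K for [kap] and the direction of the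
   gradient, 4 eps K for the power of its length. This choice keeps it below [sig]. *)
pose eps := Num.min 1 (sig / (7 * K)).
have eps0 : 0 < eps by rewrite /eps lt_min ltr01 divr_gt0 // mulr_gt0.
have eps1 : eps <= 1 by rewrite /eps ge_min lexx.
have epsK : 7 * (eps * K) <= sig.
  have : eps <= sig / (7 * K) by rewrite /eps ge_min lexx orbT.
  by rewrite ler_pdivlMr ?mulr_gt0 //; lra.
have [theta th0 H] := @flux_stable R N (s - 2) eps eps0.
(* The factor 1/4 matches the 4 [kap] contributed by two quadratic penalties. *)
exists theta, (eps / 4); split => //; first lra.
move=> z z1 z2 h kap k z0 h0 kap0 kaph H1 H2 kE.
have Z0 : 0 < enorm z by rewrite enorm_gt0.
have b0 : h *: z != 0 by rewrite scaler_eq0 negb_or z0 gt_eqF.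
have Zz : dotv z z = enorm z ^+ 2 by rewrite enorm_sqr.
have kz : k * dotv z z = h * (2 - gam) by rewrite Zz kE divfK // gt_eqF // exprn_gt0.
set B := enorm (h *: z) `^ (s - 2).
have B0 : 0 <= B by exact: powR_ge0.
have T v : enorm (v - h *: z) <= theta * enorm (h *: z) ->
  \sum_(i < N) Dflux s v ((h + 4 * kap) *: ebasis R i - (k * z 0 i) *: z) 0 i <=
  h * B * (N%:R - 1 - sig + 7 * (eps * K)).
  move=> /(H _ _ b0)[v0 Hp Hq]; rewrite trace_Dflux // kz.
  have := Hq z; rewrite dotvZl Zz enormZ (ger0_norm (ltW h0)).
  have -> : (h * enorm z ^+ 2) ^+ 2 / (h * enorm z) ^+ 2 = enorm z ^+ 2.
    by field; rewrite !gt_eqF.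
  set w := dotv v z ^+ 2 / enorm v ^+ 2 => Hw.
  pose err := w / enorm z ^+ 2 - 1.
  have kw : k * w = h * (2 - gam) * (1 + err).
    by rewrite kE /err; field; rewrite gt_eqF.
  have Herr : `|err| <= eps.
    have -> : err = (w - enorm z ^+ 2) / enorm z ^+ 2.
      by rewrite /err; field; rewrite gt_eqF.
    rewrite normf_div (ger0_norm (sqr_ge0 _)) ler_pdivrMr ?exprn_gt0 //.
  rewrite kw.
  pose e := 4 * (kap / h) * (N%:R + s - 2) - (s - 2) * (2 - gam) * err.
  have -> : (h + 4 * kap) * N%:R - h * (2 - gam) +
     (s - 2) * (h + 4 * kap - h * (2 - gam) * (1 + err)) =
     h * (N%:R - 1 - sig + e).
    by rewrite /e /sig; field; rewrite gt_eqF.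
  have He : `|e| <= 3 * (eps * K).
    have ka : 0 <= kap / h <= eps / 4.
      by apply/andP; split; [apply: divr_ge0 => //; exact: ltW | rewrite ler_pdivrMr].
    have E1 : `|4 * (kap / h) * (N%:R + s - 2)| <= eps * K.
      rewrite normrM ger0_norm; last by case/andP: ka => *; lra.
      apply: ler_pM => //; first by case/andP: ka => *; lra.
      - by case/andP: ka => *; lra.
      - by rewrite /K ler_norml; lra.
    have E2 : `|(s - 2) * (2 - gam) * err| <= 2 * (eps * K).
      rewrite normrM.
      have : `|(s - 2) * (2 - gam)| <= 2 * K.
        rewrite normrM [2 * K]mulrC; apply: ler_pM => //.
          by rewrite /K ler_norml; lra.
        by rewrite ler_norml; lra.
      move=> E2; apply: le_trans (ler_pM _ _ E2 Herr) _ => //.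
      by rewrite -mulrA (mulrC K).
    apply: le_trans (ler_normB _ _) _; lra.
  set V := enorm v `^ (s - 2) in Hp *.
  have T0 : `|N%:R - 1 - sig| <= K by rewrite /K ler_norml; lra.
  have eK : 0 <= eps * K by rewrite mulr_ge0 // ltW.
  have TE : `|N%:R - 1 - sig + e| <= K + 3 * (eps * K).
    by apply: le_trans (ler_normD _ _) _; exact: lerD.
  have eeK : eps * (K + 3 * (eps * K)) <= 4 * (eps * K).
    have : eps * (eps * K) <= 1 * (eps * K) by apply: ler_wpM2r.
    lra.
  rewrite mulrCA -mulrA; apply: ler_wpM2l; first exact: ltW.
  have -> : V = B + (V - B) by ring.
  rewrite mulrDl.
  have D : (V - B) * (N%:R - 1 - sig + e) <= B * (4 * (eps * K)).
    apply: le_trans (ler_norm _) _; rewrite normrM.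
    apply: le_trans (ler_pM _ _ Hp TE) _ => //.
    by rewrite -/B (mulrC eps) -mulrA; apply: ler_wpM2l.
  apply: le_trans (lerD (lexx _) D) _; rewrite -mulrDr; apply: ler_wpM2l => //.
  move: He; rewrite ler_norml; lra.
rewrite trace_cpl // kz -/B.
have := T _ H1; have := T _ H2; set S1 := \sum_(i < N) _; set S2 := \sum_(i < N) _.
move=> t2 t1.
apply: le_trans (lerB (lerB (lexx _) t1) t2).
have hB : 0 <= h * B by rewrite mulr_ge0 // ltW.
have -> : (s - 1) * (1 - gam) * (h * B) = h * B * sig by rewrite /sig; ring.
have -> : 2 * ((1 - del) * (B * (h * N%:R - h * (2 - gam) - s * (h - h * (2 - gam)))))
   - h * B * (N%:R - 1 - sig + 7 * (eps * K)) - h * B * (N%:R - 1 - sig + 7 * (eps * K))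
  = h * B * (4 * sig - 14 * (eps * K) - 2 * (del * (N%:R - 1 + sig))).
  by rewrite /sig; ring.
apply: ler_wpM2l => //.
(* Of the gain 4 sig, the errors of the two traces take at most 2 sig and the damping at most
   sig. *)
have : del * (N%:R - 1 + sig) <= del * (N%:R + s) by apply: ler_wpM2l; lra.
rewrite -/sig in delN; lra.
Qed.

(** * Testing the equation against a comparison field *)

(** [G] will be a flux expression, singular where a gradient or x - y vanishes; it has to behave
    well only on [K], because [F] removes it elsewhere. *)
Lemma ccont_mul_local (R : realType) (V : normedModType R) (K : set V) (r : R)
    (F G : V -> R) : closed K -> (forall z, K z -> `|z| <= r) ->
  continuous F -> (forall z, ~ K z -> F z = 0) ->
  (forall z, K z -> (G x @[x --> z] --> G z)%classic) ->
  ccont (fun z => F z * G z).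
Proof.
move=> Kc Kr Fc F0 Gc; split; last first.
  exists r => z rz; rewrite F0 ?mul0r // => /Kr; apply/negP.
  by rewrite -ltNge.
move=> z; have [Kz|nKz] := pselect (K z).
  by apply: cvgM; [exact: Fc | exact: Gc].
have H : \forall x \near z, F x * G x = 0.
  have : nbhs z (~` K)%classic by apply: open_nbhs_nbhs; split => //; exact: closed_openC.
  by apply: filterS => x nKx; rewrite F0 // mul0r.
exact: near_cst_continuous H.
Qed.

Lemma ccontD (R : realType) (V : normedModType R) (F G : V -> R) :
  ccont F -> ccont G -> ccont (fun z => F z + G z).
Proof.
move=> [Fc [r Fr]] [Gc [s Gs]]; split.
  by move=> z; apply: cvgD; [exact: Fc | exact: Gc].
exists (Num.max r s) => z; rewrite gt_max => /andP[rz sz].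
by rewrite Fr // Gs // addr0.
Qed.

Lemma ccontZ (R : realType) (V : normedModType R) (c : R) (F : V -> R) :
  ccont F -> ccont (fun z => c * F z).
Proof.
move=> [Fc [r Fr]]; split.
  by move=> z; apply: cvgM; [exact: cvg_cst | exact: Fc].
by exists r => z rz; rewrite Fr // mulr0.
Qed.

Lemma ccont_sum (R : realType) (V : normedModType R) (n : nat) (F : 'I_n -> V -> R) :
  (forall k, ccont (F k)) -> ccont (fun z => \sum_(k < n) F k z).
Proof.
elim: n F => [|n IH] F FC.
  rewrite (_ : (fun _ => _) = fun=> 0).
    by split; [move=> z; exact: cvg_cst | exists 0].
  by apply/funext => z; rewrite big_ord0.
rewrite (_ : (fun _ => _) =
    fun t => \sum_(k < n) F (widen_ord (leqnSn n) k) t + F ord_max t).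
  by apply: ccontD => //; apply: IH.
by apply/funext => t; rewrite big_ord_recr.
Qed.

Lemma integralRN_sum (R : realType) (N n : nat) (F : 'I_n -> 'rV[R]_N -> R) :
  (forall k, ccont (F k)) ->
  integralRN (fun x => \sum_(k < n) F k x) = \sum_(k < n) integralRN (F k).
Proof.
elim: n F => [|n IH] F FC.
  by rewrite big_ord0 integralRN_eq0 // => x; rewrite big_ord0.
rewrite big_ord_recr /= -IH // -integralRND //; last exact: ccont_sum.
by congr integralRN; apply/funext => x; rewrite big_ord_recr.
Qed.

Lemma cvg_f2 (R : realType) (N : nat) (f : R -> 'rV[R]_N -> R) (T : Type)
    (F : set_system T) (FF : Filter F) (g : T -> R) (h : T -> 'rV[R]_N) a b :
  continuous (fun z : R * 'rV[R]_N => f z.1 z.2) ->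
  (g x @[x --> F] --> a)%classic -> (h x @[x --> F] --> b)%classic ->
  (f (g x) (h x) @[x --> F] --> f a b)%classic.
Proof.
move=> fc ga hb.
exact: (cvg_comp (fun x => (g x, h x)) (fun z => f z.1 z.2) (cvg_pair ga hb) (fc (a, b))).
Qed.

Lemma coord_cvg_at (R : realType) (N : nat) (T : topologicalType)
    (f : T -> 'rV[R]_N) (z : T) (i : 'I_N) : (f x @[x --> z] --> f z)%classic ->
  (f x 0 i @[x --> z] --> f z 0 i)%classic.
Proof. by move=> fz; exact: (cvg_coord (nbhs_filter z) fz). Qed.

Lemma dotv_cvg_local (R : realType) (N : nat) (K : set 'rV[R]_N) (r : R)
    (F G : 'rV[R]_N -> 'rV[R]_N) : closed K -> (forall z, K z -> `|z| <= r) ->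
  continuous F -> (forall z, ~ K z -> F z = 0) ->
  (forall z, K z -> (G x @[x --> z] --> G z)%classic) ->
  ccont (fun z => dotv (G z) (F z)).
Proof.
move=> Kc Kr Fc F0 Gc; apply: ccont_sum => i.
rewrite (_ : (fun z => _) = fun z => F z 0 i * G z 0 i); last first.
  by apply/funext => z; rewrite mulrC.
apply: (ccont_mul_local Kc Kr).
- by move=> z; apply: coord_cvg_at; exact: Fc.
- by move=> z nKz; rewrite F0 // mxE.
- by move=> z Kz; apply: coord_cvg_at; exact: Gc.
Qed.

Lemma grad_eq0 (R : realType) (N : nat) (phi : 'rV[R]_N -> R) (x : 'rV[R]_N) :
  (\forall y \near x, 0 = phi y) -> grad phi x = 0.
Proof.
move=> H; apply/rowP => i; rewrite !mxE; apply: derive_val.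
exact: near_eq_is_derive H (is_derive_cst _ _ _).
Qed.

(** The weak equation for [phi], minus the vanishing integral of div (phi T). Only the comparison
    field [T] is differentiated, and only on [K]. *)
Lemma weak_slice (R : realType) (N : nat) (p q : R) (f : R -> 'rV[R]_N -> R)
    (u phi : 'rV[R]_N -> R) (T : 'rV[R]_N -> 'rV[R]_N)
    (D : 'I_N -> 'rV[R]_N -> R) (K : set 'rV[R]_N) (r : R) :
  is_solution p q f u -> C1 phi -> continuous (fun z : R * 'rV[R]_N => f z.1 z.2) ->
  closed K -> (forall x, K x -> enorm x <= r) -> (forall x, ~ K x -> phi x = 0) ->
  (forall x, K x -> grad u x != 0) ->
  (forall x, K x -> (T y @[y --> x] --> T x)%classic) ->
  (forall i x, K x -> (D i y @[y --> x] --> D i x)%classic) ->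
  (forall x i, K x -> is_derive x (ebasis R i) (fun y => T y 0 i) (D i x)) ->
  integralRN (fun x =>
    dotv (rflux p (grad u x) + rflux q (grad u x) - T x) (grad phi x)
    - (f (u x) (grad u x) + \sum_(i < N) D i x) * phi x) = 0.
Proof.
move=> [[du cu] sol] [dphi cphi] fc Kc Kr phi0 u0 Tc Dc TD.
have Kr' x : K x -> `|x| <= r by move=> /Kr; apply: le_trans; exact: norm_le_enorm.
have uc x : (u y @[y --> x] --> u x)%classic by exact: differentiable_continuous.
have phic : continuous phi by move=> x; exact: differentiable_continuous.
have near0 x : ~ K x -> \forall y \near x, 0 = phi y.
  move=> nKx; have : nbhs x (~` K)%classic.
    by apply: open_nbhs_nbhs; split => //; exact: closed_openC.
  by apply: filterS => y /phi0.
have gphi0 x : ~ K x -> grad phi x = 0 by move=> /near0; exact: grad_eq0.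
have C1cphi : C1c phi.
  split=> //; exists r => x rx; apply: phi0 => /Kr; apply/negP.
  by rewrite -ltNge.
have fl s : ccont (fun x => dotv (rflux s (grad u x)) (grad phi x)).
  apply: (dotv_cvg_local Kc Kr') => // z Kz; apply: (cvg_rflux (nbhs_filter z)); first exact: u0.
  exact: cu.
have fphi : ccont (fun x => f (u x) (grad u x) * phi x).
  rewrite (_ : (fun x => _) = fun x => phi x * f (u x) (grad u x)).
    by apply: (ccont_mul_local Kc Kr') => // z Kz; exact: (cvg_f2 (nbhs_filter z) fc (uc z) (cu z)).
  by apply/funext => x; rewrite mulrC.
(* The i-th partial derivative of [T x 0 i * phi x]. *)
pose Q i x := D i x * phi x + T x 0 i * grad phi x 0 i.
have QC i : ccont (Q i).
  apply: ccontD.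
    rewrite (_ : (fun x => _) = fun x => phi x * D i x).
      by apply: (ccont_mul_local Kc Kr') => // z Kz; exact: Dc.
    by apply/funext => x; rewrite mulrC.
  rewrite (_ : (fun x => _) = fun x => grad phi x 0 i * T x 0 i).
    apply: (ccont_mul_local Kc Kr').
    - by move=> z; apply: coord_cvg_at; exact: cphi.
    - by move=> z /gphi0 ->; rewrite mxE.
    - by move=> z Kz; apply: coord_cvg_at; exact: Tc.
  by apply/funext => x; rewrite mulrC.
have Q0 i : integralRN (Q i) = 0.
  apply: (@integralRN_deriv _ _ (fun x => T x 0 i * phi x) _ i) => //.
    rewrite (_ : (fun x => _) = fun x => phi x * T x 0 i).
      by apply: (ccont_mul_local Kc Kr') => // z Kz; apply: coord_cvg_at; exact: Tc.
    by apply/funext => x; rewrite mulrC.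
  move=> x; have [Kx|nKx] := pselect (K x).
    exact: is_derive_mulf (TD x i Kx) (grad_is_derive i (dphi x)) _.
  rewrite /Q phi0 // gphi0 // mxE !mulr0 addr0.
  apply: near_eq_is_derive (is_derive_cst (0 : R) _ _).
  by apply: filterS (near0 _ nKx) => y <-; rewrite mulr0.
have -> : (fun x =>
    dotv (rflux p (grad u x) + rflux q (grad u x) - T x) (grad phi x)
    - (f (u x) (grad u x) + \sum_(i < N) D i x) * phi x) =
  (fun x => (dotv (rflux p (grad u x)) (grad phi x)
     + dotv (rflux q (grad u x)) (grad phi x)) +
     -1 * (f (u x) (grad u x) * phi x + \sum_(i < N) Q i x)).
  apply/funext => x; rewrite dotvBl dotvDl mulN1r /Q big_split /= -mulr_suml.
  by rewrite /dotv; ring.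
have QsC := ccont_sum QC.
have Qs0 : integralRN (fun x => \sum_(i < N) Q i x) = 0.
  by rewrite integralRN_sum // big1.
have flC := ccontD (fl p) (fl q); have fQC := ccontD fphi QsC.
rewrite (integralRND flC (ccontZ (-1) fQC)) integralRNZ //.
rewrite (integralRND (fl p) (fl q)) (integralRND fphi QsC) sol // Qs0.
by rewrite addr0 mulN1r subrr.
Qed.

(** * Penalization and the equation along a slice *)

Lemma enorm_pow_continuous (R : realType) (N : nat) (r : R) : 0 < r ->
  continuous (fun x : 'rV[R]_N => enorm x `^ r).
Proof.
move=> r0.
have E0 : enorm (0 : 'rV[R]_N) = 0 by apply/eqP; rewrite enorm_eq0.
have C0 : (enorm y `^ r @[y --> (0 : 'rV[R]_N)] --> (0 : R))%classic.
  apply/(@cvgrPdist_le _ _ _ _ (nbhs_filter (0 : 'rV[R]_N))) => e e0.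
  have d0 : 0 < e `^ r^-1 by exact: powR_gt0.
  have H : \forall y \near (0 : 'rV[R]_N), enorm y < e `^ r^-1.
    have := cvg_enorm (nbhs_filter (0 : 'rV[R]_N)) (@cvg_id _ (nbhs (0 : 'rV[R]_N))).
    by rewrite E0 => H; apply: (cvgr_lt _ H).
  have /nbhs_ballP[d /= d1 Hd] := H.
  apply/nbhs_ballP; exists d => //= y /Hd /= /ltW ye; rewrite sub0r normrN ger0_norm ?powR_ge0 //.
  have := @ge0_ler_powR _ _ (ltW r0) _ _ (enorm_ge0 y) (ltW d0) ye.
  by rewrite -powRrM mulVf ?gt_eqF // powRr1 // ltW.
move=> x; have [->|x0] := eqVneq x 0; last exact: (cvg_enorm_pow (nbhs_filter x)).
by move: C0; rewrite /continuous_at E0 powR0 ?gt_eqF.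
Qed.

Definition sqd (R : realType) (N : nat) (c x : 'rV[R]_N) : R := dotv (x - c) (x - c).

Lemma sqd_ge0 (R : realType) (N : nat) (c x : 'rV[R]_N) : 0 <= sqd c x.
Proof. exact: dotv_ge0. Qed.

(** [W] is bounded but need not attain its supremum. The penalty is centred at a point (x0, y0)
    where [W] is within [kap] of it; once the squared distance to that point exceeds 1 the penalty
    costs more than this gap, so maximizing over a compact set is enough. *)
Lemma penalized_max (R : realType) (N : nat) (W : 'rV[R]_N -> 'rV[R]_N -> R)
    (kap B : R) (X Y : 'rV[R]_N) :
  continuous (fun z : 'rV[R]_N * 'rV[R]_N => W z.1 z.2) ->
  (forall x y, W x y <= B) -> 0 < kap ->
  exists x0 y0 x1 y1, [/\ enorm (x1 - x0) <= 1, enorm (y1 - y0) <= 1,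
    W X Y - kap <= W x1 y1 - kap * (sqd x0 x1 + sqd y0 y1) &
    forall x y, W x y - kap * (sqd x0 x + sqd y0 y) <=
                W x1 y1 - kap * (sqd x0 x1 + sqd y0 y1)].
Proof.
move=> Wc WB k0.
pose A := [set W z.1 z.2 | z in [set: 'rV[R]_N * 'rV[R]_N]]%classic.
have Asup : has_sup A.
  by split; [exists (W X Y), (X, Y) | exists B => _ [z _ <-]].
have [_ [[x0 y0] _ <-] /= H0] := sup_adherent k0 Asup.
have WS x y : W x y <= sup A by apply: sup_upper_bound => //; exists (x, y).
pose h (z : 'rV[R]_N * 'rV[R]_N) :=
  W (x0 + z.1) (y0 + z.2) - kap * (dotv z.1 z.1 + dotv z.2 z.2).
have hc (z : 'rV[R]_N * 'rV[R]_N) : (h w @[w --> z] --> h z)%classic.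
  have c1 : (w.1 @[w --> z] --> z.1)%classic by exact: cvg_fst.
  have c2 : (w.2 @[w --> z] --> z.2)%classic by exact: cvg_snd.
  apply: cvgB.
    have c3 : ((x0 + w.1, y0 + w.2) @[w --> z] --> (x0 + z.1, y0 + z.2))%classic.
      exact: (cvg_pair (cvgD (cvg_cst x0) c1) (cvgD (cvg_cst y0) c2)).
    exact: (cvg_comp _ (fun z => W z.1 z.2) c3 (Wc (x0 + z.1, y0 + z.2))).
  have c4 : (dotv w.1 w.1 + dotv w.2 w.2 @[w --> z] --> dotv z.1 z.1 + dotv z.2 z.2)%classic.
    exact: (cvgD (cvg_dotv _ c1 c1) (cvg_dotv _ c2 c2)).
  exact: (cvgM (cvg_cst kap) c4).
pose K := [set z : 'rV[R]_N * 'rV[R]_N | `|z| <= 1]%classic.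
have K0 : K (0, 0) by rewrite /K /= prod_normE /= !normr0 maxxx ler01.
have [|[x1 y1] z1K Hz] := @compact_EVT_max _ _ h K (ex_intro _ _ K0)
  (@closed_ball_pair_compact R N 1).
  exact: continuous_subspaceT.
have h0 : h (0, 0) = W x0 y0.
  have d0 : dotv (0 : 'rV[R]_N) 0 = 0 by apply/eqP; rewrite dotv_eq0.
  by rewrite /h /= !addr0 d0 addr0 mulr0 subr0.
have h1 : W x0 y0 <= h (x1, y1) by rewrite -h0; apply: Hz; rewrite inE.
have small x y : W x0 y0 <= h (x, y) -> dotv x x + dotv y y <= 1.
  rewrite /h /= => Hh; have := WS (x0 + x) (y0 + y).
  move=> Wle; rewrite leNgt; apply/negP => gt1.
  have : kap * 1 < kap * (dotv x x + dotv y y) by rewrite ltr_pM2l.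
  lra.
have le1 (v : 'rV[R]_N) : dotv v v <= 1 -> enorm v <= 1.
  by move=> v1; rewrite -(@ler_pXn2r _ 2) ?nnegrE ?enorm_ge0 // enorm_sqr expr1n.
exists x0, y0, (x0 + x1), (y0 + y1).
have s1 := small _ _ h1; have dx := dotv_ge0 x1; have dy := dotv_ge0 y1.
rewrite /sqd !(addrC _ x1) !(addrC _ y1) !addrK (addrC x1) (addrC y1).
split.
- apply: le1; lra.
- apply: le1; lra.
- apply: le_trans h1; have := WS X Y; lra.
move=> x y.
have -> : W x y - kap * (dotv (x - x0) (x - x0) + dotv (y - y0) (y - y0)) =
    h (x - x0, y - y0) by rewrite /h /= !(addrC _ (_ - _)) !subrK.
have [zK|zK] := boolP ((x - x0, y - y0) \in K); first exact: Hz.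
apply: (le_trans _ h1); rewrite leNgt; apply/negP => /ltW /small s.
move/negP: zK; apply; rewrite inE /K /= prod_normE /= ge_max.
have := dotv_ge0 (x - x0); have := dotv_ge0 (y - y0) => a1 a2.
by apply/andP; split; apply: le_trans (norm_le_enorm _) _; apply: le1; lra.
Qed.

Lemma C1_penalty (R : realType) (N : nat) (u : 'rV[R]_N -> R) (s c kap : R)
    (x0 x1 : 'rV[R]_N) : C1 u ->
  let w x := s * u x + c - kap * sqd x0 x - kap * sqd x1 x in
  C1 w /\ forall x, grad w x =
    s *: grad u x - (2 * kap) *: (x - x0) - (2 * kap) *: (x - x1).
Proof.
move=> [du cu] w.
have dsq a x : differentiable (fun x : 'rV[R]_N => sqd a x) x.
  rewrite (_ : (fun x => _) =
      \sum_(i < N) (fun x : 'rV[R]_N => (x 0 i - a 0 i) * (x 0 i - a 0 i))).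
    apply: differentiable_sum => i; apply: differentiableM;
    by apply: differentiableB; [exact: differentiable_coord | exact: differentiable_cst].
  by apply/funext => y; rewrite fct_sumE; apply: eq_bigr => i _; rewrite !mxE.
have isq a x i : is_derive x (ebasis R i) (fun x : 'rV[R]_N => sqd a x)
    (2 * (x - a) 0 i).
  apply: is_derive_of_line.
  have V := @is_vderive_line _ _ (x - a) (ebasis R i) 0.
  have := is_derive_dotv V V.
  rewrite scale0r addr0 (dotvC (ebasis R i)) dotv_ebasis => D.
  rewrite (_ : (fun t => _) = fun t => dotv (x - a + t *: ebasis R i)
      (x - a + t *: ebasis R i)); last by apply/funext => t; rewrite /sqd addrAC.
  by apply: (is_derive_eq D); ring.
have dw x : differentiable w x.
  apply: differentiableB; last first.
    by apply: differentiableM => //; exact: differentiable_cst.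
  apply: differentiableB; last first.
    by apply: differentiableM => //; exact: differentiable_cst.
  apply: differentiableD; last exact: differentiable_cst.
  by apply: differentiableM => //; exact: differentiable_cst.
have gw x : grad w x =
    s *: grad u x - (2 * kap) *: (x - x0) - (2 * kap) *: (x - x1).
  apply/rowP => i; rewrite mxE; apply: derive_val.
  have cst a : is_derive x (ebasis R i) (fun=> a : R) 0 by exact: is_derive_cst.
  have D : is_derive x (ebasis R i) w
     ((s * grad u x 0 i + 0) - kap * (2 * (x - x0) 0 i) - kap * (2 * (x - x1) 0 i)).
    have A1 : is_derive x (ebasis R i) (fun y => s * u y) (s * grad u x 0 i).
      by apply: (is_derive_mulf (cst s) (grad_is_derive i (du x))); ring.
    have A2 a : is_derive x (ebasis R i) (fun y => kap * sqd a y) (kap * (2 * (x - a) 0 i)).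
      by apply: (is_derive_mulf (cst kap) (isq a x i)); ring.
    exact: (is_deriveB (is_deriveB (is_deriveD A1 (cst c)) (A2 x0)) (A2 x1)).
  by apply: (is_derive_eq D); rewrite !mxE; ring.
split=> //; split=> //; rewrite (funext gw).
have xa a (x : 'rV[R]_N) : ((y - a) @[y --> x] --> x - a)%classic.
  exact: (cvgB cvg_id (cvg_cst a)).
move=> x; exact: (cvgB (cvgB (cvgZ (cvg_cst s) (cu x))
  (cvgZ (cvg_cst (2 * kap)) (xa x0 x))) (cvgZ (cvg_cst (2 * kap)) (xa x1 x))).
Qed.

Lemma is_vderiveD (R : realType) (N : nat) (t : R) (c d : R -> 'rV[R]_N)
    (c' d' : 'rV[R]_N) : is_vderive t c c' -> is_vderive t d d' ->
  is_vderive t (fun s => c s + d s) (c' + d').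
Proof.
move=> H1 H2 j; rewrite mxE (_ : (fun s => _) = fun s => c s 0 j + d s 0 j).
  exact: is_deriveD.
by apply/funext => s; rewrite mxE.
Qed.

Lemma is_vderiveZ (R : realType) (N : nat) (t r : R) (c : R -> 'rV[R]_N)
    (c' : 'rV[R]_N) : is_vderive t c c' -> is_vderive t (fun s => r *: c s) (r *: c').
Proof.
move=> H j; rewrite mxE (_ : (fun s => _) = fun s => r * c s 0 j).
  by apply: (is_derive_mulf (is_derive_cst r _ _) (H j)); rewrite mul0r add0r.
by apply/funext => s; rewrite mxE.
Qed.

Lemma is_vderive_cpl (R : realType) (N : nat) (t s : R) (b : 'rV[R]_N)
    (c : R -> 'rV[R]_N) (c' : 'rV[R]_N) : is_vderive t c c' ->
  is_vderive t (fun r => cpl s b (c r)) (cpl s b c').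
Proof.
move=> H; have D := is_derive_dotv (@is_vderive_cst _ _ b t) H.
rewrite -(scale0r b) dotvZl mul0r add0r in D.
move=> j; pose m := enorm b `^ (s - 2); pose n := s / enorm b ^+ 2 * b 0 j.
rewrite (_ : (fun r => _) = fun r => m * (c r 0 j - n * dotv b (c r))); last first.
  by apply/funext => r; rewrite !mxE /m /n; ring.
have A : is_derive t (1 : R) (fun r => n * dotv b (c r)) (n * dotv b c').
  by apply: (is_derive_mulf (is_derive_cst n _ _) D); rewrite mul0r add0r.
apply: (is_derive_mulf (is_derive_cst m _ _) (is_deriveB (H j) A)).
by rewrite mul0r add0r !mxE /= /m /n; set E := (enorm b ^+ 2)^-1; ring.
Qed.

Lemma cvg_cst_at (T : Type) (F : set_system T) (FF : Filter F) (U : topologicalType)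
    (a : U) : ((fun=> a) @ F --> a)%classic.
Proof. exact: cvg_cst. Qed.

Lemma cvgD_at (R : realType) (V : normedModType R) (T : Type) (F : set_system T)
    (FF : Filter F) (f g : T -> V) (a b : V) : (f x @[x --> F] --> a)%classic ->
  (g x @[x --> F] --> b)%classic -> (f x + g x @[x --> F] --> a + b)%classic.
Proof. exact: cvgD. Qed.

Lemma cvgB_at (R : realType) (V : normedModType R) (T : Type) (F : set_system T)
    (FF : Filter F) (f g : T -> V) (a b : V) : (f x @[x --> F] --> a)%classic ->
  (g x @[x --> F] --> b)%classic -> (f x - g x @[x --> F] --> a - b)%classic.
Proof. exact: cvgB. Qed.

Lemma cvgM_at (R : realType) (T : Type) (F : set_system T)
    (FF : Filter F) (f g : T -> R) (a b : R) : (f x @[x --> F] --> a)%classic ->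
  (g x @[x --> F] --> b)%classic -> (f x * g x @[x --> F] --> a * b)%classic.
Proof. exact: cvgM. Qed.

Lemma cvgZ_at (R : realType) (V : normedModType R) (T : Type) (F : set_system T)
    (FF : Filter F) (f : T -> R) (g : T -> V) (a : R) (b : V) :
  (f x @[x --> F] --> a)%classic -> (g x @[x --> F] --> b)%classic ->
  (f x *: g x @[x --> F] --> a *: b)%classic.
Proof. exact: cvgZ. Qed.

Lemma cvg_cpl (R : realType) (N : nat) (T : Type) (F : set_system T)
    (FF : Filter F) (f : T -> 'rV[R]_N) (a b : 'rV[R]_N) (s : R) :
  (f x @[x --> F] --> a)%classic -> (cpl s b (f x) @[x --> F] --> cpl s b a)%classic.
Proof.
move=> fa; have D := cvg_dotv FF (@cvg_cst_at _ _ FF _ b) fa.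
have D2 := cvgM_at FF (@cvg_cst_at _ _ FF _ s) (cvgM_at FF D (@cvg_cst_at _ _ FF _ (enorm b ^+ 2)^-1)).
exact: (cvgZ_at FF (@cvg_cst_at _ _ FF _ (enorm b `^ (s - 2))) (cvgB_at FF fa (cvgZ_at FF D2 (@cvg_cst_at _ _ FF _ b)))).
Qed.

(** The gradient of a |z|^gam; [bhess] is the Hessian applied to [e]. *)
Definition bgrad (R : realType) (N : nat) (a gam : R) (z : 'rV[R]_N) : 'rV[R]_N :=
  (a * gam) *: rflux gam z.

Definition bhess (R : realType) (N : nat) (a gam : R) (z e : 'rV[R]_N) : 'rV[R]_N :=
  (a * gam) *: Dflux gam z e.

Definition cpl2 (R : realType) (N : nat) (p q del : R) (b v : 'rV[R]_N) : 'rV[R]_N :=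
  (1 - del) *: (cpl p b v + cpl q b v).

(** The gradient of u at [x] predicted by the penalty: where s u - Psi is critical in x, grad u
    equals s times the x-gradient of Psi. *)
Definition pgrad (R : realType) (N : nat) (s a gam kap : R) (y x0 x1 x : 'rV[R]_N) :
  'rV[R]_N :=
  s *: (bgrad a gam (x - y) + (2 * kap) *: (x - x0) + (2 * kap) *: (x - x1)).

Definition ograd (R : realType) (N : nat) (s a gam : R) (y k x : 'rV[R]_N) :
  'rV[R]_N := s *: (bgrad a gam (x - y) - k).

(** The i-th term of the divergence in x of the two fluxes of [pgrad] minus [cpl2] of [ograd]; the 4
    [kap] comes from the two quadratic penalties. *)
Definition pdiv (R : realType) (N : nat) (p q del s a gam kap : R)
  (b y x0 x1 x : 'rV[R]_N) (i : 'I_N) : R :=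
  (Dflux p (pgrad s a gam kap y x0 x1 x)
     (s *: (bhess a gam (x - y) (ebasis R i) + (4 * kap) *: ebasis R i))
   + Dflux q (pgrad s a gam kap y x0 x1 x)
     (s *: (bhess a gam (x - y) (ebasis R i) + (4 * kap) *: ebasis R i))
   - cpl2 p q del b (s *: bhess a gam (x - y) (ebasis R i))) 0 i.

Lemma cvg_pgrad (R : realType) (N : nat) (T : Type) (F : set_system T)
    (FF : Filter F) (s a gam kap : R) (x0 x1 : 'rV[R]_N) (X Y : T -> 'rV[R]_N)
    (x y : 'rV[R]_N) : x != y ->
  (X z @[z --> F] --> x)%classic -> (Y z @[z --> F] --> y)%classic ->
  (pgrad s a gam kap (Y z) x0 x1 (X z) @[z --> F] -->
   pgrad s a gam kap y x0 x1 x)%classic.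
Proof.
rewrite -subr_eq0 => xy Xx Yy; have XY := cvgB_at FF Xx Yy.
have fl := (@cvg_rflux _ _ _ _ FF _ _ gam xy XY).
exact: (cvgZ_at FF (@cvg_cst_at _ _ FF _ s) (cvgD_at FF (cvgD_at FF (cvgZ_at FF (@cvg_cst_at _ _ FF _ _) fl)
  (cvgZ_at FF (@cvg_cst_at _ _ FF _ _) (cvgB_at FF Xx (@cvg_cst_at _ _ FF _ _)))) (cvgZ_at FF (@cvg_cst_at _ _ FF _ _) (cvgB_at FF Xx (@cvg_cst_at _ _ FF _ _))))).
Qed.

Lemma cvg_ograd (R : realType) (N : nat) (T : Type) (F : set_system T)
    (FF : Filter F) (s a gam : R) (X Y K : T -> 'rV[R]_N)
    (x y k : 'rV[R]_N) : x != y ->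
  (X z @[z --> F] --> x)%classic -> (Y z @[z --> F] --> y)%classic ->
  (K z @[z --> F] --> k)%classic ->
  (ograd s a gam (Y z) (K z) (X z) @[z --> F] --> ograd s a gam y k x)%classic.
Proof.
rewrite -subr_eq0 => xy Xx Yy Kk; have XY := cvgB_at FF Xx Yy.
have fl := (@cvg_rflux _ _ _ _ FF _ _ gam xy XY).
exact: (cvgZ_at FF (@cvg_cst_at _ _ FF _ s) (cvgB_at FF (cvgZ_at FF (@cvg_cst_at _ _ FF _ _) fl) Kk)).
Qed.

Lemma cvg_cpl2 (R : realType) (N : nat) (T : Type) (F : set_system T)
    (FF : Filter F) (p q del : R) (f : T -> 'rV[R]_N) (a b : 'rV[R]_N) :
  (f x @[x --> F] --> a)%classic ->
  (cpl2 p q del b (f x) @[x --> F] --> cpl2 p q del b a)%classic.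
Proof.
by move=> fa; exact: (cvgZ_at FF (@cvg_cst_at _ _ FF _ _) (cvgD_at FF (@cvg_cpl _ _ _ _ FF _ _ b p fa) (@cvg_cpl _ _ _ _ FF _ _ b q fa))).
Qed.

Lemma cvg_pdiv (R : realType) (N : nat) (T : Type) (F : set_system T)
    (FF : Filter F) (p q del s a gam kap : R) (b x0 x1 : 'rV[R]_N)
    (X Y : T -> 'rV[R]_N) (x y : 'rV[R]_N) (i : 'I_N) : x != y ->
  pgrad s a gam kap y x0 x1 x != 0 ->
  (X z @[z --> F] --> x)%classic -> (Y z @[z --> F] --> y)%classic ->
  (pdiv p q del s a gam kap b (Y z) x0 x1 (X z) i @[z --> F] -->
   pdiv p q del s a gam kap b y x0 x1 x i)%classic.
Proof.
move=> xy P0 Xx Yy; have P := @cvg_pgrad _ _ _ _ FF s a gam kap x0 x1 _ _ _ _ xy Xx Yy.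
move: xy; rewrite -subr_eq0 => xy; have XY := cvgB_at FF Xx Yy.
have H := cvgZ_at FF (@cvg_cst_at _ _ FF _ (a * gam)) (@cvg_Dflux _ _ _ _ FF _ _ _ _ gam xy XY (@cvg_cst_at _ _ FF _ (ebasis R i))).
have H2 := cvgZ_at FF (@cvg_cst_at _ _ FF _ s) (cvgD_at FF H (@cvg_cst_at _ _ FF _ ((4 * kap) *: ebasis R i))).
apply: (cvg_coord FF); apply: (cvgB_at FF (cvgD_at FF (@cvg_Dflux _ _ _ _ FF _ _ _ _ p P0 P H2)
  (@cvg_Dflux _ _ _ _ FF _ _ _ _ q P0 P H2)) (@cvg_cpl2 _ _ _ _ FF p q del _ _ b (cvgZ_at FF (@cvg_cst_at _ _ FF _ s) H))).
Qed.

Lemma barrier_slice (R : realType) (N : nat) (p q : R) (f : R -> 'rV[R]_N -> R)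
    (u : 'rV[R]_N -> R) (K : set 'rV[R]_N) (r s c kap a gam del : R)
    (y x0 x1 k eta0 b : 'rV[R]_N) :
  is_solution p q f u -> continuous (fun z : R * 'rV[R]_N => f z.1 z.2) ->
  s * s = 1 -> 0 <= a -> closed K -> (forall x, K x -> enorm x <= r) ->
  let w x := s * u x + c - kap * sqd x0 x - kap * sqd x1 x in
  let W x := w x - a * enorm (x - y) `^ gam in
  w y < 0 -> (forall x, ~ K x -> W x <= 0) ->
  (forall x, K x -> [/\ x != y, grad u x != 0 & pgrad s a gam kap y x0 x1 x != 0]) ->
  integralRN (fun x =>
    2 * Num.max (W x) 0 * s *
    dotv (rflux p (grad u x) + rflux q (grad u x)
      - (rflux p (pgrad s a gam kap y x0 x1 x) + rflux q (pgrad s a gam kap y x0 x1 x))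
      + cpl2 p q del b (ograd s a gam y k x - eta0))
      (grad u x - pgrad s a gam kap y x0 x1 x)
    - (f (u x) (grad u x) + \sum_(i < N) pdiv p q del s a gam kap b y x0 x1 x i)
      * sqpos (W x)) = 0.
Proof.
move=> sol fc ss a0 Kc Kr w W wy WK HK; have [[du cu] _] := sol.
have [C1w gw] := @C1_penalty _ _ u s c kap x0 x1 (conj du cu).
have [C1phi gphi] := @C1_penalized _ _ w y a gam C1w a0 wy.
pose T x := rflux p (pgrad s a gam kap y x0 x1 x) + rflux q (pgrad s a gam kap y x0 x1 x)
  - cpl2 p q del b (ograd s a gam y k x - eta0).
have := @weak_slice _ _ p q f u (fun x => sqpos (W x)) T
  (fun i x => pdiv p q del s a gam kap b y x0 x1 x i) K r sol C1phi fc Kc Kr.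
move=> H; rewrite -[RHS]H.
- congr integralRN; apply/funext => x; rewrite gphi gw; congr (_ - _).
  rewrite dotvZr -[in RHS](_ : s *: (grad u x - pgrad s a gam kap y x0 x1 x) =
     s *: grad u x - (2 * kap) *: (x - x0) - (2 * kap) *: (x - x1) -
     (a * gam) *: rflux gam (x - y)); last first.
    rewrite /pgrad /bgrad scalerBr scalerA ss scale1r !opprD !addrA.
    by rewrite -!addrA; congr (_ + _); rewrite addrC -!addrA.
  by rewrite dotvZr mulrA /T opprB addrA addrAC.
- by move=> x /WK Wx; rewrite sqpos_eq0.
- by move=> x /HK[].
- move=> x /HK[xy ux Px]; have FF := nbhs_filter x.
  have P := @cvg_pgrad _ _ _ _ FF s a gam kap x0 x1 _ _ _ _ xy cvg_id (@cvg_cst_at _ _ FF _ y).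
  have O := @cvg_ograd _ _ _ _ FF s a gam _ _ _ _ _ _ xy cvg_id (@cvg_cst_at _ _ FF _ y) (@cvg_cst_at _ _ FF _ k).
  apply: (cvgB_at FF (cvgD_at FF (@cvg_rflux _ _ _ _ FF _ _ p Px P) (@cvg_rflux _ _ _ _ FF _ _ q Px P))
    (@cvg_cpl2 _ _ _ _ FF p q del _ _ b (cvgB_at FF O (@cvg_cst_at _ _ FF _ eta0)))).
- move=> i x /HK[xy ux Px]; have FF := nbhs_filter x.
  exact: (@cvg_pdiv _ _ _ _ FF p q del s a gam kap b x0 x1 _ _ _ _ i xy Px cvg_id (@cvg_cst_at _ _ FF _ y)).
move=> x i /HK[xy ux Px]; apply: is_derive_of_line.
have L v := @is_vderive_line _ _ v (ebasis R i) 0.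
have x0E v : (fun t : R => x + t *: ebasis R i - v) = (fun t => x - v + t *: ebasis R i).
  by apply/funext => t; rewrite addrAC.
have LB : is_vderive 0 (fun t => bgrad a gam (x + t *: ebasis R i - y))
    (bhess a gam (x - y) (ebasis R i)).
  have V := L (x - y); rewrite -x0E in V.
  have := is_vderive_rflux gam V; rewrite /= scale0r addr0 subr_eq0 => /(_ xy).
  exact: is_vderiveZ.
have LP : is_vderive 0 (fun t => pgrad s a gam kap y x0 x1 (x + t *: ebasis R i))
    (s *: (bhess a gam (x - y) (ebasis R i) + (4 * kap) *: ebasis R i)).
  have V0 := L (x - x0); rewrite -x0E in V0.
  have V1 := L (x - x1); rewrite -x0E in V1.
  have := is_vderiveZ s (is_vderiveD (is_vderiveD LB (is_vderiveZ (2 * kap) V0))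
    (is_vderiveZ (2 * kap) V1)).
  rewrite -addrA -scalerDl (_ : 2 * kap + 2 * kap = 4 * kap) //; ring.
have LO : is_vderive 0 (fun t => ograd s a gam y k (x + t *: ebasis R i) - eta0)
    (s *: bhess a gam (x - y) (ebasis R i)).
  have := is_vderiveD (is_vderiveZ s (is_vderiveD LB (@is_vderive_cst _ _ (- k) 0)))
    (@is_vderive_cst _ _ (- eta0) 0).
  by rewrite !addr0.
have LC := is_vderiveZ (1 - del) (is_vderiveD (is_vderive_cpl p b LO) (is_vderive_cpl q b LO)).
have P0 : pgrad s a gam kap y x0 x1 (x + 0 *: ebasis R i) != 0 by rewrite scale0r addr0.
have := is_vderiveD (is_vderiveD (is_vderive_rflux p LP P0) (is_vderive_rflux q LP P0))
  (is_vderiveZ (-1) LC).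
rewrite /= scale0r addr0 scaleN1r => /(_ i).
rewrite (_ : (fun t => _) = fun t => T (x + t *: ebasis R i) 0 i) //.
by apply/funext => t; rewrite scaleN1r.
Qed.

(** * Doubling of variables *)

Lemma grad_max (R : realType) (N : nat) (phi : 'rV[R]_N -> R) (x : 'rV[R]_N) :
  (forall y, differentiable phi y) -> (forall y, phi y <= phi x) -> grad phi x = 0.
Proof.
move=> dphi pmax; apply/rowP => i; rewrite [RHS]mxE.
pose g (t : R) := phi (x + t *: ebasis R i).
have gd (t : R) : is_derive t (1 : R) g (grad phi (x + t *: ebasis R i) 0 i).
  have := @is_derive_line _ _ phi x (ebasis R i) t 0 (grad phi (x + t *: ebasis R i) 0 i).
  rewrite subr0 => /(_ (grad_is_derive i (dphi _))).
  by rewrite (_ : (fun s => _) = g) //; apply/funext => s; rewrite subr0.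
have g0 : is_derive (0 : R) (1 : R) g 0.
  apply: (@derive1_at_max _ g (-1) 1) => //.
  - by rewrite in_itv /=; apply/andP; split; lra.
  - by move=> t _; rewrite /g scale0r addr0.
have [_ E0] := g0; have [_ E1] := gd 0.
by rewrite -E0 E1 scale0r addr0.
Qed.

Lemma rfluxN (R : realType) (N : nat) (s : R) (z : 'rV[R]_N) :
  rflux s (- z) = - rflux s z.
Proof. by rewrite /rflux enormN scalerN. Qed.

Lemma DfluxN (R : realType) (N : nat) (s : R) (z h : 'rV[R]_N) :
  Dflux s (- z) h = Dflux s z h.
Proof. by apply/rowP => i; rewrite /Dflux enormN dotvNl !mxE; ring. Qed.

Lemma Dflux_oppr (R : realType) (N : nat) (s : R) (z h : 'rV[R]_N) :
  Dflux s z (- h) = - Dflux s z h.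
Proof. by apply/rowP => i; rewrite /Dflux dotvNr !mxE; ring. Qed.

Lemma bgradN (R : realType) (N : nat) (a gam : R) (x y : 'rV[R]_N) :
  bgrad a gam (y - x) = - bgrad a gam (x - y).
Proof. by rewrite -opprB /bgrad rfluxN scalerN. Qed.

Lemma bhessN (R : realType) (N : nat) (a gam : R) (x y e : 'rV[R]_N) :
  bhess a gam (y - x) e = bhess a gam (x - y) e.
Proof. by rewrite -opprB /bhess DfluxN. Qed.

Lemma bgrad_scale (R : realType) (N : nat) (a gam : R) (z : 'rV[R]_N) :
  bgrad a gam z = (a * gam * enorm z `^ (gam - 2)) *: z.
Proof. by rewrite /bgrad /rflux scalerA. Qed.

Lemma bhess_expand (R : realType) (N : nat) (a gam h k : R) (z : 'rV[R]_N) i :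
  z != 0 -> h = a * gam * enorm z `^ (gam - 2) ->
  k = h * (2 - gam) / enorm z ^+ 2 ->
  bhess a gam z (ebasis R i) = h *: ebasis R i - (k * z 0 i) *: z.
Proof.
move=> z0 -> ->; have Z0 : 0 < enorm z by rewrite enorm_gt0.
rewrite /bhess /Dflux dotv_ebasis scalerDr !scalerA -scaleNr.
rewrite (_ : gam - 4 = gam - 2 - 2) ?powR_sub2 //; last by lra.
congr (_ *: _ + _ *: _); field.
by rewrite gt_eqF.
Qed.

(** By symmetry of [cpl] the two cross terms add up to -2 (1 - del) times the coupling of the two
    differences, and [cpl_le] bounds it by the two quadratic forms. The damping in [cpl2] equals the
    loss allowed in monotonicity, so the terms match. *)
Lemma coupled_monotone (R : realType) (N : nat) (p q del : R)
    (b xi xi' eta eta' : 'rV[R]_N) : 1 < p -> 1 < q -> del < 1 -> b != 0 ->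
  (forall s, s = p \/ s = q ->
    (1 - del) * (enorm b `^ (s - 2) * qform s b (xi - xi')) <=
      dotv (rflux s xi - rflux s xi') (xi - xi') /\
    (1 - del) * (enorm b `^ (s - 2) * qform s b (eta - eta')) <=
      dotv (rflux s eta - rflux s eta') (eta - eta')) ->
  0 <= dotv (rflux p xi + rflux q xi - (rflux p xi' + rflux q xi')
         + cpl2 p q del b (eta' - eta)) (xi - xi')
     + dotv (rflux p eta + rflux q eta - (rflux p eta' + rflux q eta')
         + cpl2 p q del b (xi' - xi)) (eta - eta').
Proof.
move=> p1 q1 d1 b0 H.
have [Hp1 Hp2] := H p (or_introl erefl); have [Hq1 Hq2] := H q (or_intror erefl).
set X := xi - xi' in Hp1 Hq1 *; set Y := eta - eta' in Hp2 Hq2 *.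
have -> : xi' - xi = - X by rewrite /X opprB.
have -> : eta' - eta = - Y by rewrite /Y opprB.
have E (A1 A2 B1 B2 C : 'rV[R]_N) : A1 + A2 - (B1 + B2) + C = (A1 - B1) + (A2 - B2) + C.
  by rewrite opprD addrACA.
rewrite !E; move: Hp1 Hp2 Hq1 Hq2.
move: (rflux p xi - _) (rflux q xi - _) (rflux p eta - _) (rflux q eta - _).
move=> V1 V2 V3 V4 Hp1 Hp2 Hq1 Hq2.
rewrite !dotvDl /cpl2 !cplN -!opprD !scalerN !dotvNl !dotvZl !dotvDl.
rewrite (cpl_sym p b Y) (cpl_sym q b Y) (dotvC Y) (dotvC Y).
have d0 : 0 <= 1 - del by lra.
have := ler_wpM2l d0 (cpl_le X Y p1 b0); have := ler_wpM2l d0 (cpl_le X Y q1 b0).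
lra.
Qed.

Lemma sqpos_le (R : realType) (s t : R) : s <= t -> sqpos s <= sqpos t.
Proof.
move=> st; have pos (v : R) : 0 <= Num.max v 0 by rewrite le_max lexx orbT.
have m : Num.max s 0 <= Num.max t 0 by rewrite ge_max !le_max st lexx orbT.
by rewrite /sqpos ler_pXn2r ?nnegrE.
Qed.

(** [W] itself may fail to be differentiable at [y], so the first-order condition is taken for its
    squared positive part; its factor 2 W is positive at [x1] and cancels. *)
Lemma penalized_critical (R : realType) (N : nat) (u : 'rV[R]_N -> R)
    (s c kap a gam : R) (y x0 x1 : 'rV[R]_N) : C1 u -> s * s = 1 -> 0 <= a ->
  let w x := s * u x + c - kap * sqd x0 x - kap * sqd x1 x in
  let W x := w x - a * enorm (x - y) `^ gam in
  w y < 0 -> 0 < W x1 -> (forall x, W x <= W x1) ->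
  grad u x1 = pgrad s a gam kap y x0 x1 x1.
Proof.
move=> Cu ss a0 w W wy W1 Wmax.
have [C1w gw] := @C1_penalty _ _ u s c kap x0 x1 Cu.
have [[dphi _] gphi] := @C1_penalized _ _ w y a gam C1w a0 wy.
have := grad_max dphi (fun x => sqpos_le (Wmax x)).
rewrite gphi => /eqP; rewrite scaler_eq0 mulf_eq0 pnatr_eq0 /=.
rewrite max_l ?(ltW W1) // (gt_eqF W1) /= subr_eq0 gw => /eqP H.
rewrite /pgrad /bgrad -H -[LHS]scale1r -ss -scalerA; congr (_ *: _).
by rewrite addrAC !subrK.
Qed.

Definition slice_mono (R : realType) (N : nat) (p q del s a gam kap : R)
    (u : 'rV[R]_N -> R) (b x0 x1 k eta y x : 'rV[R]_N) : R :=
  dotv (rflux p (grad u x) + rflux q (grad u x)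
      - (rflux p (pgrad s a gam kap y x0 x1 x) + rflux q (pgrad s a gam kap y x0 x1 x))
      + cpl2 p q del b (ograd s a gam y k x - eta))
      (grad u x - pgrad s a gam kap y x0 x1 x).

Definition slice_src (R : realType) (N : nat) (p q del s a gam kap : R)
    (f : R -> 'rV[R]_N -> R) (u : 'rV[R]_N -> R) (b x0 x1 y x : 'rV[R]_N) : R :=
  f (u x) (grad u x) + \sum_(i < N) pdiv p q del s a gam kap b y x0 x1 x i.

Lemma cvg_slice_mono (R : realType) (N : nat) (T : Type) (F : set_system T)
    (FF : Filter F) (p q del s a gam kap : R) (u : 'rV[R]_N -> R)
    (b x0 x1 : 'rV[R]_N) (X Y K E : T -> 'rV[R]_N) (x y k eta : 'rV[R]_N) :
  continuous (grad u) -> x != y -> grad u x != 0 ->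
  pgrad s a gam kap y x0 x1 x != 0 ->
  (X z @[z --> F] --> x)%classic -> (Y z @[z --> F] --> y)%classic ->
  (K z @[z --> F] --> k)%classic -> (E z @[z --> F] --> eta)%classic ->
  (slice_mono p q del s a gam kap u b x0 x1 (K z) (E z) (Y z) (X z) @[z --> F] -->
   slice_mono p q del s a gam kap u b x0 x1 k eta y x)%classic.
Proof.
move=> cu xy u0 P0 Xx Yy Kk Ee.
have P := @cvg_pgrad _ _ _ _ FF s a gam kap x0 x1 _ _ _ _ xy Xx Yy.
have O := @cvg_ograd _ _ _ _ FF s a gam _ _ _ _ _ _ xy Xx Yy Kk.
have U : (grad u (X z) @[z --> F] --> grad u x)%classic.
  exact: (cvg_comp _ (grad u) Xx (cu x)).
have fl (t : R) v w (vw : v != 0) H := @cvg_rflux R N T F FF w v t vw H.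
apply: (cvg_dotv FF); last exact: (cvgB_at FF U P).
have A1 := cvgD_at FF (fl p _ _ u0 U) (fl q _ _ u0 U).
have A2 := cvgD_at FF (fl p _ _ P0 P) (fl q _ _ P0 P).
have A3 := @cvg_cpl2 _ _ _ _ FF p q del _ _ b (cvgB_at FF O Ee).
have A4 := cvgB_at FF A1 A2.
exact: (cvgD_at FF A4 A3).
Qed.

Lemma cvg_slice_src (R : realType) (N : nat) (T : Type) (F : set_system T)
    (FF : Filter F) (p q del s a gam kap : R) (f : R -> 'rV[R]_N -> R)
    (u : 'rV[R]_N -> R) (b x0 x1 : 'rV[R]_N) (X Y : T -> 'rV[R]_N) (x y : 'rV[R]_N) :
  C1 u -> continuous (fun z : R * 'rV[R]_N => f z.1 z.2) -> x != y ->
  pgrad s a gam kap y x0 x1 x != 0 ->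
  (X z @[z --> F] --> x)%classic -> (Y z @[z --> F] --> y)%classic ->
  (slice_src p q del s a gam kap f u b x0 x1 (Y z) (X z) @[z --> F] -->
   slice_src p q del s a gam kap f u b x0 x1 y x)%classic.
Proof.
move=> [du cu] fc xy P0 Xx Yy.
have uc : (u (X z) @[z --> F] --> u x)%classic.
  exact: (cvg_comp _ u Xx (differentiable_continuous (du x))).
have U : (grad u (X z) @[z --> F] --> grad u x)%classic.
  exact: (cvg_comp _ (grad u) Xx (cu x)).
apply: (cvgD_at FF (cvg_f2 FF fc uc U)); apply: cvg_sum => i.
exact: (@cvg_pdiv _ _ _ _ FF p q del s a gam kap b x0 x1 _ _ _ _ i xy P0 Xx Yy).
Qed.

Lemma gain_arith (R : realType) (s1 s2 s3 s4 s5 s6 F1 F2 P1 P2 gp gq dl : R) :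
  P1 = s2 + s5 - (1 - dl) * (s1 + s4) ->
  P2 = - s3 - s6 + (1 - dl) * (s1 + s4) ->
  gp <= 2 * ((1 - dl) * s1) - s2 - s3 -> gq <= 2 * ((1 - dl) * s4) - s5 - s6 ->
  F1 - F2 < gp + gq -> 0 < (F2 + P2) - (F1 + P1).
Proof. by move=> -> ->; lra. Qed.

(** The strict supersolution property at the maximum. The barrier Hessian is even in x - y and
    enters the y-slice with the factor -1, so the difference of the two divergences is the
    combination of traces bounded below by the gains for p and q, which together exceed the
    difference of the sources. *)
Lemma gain_at (R : realType) (N : nat) (p q del theta kap0 a gam kap : R)
    (f : R -> 'rV[R]_N -> R) (u : 'rV[R]_N -> R) (x0 y0 x1 y1 : 'rV[R]_N) :
  0 < a -> 0 < gam -> x1 != y1 -> 0 <= kap ->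
  (forall s, s = p \/ s = q ->
    forall (z z1 z2 : 'rV[R]_N) (h kap k : R), z != 0 -> 0 < h -> 0 <= kap ->
    kap <= kap0 * h ->
    enorm (z1 - h *: z) <= theta * enorm (h *: z) ->
    enorm (z2 - h *: z) <= theta * enorm (h *: z) ->
    k = h * (2 - gam) / enorm z ^+ 2 ->
    (s - 1) * (1 - gam) * (h * enorm (h *: z) `^ (s - 2)) <=
    2 * ((1 - del) *
      \sum_(i < N) cpl s (h *: z) (h *: ebasis R i - (k * z 0 i) *: z) 0 i)
    - \sum_(i < N) Dflux s z1 ((h + 4 * kap) *: ebasis R i - (k * z 0 i) *: z) 0 i
    - \sum_(i < N) Dflux s z2 ((h + 4 * kap) *: ebasis R i - (k * z 0 i) *: z) 0 i) ->
  let h := a * gam * enorm (x1 - y1) `^ (gam - 2) in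
  let b := bgrad a gam (x1 - y1) in
  let z1 := pgrad 1 a gam kap y1 x0 x1 x1 in
  let z2 := pgrad (-1) a gam kap x1 y0 y1 y1 in
  kap <= kap0 * h -> enorm (z1 - b) <= theta * enorm b ->
  enorm (z2 - b) <= theta * enorm b ->
  f (u x1) (grad u x1) - f (u y1) (grad u y1) <
    (p - 1) * (1 - gam) * (h * enorm b `^ (p - 2)) +
    (q - 1) * (1 - gam) * (h * enorm b `^ (q - 2)) ->
  0 < slice_src p q del (-1) a gam kap f u b y0 y1 x1 y1
    - slice_src p q del 1 a gam kap f u b x0 x1 y1 x1.
Proof.
move=> a0 g0 xy k0 CG h b z1 z2 kh H1 H2 ff.
pose z := x1 - y1; pose k := h * (2 - gam) / enorm z ^+ 2.
have z0 : z != 0 by rewrite subr_eq0.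
have h0 : 0 < h by rewrite !mulr_gt0 // powR_gt0 // enorm_gt0.
have bE : b = h *: z by exact: bgrad_scale.
rewrite bE in H1 H2 ff.
have Gp := CG p (or_introl erefl) z z1 z2 h kap k z0 h0 k0 kh H1 H2 erefl.
have Gq := CG q (or_intror erefl) z z1 z2 h kap k z0 h0 k0 kh H1 H2 erefl.
have BH i : bhess a gam (x1 - y1) (ebasis R i) = h *: ebasis R i - (k * z 0 i) *: z.
  exact: bhess_expand.
have BH' i : bhess a gam (x1 - y1) (ebasis R i) + (4 * kap) *: ebasis R i =
    (h + 4 * kap) *: ebasis R i - (k * z 0 i) *: z.
  by rewrite BH scalerDl addrAC.
have S1 : \sum_(i < N) pdiv p q del 1 a gam kap b y1 x0 x1 x1 i =
    \sum_(i < N) Dflux p z1 ((h + 4 * kap) *: ebasis R i - (k * z 0 i) *: z) 0 i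
  + \sum_(i < N) Dflux q z1 ((h + 4 * kap) *: ebasis R i - (k * z 0 i) *: z) 0 i
  - (1 - del) * (\sum_(i < N) cpl p (h *: z) (h *: ebasis R i - (k * z 0 i) *: z) 0 i
  + \sum_(i < N) cpl q (h *: z) (h *: ebasis R i - (k * z 0 i) *: z) 0 i).
  rewrite -!big_split /= mulr_sumr -sumrB; apply: eq_bigr => i _.
  by rewrite /pdiv -/z1 !scale1r BH' BH -bE /cpl2; move: (Dflux _ _ _) (Dflux _ _ _)
    (cpl _ _ _) (cpl _ _ _) => D1 D2 D3 D4; rewrite !mxE.
have S2 : \sum_(i < N) pdiv p q del (-1) a gam kap b x1 y0 y1 y1 i =
    - (\sum_(i < N) Dflux p z2 ((h + 4 * kap) *: ebasis R i - (k * z 0 i) *: z) 0 i)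
  - \sum_(i < N) Dflux q z2 ((h + 4 * kap) *: ebasis R i - (k * z 0 i) *: z) 0 i
  + (1 - del) * (\sum_(i < N) cpl p (h *: z) (h *: ebasis R i - (k * z 0 i) *: z) 0 i
  + \sum_(i < N) cpl q (h *: z) (h *: ebasis R i - (k * z 0 i) *: z) 0 i).
  rewrite -!sumrN -!big_split /= mulr_sumr -big_split /=; apply: eq_bigr => i _.
  rewrite /pdiv -/z2 !scaleN1r bhessN BH' BH -bE /cpl2 !cplN !Dflux_oppr.
  move: (Dflux _ _ _) (Dflux _ _ _) (cpl _ _ _) (cpl _ _ _) => D1 D2 D3 D4.
  by rewrite !mxE; ring.
exact: gain_arith S1 S2 Gp Gq ff.
Qed.

Lemma sqd_enorm (R : realType) (N : nat) (c x : 'rV[R]_N) : sqd c x = enorm (x - c) ^+ 2.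
Proof. by rewrite enorm_sqr. Qed.

Lemma sqd_id (R : realType) (N : nat) (c : 'rV[R]_N) : sqd c c = 0.
Proof. by apply/eqP; rewrite /sqd subrr dotv_eq0. Qed.

Lemma enorm_le_sqd (R : realType) (N : nat) (c x : 'rV[R]_N) (d : R) : 0 <= d ->
  sqd c x <= d ^+ 2 -> enorm (x - c) <= d.
Proof. by move=> d0; rewrite sqd_enorm ler_pXn2r ?nnegrE ?enorm_ge0. Qed.

Lemma cvg_sqd (R : realType) (N : nat) (T : Type) (F : set_system T)
    (FF : Filter F) (c : 'rV[R]_N) (X : T -> 'rV[R]_N) (x : 'rV[R]_N) :
  (X z @[z --> F] --> x)%classic -> (sqd c (X z) @[z --> F] --> sqd c x)%classic.
Proof.
by move=> Xx; have H := cvgB_at FF Xx (@cvg_cst_at _ _ FF _ c); exact: (cvg_dotv FF H H).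
Qed.

Lemma closed_sqd (R : realType) (N : nat) (c : 'rV[R]_N) (r : R) (P : Prop) :
  closed [set x : 'rV[R]_N | sqd c x <= r /\ P]%classic.
Proof.
have [HP|HP] := pselect P; last first.
  rewrite (_ : [set x | _]%classic = set0); first exact: closed0.
  by apply/seteqP; split => // x [].
rewrite (_ : [set x | _]%classic = (sqd c) @^-1` [set t | t <= r])%classic.
  apply: closed_comp; last exact: closed_le.
  by move=> x _; exact: (@cvg_sqd _ _ _ _ (nbhs_filter x) c _ _ cvg_id).
by apply/seteqP; split => x /= => [[]|].
Qed.

Lemma closed_sqd2 (R : realType) (N : nat) (c d : 'rV[R]_N) (r : R) :
  closed [set z : 'rV[R]_N * 'rV[R]_N | sqd c z.1 <= r /\ sqd d z.2 <= r]%classic.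
Proof.
apply: closedI.
- apply: (@closed_comp _ _ (fun z : 'rV[R]_N * 'rV[R]_N => sqd c z.1)
    [set t | t <= r]%classic); last exact: closed_le.
  by move=> z _; exact: (@cvg_sqd _ _ _ _ (nbhs_filter z) c _ _ cvg_fst).
- apply: (@closed_comp _ _ (fun z : 'rV[R]_N * 'rV[R]_N => sqd d z.2)
    [set t | t <= r]%classic); last exact: closed_le.
  by move=> z _; exact: (@cvg_sqd _ _ _ _ (nbhs_filter z) d _ _ cvg_snd).
Qed.

(** * The doubled functional, its slices, and the integral comparison *)

(** The penalty centred at (x0, y0) makes a maximum exist; the one centred at that maximum (x1, y1)
    makes it strict. *)
Definition dblV (R : realType) (N : nat) (u : 'rV[R]_N -> R) (a gam kap : R)
  (x0 y0 x1 y1 x y : 'rV[R]_N) : R :=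
  u x - u y - kap * (sqd x0 x + sqd y0 y) - kap * (sqd x1 x + sqd y1 y)
  - a * enorm (x - y) `^ gam.

(** Everything in [dblV - l] that depends on y alone: the constant [c] of the x-slice. [cstY] plays
    the same role for the y-slice. *)
Definition cstX (R : realType) (N : nat) (u : 'rV[R]_N -> R) (kap : R)
  (y0 y1 : 'rV[R]_N) (l : R) (y : 'rV[R]_N) : R :=
  - u y - kap * sqd y0 y - kap * sqd y1 y - l.

Definition cstY (R : realType) (N : nat) (u : 'rV[R]_N -> R) (kap : R)
  (x0 x1 : 'rV[R]_N) (l : R) (x : 'rV[R]_N) : R :=
  u x - kap * sqd x0 x - kap * sqd x1 x - l.

Lemma dblV_X (R : realType) (N : nat) (u : 'rV[R]_N -> R) (a gam kap l : R)
    (x0 y0 x1 y1 x y : 'rV[R]_N) :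
  1 * u x + cstX u kap y0 y1 l y - kap * sqd x0 x - kap * sqd x1 x
    - a * enorm (x - y) `^ gam = dblV u a gam kap x0 y0 x1 y1 x y - l.
Proof. by rewrite /dblV /cstX; ring. Qed.

Lemma dblV_Y (R : realType) (N : nat) (u : 'rV[R]_N -> R) (a gam kap l : R)
    (x0 y0 x1 y1 x y : 'rV[R]_N) :
  -1 * u y + cstY u kap x0 x1 l x - kap * sqd y0 y - kap * sqd y1 y
    - a * enorm (y - x) `^ gam = dblV u a gam kap x0 y0 x1 y1 x y - l.
Proof. by rewrite /dblV /cstY -(enormN (y - x)) opprB; ring. Qed.

(** On the diagonal the values of u cancel, and only penalties and the positive level [l] remain.
    This keeps the test function away from the singularity of the barrier. *)
Lemma cstX_lt0 (R : realType) (N : nat) (u : 'rV[R]_N -> R) (kap l : R)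
    (x0 y0 x1 y1 y : 'rV[R]_N) : 0 <= kap -> 0 < l ->
  1 * u y + cstX u kap y0 y1 l y - kap * sqd x0 y - kap * sqd x1 y < 0.
Proof.
move=> k0 l0; have P c := mulr_ge0 k0 (sqd_ge0 c y).
by move: (P x0) (P x1) (P y0) (P y1); rewrite /cstX; lra.
Qed.

Lemma cstY_lt0 (R : realType) (N : nat) (u : 'rV[R]_N -> R) (kap l : R)
    (x0 y0 x1 y1 x : 'rV[R]_N) : 0 <= kap -> 0 < l ->
  -1 * u x + cstY u kap x0 x1 l x - kap * sqd y0 x - kap * sqd y1 x < 0.
Proof.
move=> k0 l0; have P c := mulr_ge0 k0 (sqd_ge0 c x).
by move: (P x0) (P x1) (P y0) (P y1); rewrite /cstY; lra.
Qed.

Lemma critical_pair (R : realType) (N : nat) (u : 'rV[R]_N -> R) (a gam kap L : R)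
    (x0 y0 x1 y1 : 'rV[R]_N) : C1 u -> 0 <= a -> 0 <= kap -> 0 < L ->
  dblV u a gam kap x0 y0 x1 y1 x1 y1 = L ->
  (forall x y, dblV u a gam kap x0 y0 x1 y1 x y <= L) ->
  grad u x1 = pgrad 1 a gam kap y1 x0 x1 x1 /\
  grad u y1 = pgrad (-1) a gam kap x1 y0 y1 y1.
Proof.
(* Any level strictly between 0 and [L] would do: positive for the diagonal, below [L] so that the
   maximum lies above it. *)
move=> Cu a0 k0 L0 V1 VL; have L2 : 0 < L / 2 by rewrite divr_gt0.
have L3 : 0 < L - L / 2 by lra.
split.
- apply: (@penalized_critical _ _ u 1 (cstX u kap y0 y1 (L / 2) y1) kap a gam y1 x0 x1 Cu).
  + exact: mulr1.
  + exact: a0.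
  + exact: cstX_lt0.
  + by rewrite (dblV_X u a gam kap (L / 2) x0 y0) V1.
  + move=> x; rewrite !(dblV_X u a gam kap (L / 2) x0 y0) V1.
    by rewrite lerD2r; exact: VL.
- apply: (@penalized_critical _ _ u (-1) (cstY u kap x0 x1 (L / 2) x1) kap a gam x1 y0 y1 Cu).
  + by rewrite mulrNN mulr1.
  + exact: a0.
  + exact: cstY_lt0.
  + by rewrite (dblV_Y u a gam kap (L / 2) x0 y0) V1.
  + move=> y; rewrite !(dblV_Y u a gam kap (L / 2) x0 y0) V1.
    by rewrite lerD2r; exact: VL.
Qed.

Lemma enorm_near_neq0 (R : realType) (N : nat) (theta : R) (b v : 'rV[R]_N) :
  theta < 1 -> b != 0 -> enorm (v - b) <= theta * enorm b -> v != 0.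
Proof.
move=> th1; rewrite -!enorm_gt0 => B0 vb.
have : enorm b <= enorm (v - b) + enorm v.
  by rewrite -(enormN (v - b)) opprB -{1}(subrK v b) enormD.
have : theta * enorm b < 1 * enorm b by rewrite ltr_pM2r.
lra.
Qed.

Lemma near_enorm_le (R : realType) (N : nat) (T : topologicalType) (g : T -> 'rV[R]_N)
    (x : T) (v b : 'rV[R]_N) (r : R) : (g z @[z --> x] --> v)%classic ->
  enorm (v - b) < r -> \forall z \near x, enorm (g z - b) <= r.
Proof.
move=> gv vb; have FF := nbhs_filter x.
have H := cvg_enorm FF (cvgB_at FF gv (@cvg_cst_at _ _ FF _ b)).
have H' : \forall z \near x, enorm (g z - b) < r by exact: (cvgr_lt _ H).
by apply: filterS H' => z /ltW.
Qed.

Lemma near_fst_neq_snd (R : realType) (N : nat) (x y : 'rV[R]_N) : x != y ->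
  \forall z \near (x, y), z.1 != z.2.
Proof.
rewrite -subr_eq0 -enorm_gt0 => xy; have FF := nbhs_filter (x, y).
have c1 : (w.1 @[w --> (x, y)] --> x)%classic by exact: (@cvg_fst _ _ (nbhs x) (nbhs y)).
have c2 : (w.2 @[w --> (x, y)] --> y)%classic by exact: (@cvg_snd _ _ (nbhs x) (nbhs y)).
have H := cvg_enorm FF (cvgB_at FF c1 c2).
have H' : \forall z \near (x, y), 0 < enorm (z.1 - z.2) by exact: (cvgr_gt _ H).
by apply: filterS H' => z; rewrite enorm_gt0 subr_eq0.
Qed.

(** What must hold throughout the support of the test function: no singularity, all four gradients
    close to [b], and a gain of at least [c0]. *)
Definition goodpair (R : realType) (N : nat) (p q del theta a gam kap c0 : R)
    (f : R -> 'rV[R]_N -> R) (u : 'rV[R]_N -> R) (b x0 y0 x1 y1 x y : 'rV[R]_N) : Prop :=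
  [/\ x != y,
   enorm (grad u x - b) <= theta * enorm b /\
     enorm (pgrad 1 a gam kap y x0 x1 x - b) <= theta * enorm b,
   enorm (grad u y - b) <= theta * enorm b /\
     enorm (pgrad (-1) a gam kap x y0 y1 y - b) <= theta * enorm b &
   c0 <= slice_src p q del (-1) a gam kap f u b y0 y1 x y
       - slice_src p q del 1 a gam kap f u b x0 x1 y x].

Lemma near_goodpair (R : realType) (N : nat) (p q del theta a gam kap c0 : R)
    (f : R -> 'rV[R]_N -> R) (u : 'rV[R]_N -> R) (b x0 y0 x1 y1 : 'rV[R]_N) :
  C1 u -> continuous (fun z : R * 'rV[R]_N => f z.1 z.2) -> theta < 1 -> b != 0 ->
  x1 != y1 ->
  enorm (grad u x1 - b) < theta * enorm b ->
  enorm (pgrad 1 a gam kap y1 x0 x1 x1 - b) < theta * enorm b ->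
  enorm (grad u y1 - b) < theta * enorm b ->
  enorm (pgrad (-1) a gam kap x1 y0 y1 y1 - b) < theta * enorm b ->
  c0 < slice_src p q del (-1) a gam kap f u b y0 y1 x1 y1
       - slice_src p q del 1 a gam kap f u b x0 x1 y1 x1 ->
  \forall z \near (x1, y1),
    goodpair p q del theta a gam kap c0 f u b x0 y0 x1 y1 z.1 z.2.
Proof.
move=> Cu fc th1 b0 xy Ux Px Uy Py S0; have [_ cu] := Cu.
have yx : y1 != x1 by rewrite eq_sym.
have FF := nbhs_filter (x1, y1).
have c1 : (w.1 @[w --> (x1, y1)] --> x1)%classic by exact: (@cvg_fst _ _ (nbhs x1) (nbhs y1)).
have c2 : (w.2 @[w --> (x1, y1)] --> y1)%classic by exact: (@cvg_snd _ _ (nbhs x1) (nbhs y1)).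
have n2 : \forall z \near (x1, y1), enorm (grad u z.1 - b) <= theta * enorm b.
  exact: near_enorm_le (cvg_comp _ (grad u) c1 (cu x1)) Ux.
have n3 : \forall z \near (x1, y1), enorm (grad u z.2 - b) <= theta * enorm b.
  exact: near_enorm_le (cvg_comp _ (grad u) c2 (cu y1)) Uy.
have n4 : \forall z \near (x1, y1),
    enorm (pgrad 1 a gam kap z.2 x0 x1 z.1 - b) <= theta * enorm b.
  exact: near_enorm_le (@cvg_pgrad _ _ _ _ FF 1 a gam kap x0 x1 _ _ _ _ xy c1 c2) Px.
have n5 : \forall z \near (x1, y1),
    enorm (pgrad (-1) a gam kap z.1 y0 y1 z.2 - b) <= theta * enorm b.
  exact: near_enorm_le (@cvg_pgrad _ _ _ _ FF (-1) a gam kap y0 y1 _ _ _ _ yx c2 c1) Py.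
have Px0 := enorm_near_neq0 th1 b0 (ltW Px).
have Py0 := enorm_near_neq0 th1 b0 (ltW Py).
have H := cvgB_at FF
    (@cvg_slice_src _ _ _ _ FF p q del (-1) a gam kap f u b y0 y1 _ _ _ _ Cu fc yx Py0 c2 c1)
    (@cvg_slice_src _ _ _ _ FF p q del 1 a gam kap f u b x0 x1 _ _ _ _ Cu fc xy Px0 c1 c2).
have n6 : \forall z \near (x1, y1), c0 <
    slice_src p q del (-1) a gam kap f u b y0 y1 z.1 z.2
       - slice_src p q del 1 a gam kap f u b x0 x1 z.2 z.1 by exact: (cvgr_gt _ H).
have n1 := near_fst_neq_snd xy.
by apply: filterS (filterI n1 (filterI (filterI n2 n4) (filterI (filterI n3 n5) n6)))
  => z [? [[? ?] [[? ?] /ltW ?]]]; split.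
Qed.

Definition ZX (R : realType) (N : nat) (p q del a gam kap l : R)
    (f : R -> 'rV[R]_N -> R) (u : 'rV[R]_N -> R) (b x0 y0 x1 y1 x y : 'rV[R]_N) : R :=
  2 * Num.max (dblV u a gam kap x0 y0 x1 y1 x y - l) 0 * 1 *
    slice_mono p q del 1 a gam kap u b x0 x1
      ((2 * kap) *: (y - y0) + (2 * kap) *: (y - y1)) (grad u y) y x
  - slice_src p q del 1 a gam kap f u b x0 x1 y x *
    sqpos (dblV u a gam kap x0 y0 x1 y1 x y - l).

Definition ZY (R : realType) (N : nat) (p q del a gam kap l : R)
    (f : R -> 'rV[R]_N -> R) (u : 'rV[R]_N -> R) (b x0 y0 x1 y1 x y : 'rV[R]_N) : R :=
  2 * Num.max (dblV u a gam kap x0 y0 x1 y1 x y - l) 0 * -1 *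
    slice_mono p q del (-1) a gam kap u b y0 y1
      ((2 * kap) *: (x - x0) + (2 * kap) *: (x - x1)) (grad u x) x y
  - slice_src p q del (-1) a gam kap f u b y0 y1 x y *
    sqpos (dblV u a gam kap x0 y0 x1 y1 x y - l).

Lemma enorm_bound_sqd (R : realType) (N : nat) (c x : 'rV[R]_N) (d : R) : 0 <= d ->
  sqd c x <= d ^+ 2 -> enorm x <= enorm c + d.
Proof.
move=> d0 /(enorm_le_sqd d0) xc; rewrite -(subrK c x) [enorm c + d]addrC.
by apply: le_trans (enormD _ _) _; rewrite lerD2r.
Qed.

Lemma integral_ZX (R : realType) (N : nat) (p q del theta a gam kap c0 l d : R)
    (f : R -> 'rV[R]_N -> R) (u : 'rV[R]_N -> R) (b x0 y0 x1 y1 y : 'rV[R]_N) :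
  is_solution p q f u -> continuous (fun z : R * 'rV[R]_N => f z.1 z.2) ->
  0 <= a -> 0 <= kap -> 0 < l -> 0 <= d -> theta < 1 -> b != 0 ->
  (forall x y, sqd x1 x <= d ^+ 2 /\ sqd y1 y <= d ^+ 2 ->
    goodpair p q del theta a gam kap c0 f u b x0 y0 x1 y1 x y) ->
  (forall x y, ~ (sqd x1 x <= d ^+ 2 /\ sqd y1 y <= d ^+ 2) ->
    dblV u a gam kap x0 y0 x1 y1 x y - l <= 0) ->
  integralRN (fun x => ZX p q del a gam kap l f u b x0 y0 x1 y1 x y) = 0.
Proof.
move=> sol fc a0 k0 l0 d0 th1 b0 good out.
rewrite -[RHS](@barrier_slice _ _ p q f u
  [set x | sqd x1 x <= d ^+ 2 /\ sqd y1 y <= d ^+ 2]%classic (enorm x1 + d)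
  1 (cstX u kap y0 y1 l y) kap a gam del y x0 x1
  ((2 * kap) *: (y - y0) + (2 * kap) *: (y - y1)) (grad u y) b sol fc) => //.
- congr integralRN; apply/funext => x; rewrite /ZX.
  by rewrite (dblV_X u a gam kap l x0 y0 x1 y1 x y).
- exact: mulr1.
- exact: closed_sqd.
- by move=> x [H _]; exact: enorm_bound_sqd.
- exact: cstX_lt0.
- by move=> x H; rewrite (dblV_X u a gam kap l x0 y0 x1 y1 x y); exact: out.
- move=> x /good[xy [Ux Px] _ _].
  by split => //; [exact: enorm_near_neq0 Ux | exact: enorm_near_neq0 Px].
Qed.

Lemma integral_ZY (R : realType) (N : nat) (p q del theta a gam kap c0 l d : R)
    (f : R -> 'rV[R]_N -> R) (u : 'rV[R]_N -> R) (b x0 y0 x1 y1 x : 'rV[R]_N) :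
  is_solution p q f u -> continuous (fun z : R * 'rV[R]_N => f z.1 z.2) ->
  0 <= a -> 0 <= kap -> 0 < l -> 0 <= d -> theta < 1 -> b != 0 ->
  (forall x y, sqd x1 x <= d ^+ 2 /\ sqd y1 y <= d ^+ 2 ->
    goodpair p q del theta a gam kap c0 f u b x0 y0 x1 y1 x y) ->
  (forall x y, ~ (sqd x1 x <= d ^+ 2 /\ sqd y1 y <= d ^+ 2) ->
    dblV u a gam kap x0 y0 x1 y1 x y - l <= 0) ->
  integralRN (fun y => ZY p q del a gam kap l f u b x0 y0 x1 y1 x y) = 0.
Proof.
move=> sol fc a0 k0 l0 d0 th1 b0 good out.
rewrite -[RHS](@barrier_slice _ _ p q f u
  [set y | sqd y1 y <= d ^+ 2 /\ sqd x1 x <= d ^+ 2]%classic (enorm y1 + d)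
  (-1) (cstY u kap x0 x1 l x) kap a gam del x y0 y1
  ((2 * kap) *: (x - x0) + (2 * kap) *: (x - x1)) (grad u x) b sol fc) => //.
- congr integralRN; apply/funext => y; rewrite /ZY.
  by rewrite (dblV_Y u a gam kap l x0 y0 x1 y1 x y).
- by rewrite mulrNN mulr1.
- exact: closed_sqd.
- by move=> y [H _]; exact: enorm_bound_sqd.
- exact: cstY_lt0.
- move=> y H; rewrite (dblV_Y u a gam kap l x0 y0 x1 y1 x y); apply: out.
  by move=> [? ?]; apply: H.
- move=> y [Hy Hx]; have [xy _ [Uy Py] _] := good x y (conj Hx Hy).
  by split => //; [rewrite eq_sym|exact: enorm_near_neq0 Uy | exact: enorm_near_neq0 Py].
Qed.

Lemma dblV_continuous (R : realType) (N : nat) (u : 'rV[R]_N -> R) (a gam kap l : R)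
    (x0 y0 x1 y1 : 'rV[R]_N) (z : 'rV[R]_N * 'rV[R]_N) : C1 u -> 0 < gam ->
  (dblV u a gam kap x0 y0 x1 y1 w.1 w.2 - l @[w --> z] -->
   dblV u a gam kap x0 y0 x1 y1 z.1 z.2 - l)%classic.
Proof.
move=> [du _] g0; have FF := nbhs_filter z.
have c1 : (w.1 @[w --> z] --> z.1)%classic by exact: cvg_fst.
have c2 : (w.2 @[w --> z] --> z.2)%classic by exact: cvg_snd.
have u1 : (u w.1 @[w --> z] --> u z.1)%classic.
  exact: (cvg_comp _ u c1 (differentiable_continuous (du z.1))).
have u2 : (u w.2 @[w --> z] --> u z.2)%classic.
  exact: (cvg_comp _ u c2 (differentiable_continuous (du z.2))).
have kk c d : (kap * (sqd c w.1 + sqd d w.2) @[w --> z] -->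
    kap * (sqd c z.1 + sqd d z.2))%classic.
  apply: (cvgM_at FF (@cvg_cst_at _ _ FF _ kap)); apply: (cvgD_at FF); exact: cvg_sqd.
have en : (a * enorm (w.1 - w.2) `^ gam @[w --> z] -->
    a * enorm (z.1 - z.2) `^ gam)%classic.
  apply: (cvgM_at FF (@cvg_cst_at _ _ FF _ a)).
  have D := cvgB_at FF c1 c2.
  have E := @enorm_pow_continuous R N gam g0 (z.1 - z.2).
  exact: (cvg_comp _ (fun v : 'rV[R]_N => enorm v `^ gam) D E).
exact: (cvgB_at FF (cvgB_at FF (cvgB_at FF (cvgB_at FF (cvgB_at FF u1 u2) (kk x0 y0))
  (kk x1 y1)) en) (@cvg_cst_at _ _ FF _ l)).
Qed.

(** Joint continuity in (x, y), needed to exchange the integrals; the slice identities alone do not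
    provide it. *)
Lemma ccont_Z (R : realType) (N : nat) (p q del theta a gam kap c0 l d : R)
    (f : R -> 'rV[R]_N -> R) (u : 'rV[R]_N -> R) (b x0 y0 x1 y1 : 'rV[R]_N) :
  C1 u -> continuous (fun z : R * 'rV[R]_N => f z.1 z.2) ->
  0 < gam -> 0 <= d -> theta < 1 -> b != 0 ->
  (forall x y, sqd x1 x <= d ^+ 2 /\ sqd y1 y <= d ^+ 2 ->
    goodpair p q del theta a gam kap c0 f u b x0 y0 x1 y1 x y) ->
  (forall x y, ~ (sqd x1 x <= d ^+ 2 /\ sqd y1 y <= d ^+ 2) ->
    dblV u a gam kap x0 y0 x1 y1 x y - l <= 0) ->
  [/\ ccont (fun z : 'rV[R]_N * 'rV[R]_N =>
        ZX p q del a gam kap l f u b x0 y0 x1 y1 z.1 z.2),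
      ccont (fun z : 'rV[R]_N * 'rV[R]_N =>
        ZY p q del a gam kap l f u b x0 y0 x1 y1 z.1 z.2) &
      ccont (fun z : 'rV[R]_N * 'rV[R]_N =>
        sqpos (dblV u a gam kap x0 y0 x1 y1 z.1 z.2 - l))].
Proof.
move=> Cu fc g0 d0 th1 b0 good out; have [_ cu] := Cu.
pose K := [set z : 'rV[R]_N * 'rV[R]_N | sqd x1 z.1 <= d ^+ 2 /\ sqd y1 z.2 <= d ^+ 2]%classic.
have Kc : closed K by exact: closed_sqd2.
have Kr z : K z -> `|z| <= Num.max (enorm x1 + d) (enorm y1 + d).
  move=> [H1 H2]; rewrite prod_normE /= ge_max !le_max.
  rewrite (le_trans (norm_le_enorm _) (enorm_bound_sqd d0 H1)).
  by rewrite (le_trans (norm_le_enorm _) (enorm_bound_sqd d0 H2)) orbT.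
pose V (z : 'rV[R]_N * 'rV[R]_N) := dblV u a gam kap x0 y0 x1 y1 z.1 z.2 - l.
have Vc (z : 'rV[R]_N * 'rV[R]_N) : (V w @[w --> z] --> V z)%classic.
  exact: dblV_continuous.
pose P z := Num.max (V z) 0; pose Q z := sqpos (V z).
have Pc (z : 'rV[R]_N * 'rV[R]_N) : (P w @[w --> z] --> P z)%classic.
  exact: (cvg_pos_part (nbhs_filter z) (Vc z)).
have Qc (z : 'rV[R]_N * 'rV[R]_N) : (Q w @[w --> z] --> Q z)%classic.
  exact: (cvgM_at (nbhs_filter z) (Pc z) (Pc z)).
have P0 z : ~ K z -> P z = 0 by move=> /out H; rewrite /P max_r.
have Q0 z : ~ K z -> Q z = 0 by move=> /out H; rewrite /Q sqpos_eq0.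
have c1 (z : 'rV[R]_N * 'rV[R]_N) : (w.1 @[w --> z] --> z.1)%classic by exact: cvg_fst.
have c2 (z : 'rV[R]_N * 'rV[R]_N) : (w.2 @[w --> z] --> z.2)%classic by exact: cvg_snd.
have kc (c c' : 'rV[R]_N) (g : 'rV[R]_N * 'rV[R]_N -> 'rV[R]_N)
    (z : 'rV[R]_N * 'rV[R]_N) : (g w @[w --> z] --> g z)%classic ->
    ((2 * kap) *: (g w - c) + (2 * kap) *: (g w - c') @[w --> z] -->
     (2 * kap) *: (g z - c) + (2 * kap) *: (g z - c'))%classic.
  move=> gz; have FF := nbhs_filter z.
  have H v : ((2 * kap) *: (g w - v) @[w --> z] --> (2 * kap) *: (g z - v))%classic.
    exact: (cvgZ_at FF (@cvg_cst_at _ _ FF _ (2 * kap)) (cvgB_at FF gz (@cvg_cst_at _ _ FF _ v))).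
  exact: (cvgD_at FF (H c) (H c')).
have comb (s : R) (G S : 'rV[R]_N * 'rV[R]_N -> R) :
   (forall z, K z -> (G w @[w --> z] --> G z)%classic) ->
   (forall z, K z -> (S w @[w --> z] --> S z)%classic) ->
   ccont (fun z => 2 * P z * s * G z - S z * Q z).
  move=> Gc Sc.
  rewrite (_ : (fun z => _) = fun z => (2 * s) * (P z * G z) + -1 * (Q z * S z)).
    apply: ccontD; apply: ccontZ; exact: (ccont_mul_local Kc Kr).
  by apply/funext => z; ring.
split.
- apply: comb => -[x y] Kz; have [xy [Ux Px] [Uy Py] _] := good _ _ Kz;
    have FF := nbhs_filter (x, y).
  + apply: (@cvg_slice_mono _ _ _ _ FF p q del 1 a gam kap u b x0 x1
      _ _ _ _ x y _ _ cu xy _ _ (c1 (x, y)) (c2 (x, y)) (kc y0 y1 snd _ (c2 (x, y)))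
      (cvg_comp _ (grad u) (c2 (x, y)) (cu y))).
    * exact: enorm_near_neq0 Ux.
    * exact: enorm_near_neq0 Px.
  + apply: (@cvg_slice_src _ _ _ _ FF p q del 1 a gam kap f u b x0 x1 _ _ _ _ Cu fc xy _
      (c1 (x, y)) (c2 (x, y))).
    exact: enorm_near_neq0 Px.
- apply: comb => -[x y] Kz; have [xy [Ux Px] [Uy Py] _] := good _ _ Kz;
    have FF := nbhs_filter (x, y); have yx : y != x by rewrite eq_sym.
  + apply: (@cvg_slice_mono _ _ _ _ FF p q del (-1) a gam kap u b y0 y1
      _ _ _ _ y x _ _ cu yx _ _ (c2 (x, y)) (c1 (x, y)) (kc x0 x1 fst _ (c1 (x, y)))
      (cvg_comp _ (grad u) (c1 (x, y)) (cu x))).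
    * exact: enorm_near_neq0 Uy.
    * exact: enorm_near_neq0 Py.
  + apply: (@cvg_slice_src _ _ _ _ FF p q del (-1) a gam kap f u b y0 y1 _ _ _ _ Cu fc yx _
      (c2 (x, y)) (c1 (x, y))).
    exact: enorm_near_neq0 Py.
- rewrite (_ : (fun z => _) = fun z => Q z * (fun=> 1) z).
    by apply: (ccont_mul_local Kc Kr) => // z _; exact: (@cvg_cst_at _ _ (nbhs_filter z) _ (1 : R)).
  by apply/funext => z; rewrite mulr1.
Qed.

Lemma Z_arith_out (R : realType) (m1 m2 s1 s2 c : R) :
  c * 0 <= 2 * 0 * 1 * m1 - s1 * 0 - (2 * 0 * -1 * m2 - s2 * 0).
Proof. by rewrite le_eqVlt; apply/orP; left; apply/eqP; ring. Qed.

Lemma Z_arith_in (R : realType) (m1 m2 s1 s2 c P Q : R) : 0 <= P -> 0 <= Q ->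
  c <= s2 - s1 -> 0 <= m1 + m2 ->
  c * Q <= 2 * P * 1 * m1 - s1 * Q - (2 * P * -1 * m2 - s2 * Q).
Proof.
by move=> P0 Q0 S0 M; have := ler_wpM2r Q0 S0; have := mulr_ge0 P0 M; lra.
Qed.

(** In the difference the two monotonicity terms carry the same nonnegative weight and their sum is
    nonnegative by the coupling; what remains is the difference of the sources times the test
    function. *)
Lemma Z_lower (R : realType) (N : nat) (p q del theta a gam kap c0 l d : R)
    (f : R -> 'rV[R]_N -> R) (u : 'rV[R]_N -> R) (b x0 y0 x1 y1 x y : 'rV[R]_N) :
  1 < p -> 1 < q -> del < 1 -> b != 0 ->
  (forall s, s = p \/ s = q -> forall b xi xi' : 'rV[R]_N, b != 0 ->
    enorm (xi - b) <= theta * enorm b -> enorm (xi' - b) <= theta * enorm b ->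
    (1 - del) * (enorm b `^ (s - 2) * qform s b (xi - xi')) <=
    dotv (rflux s xi - rflux s xi') (xi - xi')) ->
  (forall x y, sqd x1 x <= d ^+ 2 /\ sqd y1 y <= d ^+ 2 ->
    goodpair p q del theta a gam kap c0 f u b x0 y0 x1 y1 x y) ->
  (forall x y, ~ (sqd x1 x <= d ^+ 2 /\ sqd y1 y <= d ^+ 2) ->
    dblV u a gam kap x0 y0 x1 y1 x y - l <= 0) ->
  c0 * sqpos (dblV u a gam kap x0 y0 x1 y1 x y - l) <=
  ZX p q del a gam kap l f u b x0 y0 x1 y1 x y
  - ZY p q del a gam kap l f u b x0 y0 x1 y1 x y.
Proof.
move=> p1 q1 d1 b0 MP good out; rewrite /ZX /ZY.
set v := dblV _ _ _ _ _ _ _ _ _ _ - l.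
have [Kxy|/out] := pselect (sqd x1 x <= d ^+ 2 /\ sqd y1 y <= d ^+ 2); last first.
  rewrite -/v => v0; rewrite sqpos_eq0 // max_r //; exact: Z_arith_out.
have [xy [Ux Px] [Uy Py] S0] := good _ _ Kxy.
have P0 : 0 <= Num.max v 0 by rewrite le_max lexx orbT.
have Q0 := sqpos_ge0 v.
have M : 0 <= slice_mono p q del 1 a gam kap u b x0 x1
      ((2 * kap) *: (y - y0) + (2 * kap) *: (y - y1)) (grad u y) y x +
    slice_mono p q del (-1) a gam kap u b y0 y1
      ((2 * kap) *: (x - x0) + (2 * kap) *: (x - x1)) (grad u x) x y.
  rewrite /slice_mono.
  (* The [ograd] of one slice is the [pgrad] of the other, so both coupling terms are differences
     between true and predicted gradients. *)
  have -> : ograd 1 a gam y ((2 * kap) *: (y - y0) + (2 * kap) *: (y - y1)) x =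
      pgrad (-1) a gam kap x y0 y1 y.
    by rewrite /ograd /pgrad (bgradN a gam x y) scale1r scaleN1r -[in RHS]addrA
      [in RHS]opprD opprK.
  have -> : ograd (-1) a gam x ((2 * kap) *: (x - x0) + (2 * kap) *: (x - x1)) y =
      pgrad 1 a gam kap y x0 x1 x.
    by rewrite /ograd /pgrad (bgradN a gam x y) scale1r scaleN1r opprD !opprK addrA.
  apply: coupled_monotone => // s sE; split; exact: MP.
exact: Z_arith_in P0 Q0 S0 M.
Qed.

(** [A] integrates to 0 in x and [B] in y, so only [A] needs the order of integration exchanged. *)
Lemma integral_comparison (R : realType) (N : nat) (A B S : 'rV[R]_N -> 'rV[R]_N -> R)
    (c : R) (x y : 'rV[R]_N) : 0 < c ->
  ccont (fun z : 'rV[R]_N * 'rV[R]_N => A z.1 z.2) ->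
  ccont (fun z : 'rV[R]_N * 'rV[R]_N => B z.1 z.2) ->
  ccont (fun z : 'rV[R]_N * 'rV[R]_N => S z.1 z.2) ->
  (forall y, integralRN (A^~ y) = 0) -> (forall x, integralRN (B x) = 0) ->
  (forall x y, 0 <= S x y) -> (forall x y, c * S x y <= A x y - B x y) ->
  ~~ (0 < S x y).
Proof.
move=> c0 AC BC SC A0 B0 S0 le; apply/negP => Sxy.
have IA : integral2 A = 0.
  by rewrite integral2_swap // /integral2 integralRN_eq0.
have IB : integral2 B = 0 by rewrite /integral2 integralRN_eq0.
have IS := integral2_gt0 SC S0 Sxy.
have BC' := ccontZ (-1) BC; have SC' := ccontZ (- c) SC.
have ABC := ccontD AC BC'.
have : 0 <= integral2 (fun x y => A x y + -1 * B x y + - c * S x y).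
  by apply: integral2_ge0 => x' y'; rewrite mulN1r mulNr subr_ge0.
rewrite (integral2D ABC SC') (integral2D AC BC') (integral2Z _ BC) (integral2Z _ SC).
by rewrite IA IB mulr0 addr0 add0r mulNr oppr_ge0 leNgt mulr_gt0.
Qed.

(** At (x1, y1) the penalty centred at (x0, y0) moves the predicted gradients by at most 2 [kap],
    and the one centred at (x1, y1) adds nothing. All conditions of [goodpair] thus hold strictly
    there and persist on a small ball that contains the set where the test function is positive. *)
Lemma doubling_contradiction (R : realType) (N : nat)
    (p q del theta kap0 a gam kap L : R) (f : R -> 'rV[R]_N -> R)
    (u : 'rV[R]_N -> R) (x0 y0 x1 y1 : 'rV[R]_N) :
  is_solution p q f u -> continuous (fun z : R * 'rV[R]_N => f z.1 z.2) ->
  1 < p -> 1 < q -> 0 < a -> 0 < gam -> del < 1 -> theta < 1 -> 0 < kap ->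
  (forall s, s = p \/ s = q -> forall b xi xi' : 'rV[R]_N, b != 0 ->
    enorm (xi - b) <= theta * enorm b -> enorm (xi' - b) <= theta * enorm b ->
    (1 - del) * (enorm b `^ (s - 2) * qform s b (xi - xi')) <=
    dotv (rflux s xi - rflux s xi') (xi - xi')) ->
  (forall s, s = p \/ s = q ->
    forall (z z1 z2 : 'rV[R]_N) (h kap k : R), z != 0 -> 0 < h -> 0 <= kap ->
    kap <= kap0 * h ->
    enorm (z1 - h *: z) <= theta * enorm (h *: z) ->
    enorm (z2 - h *: z) <= theta * enorm (h *: z) ->
    k = h * (2 - gam) / enorm z ^+ 2 ->
    (s - 1) * (1 - gam) * (h * enorm (h *: z) `^ (s - 2)) <=
    2 * ((1 - del) *
      \sum_(i < N) cpl s (h *: z) (h *: ebasis R i - (k * z 0 i) *: z) 0 i)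
    - \sum_(i < N) Dflux s z1 ((h + 4 * kap) *: ebasis R i - (k * z 0 i) *: z) 0 i
    - \sum_(i < N) Dflux s z2 ((h + 4 * kap) *: ebasis R i - (k * z 0 i) *: z) 0 i) ->
  let h := a * gam * enorm (x1 - y1) `^ (gam - 2) in
  let b := bgrad a gam (x1 - y1) in
  x1 != y1 -> kap <= kap0 * h -> 2 * kap < theta * enorm b ->
  enorm (x1 - x0) <= 1 -> enorm (y1 - y0) <= 1 ->
  let W0 x y := u x - u y - a * enorm (x - y) `^ gam - kap * (sqd x0 x + sqd y0 y) in
  L = W0 x1 y1 -> 0 < L -> (forall x y, W0 x y <= L) ->
  (forall z1 z2 : 'rV[R]_N, enorm (z1 - b) <= theta * enorm b ->
    enorm (z2 - b) <= theta * enorm b ->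
    f (u x1) z1 - f (u y1) z2 <
    (p - 1) * (1 - gam) * (h * enorm b `^ (p - 2)) +
    (q - 1) * (1 - gam) * (h * enorm b `^ (q - 2))) -> False.
Proof.
move=> sol fc p1 q1 a0 g0 d1 th1 k0 MP CG h b xy kh kb X1 Y1 W0 LE L0 W0L ff.
have [Cu _] := sol; have a0' := ltW a0; have k0' := ltW k0.
have z0 : x1 - y1 != 0 by rewrite subr_eq0.
have h0 : 0 < h by rewrite !mulr_gt0 // powR_gt0 // enorm_gt0.
have b0 : b != 0 by rewrite /b bgrad_scale scaler_eq0 negb_or z0 gt_eqF.
have VL x y : dblV u a gam kap x0 y0 x1 y1 x y <= L - kap * (sqd x1 x + sqd y1 y).
  have := W0L x y; rewrite /dblV /W0; clear; lra.
have V1 : dblV u a gam kap x0 y0 x1 y1 x1 y1 = L.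
  by rewrite /dblV !sqd_id LE /W0; clear; ring.
have VL' x y : dblV u a gam kap x0 y0 x1 y1 x y <= L.
  by apply: le_trans (VL x y) _; rewrite gerBl mulr_ge0 // addr_ge0 // sqd_ge0.
have [ux1 uy1] := critical_pair Cu a0' k0' L0 V1 VL'.
have kn (v w : 'rV[R]_N) : enorm (v - w) <= 1 -> enorm ((2 * kap) *: (v - w)) <= 2 * kap.
  move=> vw; have k2 : 0 < 2 * kap by rewrite mulr_gt0.
  by rewrite enormZ (ger0_norm (ltW k2)) ger_pMr.
have Dx : enorm (pgrad 1 a gam kap y1 x0 x1 x1 - b) < theta * enorm b.
  apply: le_lt_trans kb; rewrite /pgrad subrr scaler0 addr0 scale1r -/b.
  by rewrite [b + _]addrC addrK; exact: kn.
have Dy : enorm (pgrad (-1) a gam kap x1 y0 y1 y1 - b) < theta * enorm b.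
  apply: le_lt_trans kb; rewrite /pgrad subrr scaler0 addr0 scaleN1r.
  rewrite (bgradN a gam x1 y1) -/b opprD opprK [b + _]addrC addrK enormN.
  exact: kn.
have Ux : enorm (grad u x1 - b) < theta * enorm b by rewrite ux1.
have Uy : enorm (grad u y1 - b) < theta * enorm b by rewrite uy1.
have S0 := gain_at a0 g0 xy k0' CG kh (ltW Dx) (ltW Dy) (ff _ _ (ltW Ux) (ltW Uy)).
rewrite -/b in S0.
move: S0; set S := (X in 0 < X) => S0.
have Sc : S / 2 < S by rewrite gtr_pMr // invf_lt1 // ltr1n.
have c00 : 0 < S / 2 by rewrite divr_gt0.
have near_good := near_goodpair (c0 := S / 2) Cu fc th1 b0 xy Ux Dx Uy Dy Sc.
have [d0 /= d00 Hd] := (nbhs_ballP _ _).1 near_good.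
(* [d < d0] keeps the balls inside the good neighbourhood, and [kap * d ^+ 2 < L] keeps the level
   below positive. *)
have [d dd0 [dd dL]] : exists2 d : R, 0 < d & d < d0 /\ kap * d ^+ 2 < L.
  clear -d00 k0 L0; pose d := Num.min (d0 / 2) (Num.min 1 (L / kap / 2)).
  have D0 : 0 < d by rewrite !lt_min !divr_gt0 ?ltr01.
  have D1 : d <= d0 / 2 by rewrite ge_min lexx.
  have D2 : d <= 1 by rewrite !ge_min lexx !orbT.
  have D3 : d <= L / kap / 2 by rewrite !ge_min lexx !orbT.
  exists d => //; split; first lra.
  have D4 : d ^+ 2 <= d by rewrite expr2 ger_pMr.
  have : kap * d ^+ 2 <= kap * (L / kap / 2) by apply: ler_wpM2l; [exact: ltW|lra].
  have -> : kap * (L / kap / 2) = L / 2 by field; rewrite gt_eqF.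
  lra.
(* If one of the points leaves its ball of radius [d], the second penalty alone exceeds
   [kap * d ^+ 2], so this level confines the test function. *)
pose l := L - kap * d ^+ 2; have l0 : 0 < l by rewrite subr_gt0.
have good x y : sqd x1 x <= d ^+ 2 /\ sqd y1 y <= d ^+ 2 ->
    goodpair p q del theta a gam kap (S / 2) f u b x0 y0 x1 y1 x y.
  move=> [/(enorm_le_sqd (ltW dd0)) e1 /(enorm_le_sqd (ltW dd0)) e2].
  apply: (Hd (x, y)); split => /=; rewrite -ball_normE /= -normrN opprB;
  apply: le_lt_trans dd.
    by apply: le_trans e1; exact: norm_le_enorm.
  by apply: le_trans e2; exact: norm_le_enorm.
have out x y : ~ (sqd x1 x <= d ^+ 2 /\ sqd y1 y <= d ^+ 2) ->
    dblV u a gam kap x0 y0 x1 y1 x y - l <= 0.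
  move=> nK; rewrite subr_le0 /l; apply: le_trans (VL x y) _.
  rewrite lerB // ler_wpM2l //; have s1 := sqd_ge0 x1 x; have s2 := sqd_ge0 y1 y.
  rewrite leNgt; apply/negP => lt; apply: nK; clear -s1 s2 lt; split; lra.
have d0' := ltW dd0; have g0' := g0.
have [CX CY CS] := ccont_Z (l := l) Cu fc g0 d0' th1 b0 good out.
have /negP := integral_comparison x1 y1 c00 CX CY CS
  (fun y => integral_ZX y sol fc a0' k0' l0 d0' th1 b0 good out)
  (fun x => integral_ZY x sol fc a0' k0' l0 d0' th1 b0 good out)
  (fun x y => sqpos_ge0 _)
  (fun x y => Z_lower x y p1 q1 d1 b0 MP good out).
apply; rewrite V1 /sqpos exprn_gt0 // lt_max; apply/orP; left.
by rewrite /l opprB addrC subrK mulr_gt0 // exprn_gt0.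
Qed.

(** * Exponent of the barrier, choice of the constants, and conclusion *)

Lemma le_powR_neg (R : realType) (x y r : R) : r <= 0 -> 0 < x -> x <= y ->
  y `^ r <= x `^ r.
Proof.
move=> r0 x0 xy; have y0 : 0 < y by exact: lt_le_trans xy.
have rN : 0 <= - r by rewrite oppr_ge0.
have := @ge0_ler_powR _ _ rN x y (ltW x0) (ltW y0) xy.
by rewrite !powRN lef_pV2 // posrE powR_gt0.
Qed.

Lemma powR_mul_base (R : realType) (x r : R) : 0 < x -> x `^ r * x = x `^ (r + 1).
Proof.
by move=> x0; rewrite powRD ?(gt_eqF x0) ?implybT // powRr1 // ltW.
Qed.

(* The choice of the exponent: [a r^gam] solves [- phi'' = C phi'^(m-q+2)]. *)
Lemma barrier_power (R : realType) (a gam r q m h B : R) : 0 < a -> 0 < r ->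
  q < m -> gam = (m - q) / (m - q + 1) -> h = a * gam * r `^ (gam - 2) ->
  B = h * r -> B `^ m = (a * gam) `^ (m - q + 1) * (h * B `^ (q - 2)).
Proof.
move=> a0 r0 qm gE hE BE.
have mu0 : 0 < m - q + 1 by lra.
have g0 : 0 < gam by rewrite gE divr_gt0 //; lra.
have h0 : 0 < h by rewrite hE !mulr_gt0 // powR_gt0.
have B0 : 0 < B by rewrite BE mulr_gt0.
have BE' : B = a * gam * r `^ (gam - 1).
  rewrite BE hE -mulrA (powR_mul_base _ r0).
  by congr (_ * _ `^ _); ring.
have Bmu : r * B `^ (m - q + 1) = (a * gam) `^ (m - q + 1).
  rewrite BE' powRM ?powR_ge0 ?mulr_ge0 ?ltW // -powRrM.
  (* This identity characterizes the exponent: it gives |b|^(m-q+1) = (a gam)^(m-q+1) / r. *)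
  have -> : (gam - 1) * (m - q + 1) = -1.
    by rewrite gE; field; rewrite gt_eqF.
  by rewrite powR_inv1 ?(ltW r0) // mulrCA mulfV ?mulr1 // gt_eqF.
have -> : m = (m - q + 1) + 1 + (q - 2) by ring.
rewrite powRD; last by rewrite (gt_eqF B0) implybT.
rewrite powRD; last by rewrite (gt_eqF B0) implybT.
rewrite powRr1 ?(ltW B0) // {2}BE.
rewrite (_ : m - q + 1 + 1 + (q - 2) - q + 1 = m - q + 1); last by ring.
by rewrite -Bmu; ring.
Qed.

(** Gradients close to [b] have length at most 2 |b|, so each source is at most G 2^m |b|^m.
    [barrier_power] rewrites |b|^m as a small multiple of the q-gain, which absorbs both sources;
    the p-gain is positive. *)
Lemma source_small (R : realType) (N : nat) (p q m gam a G theta : R)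
    (f : R -> 'rV[R]_N -> R) (u : 'rV[R]_N -> R) (x1 y1 : 'rV[R]_N) :
  1 < p -> 1 < q -> q < m -> 0 < a -> 0 < G -> theta <= 1 ->
  gam = (m - q) / (m - q + 1) ->
  2 * G * 2 `^ m * (a * gam) `^ (m - q + 1) < (q - 1) * (1 - gam) ->
  (forall x xi, `|f (u x) xi| <= G * enorm xi `^ m) -> x1 != y1 ->
  let h := a * gam * enorm (x1 - y1) `^ (gam - 2) in
  let b := bgrad a gam (x1 - y1) in
  forall z1 z2 : 'rV[R]_N, enorm (z1 - b) <= theta * enorm b ->
    enorm (z2 - b) <= theta * enorm b ->
    f (u x1) z1 - f (u y1) z2 <
    (p - 1) * (1 - gam) * (h * enorm b `^ (p - 2)) +
    (q - 1) * (1 - gam) * (h * enorm b `^ (q - 2)).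
Proof.
move=> p1 q1 qm a0 G0 th1 gE small fG xy h b z1 z2 H1 H2.
have r0 : 0 < enorm (x1 - y1) by rewrite enorm_gt0 subr_eq0.
have mu0 : 0 < m - q + 1 by lra.
have g0 : 0 < gam by rewrite gE divr_gt0 //; lra.
have g1 : gam < 1 by rewrite gE ltr_pdivrMr //; lra.
have h0 : 0 < h by rewrite !mulr_gt0 // powR_gt0.
have bE : enorm b = h * enorm (x1 - y1).
  by rewrite /b bgrad_scale enormZ (ger0_norm (ltW h0)).
have B0 : 0 < enorm b by rewrite bE mulr_gt0.
have m0 : 0 <= m by lra.
have zm v : enorm (v - b) <= theta * enorm b -> enorm v `^ m <= 2 `^ m * enorm b `^ m.
  move=> vb; rewrite -powRM ?(ltW B0) //.
  have le2 : enorm v <= 2 * enorm b.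
    rewrite -(subrK b v); apply: le_trans (enormD _ _) _.
    have := ler_wpM2r (ltW B0) th1; clear -vb; lra.
  by apply: ge0_ler_powR => //; rewrite nnegrE ?enorm_ge0 // mulr_ge0 // ltW.
have pw := barrier_power a0 r0 qm gE erefl bE.
have hB s : 0 < h * enorm b `^ (s - 2) by rewrite mulr_gt0 // powR_gt0.
have fle v x : enorm (v - b) <= theta * enorm b ->
    `|f (u x) v| <= G * (2 `^ m * enorm b `^ m).
  by move=> /zm vm; apply: le_trans (fG _ _) _; rewrite ler_pM2l.
have F1 := fle z1 x1 H1; have F2 := fle z2 y1 H2.
have P0 : 0 < (p - 1) * (1 - gam) * (h * enorm b `^ (p - 2)).
  by rewrite !mulr_gt0 // ?subr_gt0 // powR_gt0.
have Q0 : 2 * (G * (2 `^ m * enorm b `^ m)) <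
    (q - 1) * (1 - gam) * (h * enorm b `^ (q - 2)).
  rewrite pw (_ : 2 * _ = 2 * G * 2 `^ m * (a * gam) `^ (m - q + 1) *
    (h * enorm b `^ (q - 2))); last by rewrite !mulrA.
  by rewrite (ltr_pM2r (hB q)).
move: F1 F2 P0 Q0; rewrite !ler_norml.
move: (f (u x1) z1) (f (u y1) z2) (G * _) (_ * (h * _)) (_ * (h * _)); clear.
by move=> f1 f2 K P Q; lra.
Qed.

Lemma exists_bound_g (R : realType) (g : R -> R) (M : R) : continuous g ->
  exists2 G : R, 0 < G & forall t, `|t| <= M -> g t <= G.
Proof.
move=> gc; pose B := Num.max M 0.
have B0 : 0 <= B by rewrite le_max lexx orbT.
have BB : - B <= B by lra.
have [c _ cmax] := EVT_max BB (continuous_subspaceT gc).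
exists (`|g c| + 1); first by have := normr_ge0 (g c); lra.
move=> t tM; have := ler_norm (g c).
suff : g t <= g c by lra.
apply: cmax; rewrite in_itv /= -ler_norml; apply: le_trans tM _.
by rewrite le_max lexx.
Qed.

Lemma exists_coupling_loss (R : realType) (N : nat) (s gam : R) : 1 < s -> gam < 1 ->
  exists2 del : R, 0 < del & forall d, d <= del ->
    d * (N%:R + s) <= (s - 1) * (1 - gam) / 2.
Proof.
move=> s1 g1; have Ns : 0 < N%:R + s by rewrite ltr_wpDl //; lra.
exists ((s - 1) * (1 - gam) / 2 / (N%:R + s)).
  by rewrite !divr_gt0 // mulr_gt0 // subr_gt0.
by move=> d; rewrite ler_pdivlMr.
Qed.

Lemma exists_barrier_coef (R : realType) (gam mu C e r : R) : 0 < gam -> 0 < mu ->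
  0 < C -> 0 < e -> 0 < r ->
  exists2 a : R, 0 < a & (a * gam) `^ mu < C /\ a * r < e.
Proof.
move=> g0 mu0 C0 e0 r0; pose C2 := C / 2; have C20 : 0 < C2 by rewrite divr_gt0.
(* Halving [C] and doubling [r] make both inequalities strict. *)
pose a := Num.min (C2 `^ mu^-1 / gam) (e / (2 * r)).
have a0 : 0 < a by rewrite lt_min !divr_gt0 ?powR_gt0 // mulr_gt0.
have a1 : a * gam <= C2 `^ mu^-1 by rewrite -ler_pdivlMr // ge_min lexx.
have a2 : a * (2 * r) <= e by rewrite -ler_pdivlMr ?mulr_gt0 // ge_min lexx orbT.
exists a => //; split; last first.
  have : 0 < a * r by rewrite mulr_gt0.
  by rewrite (_ : a * (2 * r) = 2 * (a * r)) in a2; [lra | ring].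
have ag : 0 <= a * gam by rewrite mulr_ge0 // ltW.
have := @ge0_ler_powR _ _ (ltW mu0) _ _ ag (powR_ge0 _ _) a1.
rewrite -powRrM mulVf ?gt_eqF // powRr1 ?(ltW C20) // => /le_lt_trans; apply.
by rewrite /C2; lra.
Qed.

(** The maximum point depends on [kap], yet [kap] has to be small against h and |b| at that point.
    Lower bounds for both, known in advance, break this circle. *)
Lemma oscillation_le0 (R : realType) (N : nat) (p q m : R) (g : R -> R)
    (f : R -> 'rV[R]_N -> R) (u : 'rV[R]_N -> R) (M : R) (X Y : 'rV[R]_N) :
  1 < q -> q < p -> q < m -> continuous g ->
  continuous (fun z : R * 'rV[R]_N => f z.1 z.2) ->
  (forall (t : R) (xi : 'rV[R]_N), `|f t xi| <= g t * enorm xi `^ m) ->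
  is_solution p q f u -> (forall x, `|u x| <= M) -> u X <= u Y.
Proof.
move=> q1 qp qm gc fc fg sol uM; rewrite leNgt; apply/negP => YX.
have p1 : 1 < p by exact: lt_trans qp.
have [[du cu] _] := sol.
have mu0 : 0 < m - q + 1 by clear -qm; lra.
pose gam := (m - q) / (m - q + 1).
have g0 : 0 < gam by rewrite divr_gt0 //; clear -qm; lra.
have g1 : gam < 1 by rewrite ltr_pdivrMr //; lra.
have [G G0 Gb] := exists_bound_g M gc.
have fG x xi : `|f (u x) xi| <= G * enorm xi `^ m.
  apply: le_trans (fg _ _) _; apply: ler_wpM2r; first exact: powR_ge0.
  exact: Gb.
have XY : X != Y by apply: contraTneq YX => ->; rewrite ltxx.
have rXY : 0 < enorm (X - Y) `^ gam by rewrite powR_gt0 // enorm_gt0 subr_eq0.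
have [dp dp0 Hdp] := @exists_coupling_loss R N p gam p1 g1.
have [dq dq0 Hdq] := @exists_coupling_loss R N q gam q1 g1.
pose del := Num.min (1 / 2) (Num.min dp dq).
have del0 : 0 < del by rewrite !lt_min dp0 dq0 divr_gt0.
have del1 : del < 1.
  have : del <= 1 / 2 by rewrite ge_min lexx.
  by clear; lra.
have delp := Hdp del (ltac:(by rewrite !ge_min lexx !orbT)).
have delq := Hdq del (ltac:(by rewrite !ge_min lexx !orbT)).
have [t1 t10 M1] := @flux_monotone R N p del p1 del0 del1.
have [t2 t20 M2] := @flux_monotone R N q del q1 del0 del1.
have [t3 [k3 [t30 k30 C3]]] := @coupling_gain R N p gam del p1 g0 g1 del0 del1 delp.
have [t4 [k4 [t40 k40 C4]]] := @coupling_gain R N q gam del q1 g0 g1 del0 del1 delq.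
pose theta := Num.min (1 / 2) (Num.min (Num.min t1 t2) (Num.min t3 t4)).
have th0 : 0 < theta by rewrite !lt_min t10 t20 t30 t40 divr_gt0.
have th1 : theta < 1.
  have : theta <= 1 / 2 by rewrite ge_min lexx.
  by clear; lra.
have tht : [/\ theta <= t1, theta <= t2, theta <= t3 & theta <= t4].
  by split; rewrite !ge_min lexx !orbT.
have [th_1 th_2 th_3 th_4] := tht.
pose kap0 := Num.min k3 k4; have kap00 : 0 < kap0 by rewrite lt_min k30.
have wk t (v b : 'rV[R]_N) : theta <= t -> enorm v <= theta * enorm b ->
    enorm v <= t * enorm b.
  by move=> tt; move/le_trans; apply; apply: ler_wpM2r => //; exact: enorm_ge0.
have MP s : s = p \/ s = q -> forall b xi xi' : 'rV[R]_N, b != 0 ->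
    enorm (xi - b) <= theta * enorm b -> enorm (xi' - b) <= theta * enorm b ->
    (1 - del) * (enorm b `^ (s - 2) * qform s b (xi - xi')) <=
    dotv (rflux s xi - rflux s xi') (xi - xi').
  move=> [->|->] b xi xi' b0 H H'.
    by apply: M1 => //; exact: wk th_1 _.
  by apply: M2 => //; exact: wk th_2 _.
have CG s : s = p \/ s = q ->
    forall (z z1 z2 : 'rV[R]_N) (h kap k : R), z != 0 -> 0 < h -> 0 <= kap ->
    kap <= kap0 * h ->
    enorm (z1 - h *: z) <= theta * enorm (h *: z) ->
    enorm (z2 - h *: z) <= theta * enorm (h *: z) ->
    k = h * (2 - gam) / enorm z ^+ 2 ->
    (s - 1) * (1 - gam) * (h * enorm (h *: z) `^ (s - 2)) <=
    2 * ((1 - del) *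
      \sum_(i < N) cpl s (h *: z) (h *: ebasis R i - (k * z 0 i) *: z) 0 i)
    - \sum_(i < N) Dflux s z1 ((h + 4 * kap) *: ebasis R i - (k * z 0 i) *: z) 0 i
    - \sum_(i < N) Dflux s z2 ((h + 4 * kap) *: ebasis R i - (k * z 0 i) *: z) 0 i.
  move=> [->|->] z z1 z2 h kap k z0 h0 kk kh H1 H2 kE.
    apply: C3 => //; [|exact: wk th_3 _|exact: wk th_3 _].
    by apply: le_trans kh _; rewrite ler_pM2r // ge_min lexx.
  apply: C4 => //; [|exact: wk th_4 _|exact: wk th_4 _].
  by apply: le_trans kh _; rewrite ler_pM2r // ge_min lexx orbT.
pose C := (q - 1) * (1 - gam) / (2 * G * 2 `^ m).
have GG : 0 < 2 * G * 2 `^ m by rewrite !mulr_gt0 // powR_gt0.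
have C0 : 0 < C by rewrite divr_gt0 // mulr_gt0 // subr_gt0.
have e0 : 0 < (u X - u Y) / 2 by rewrite divr_gt0 // subr_gt0.
have [a a0 [aC ae]] := exists_barrier_coef g0 mu0 C0 e0 rXY.
have small : 2 * G * 2 `^ m * (a * gam) `^ (m - q + 1) < (q - 1) * (1 - gam).
  by rewrite mulrC -ltr_pdivlMr.
have M0 : 0 <= M by exact: le_trans (normr_ge0 _) (uM X).
have uB x y : u x - u y <= 2 * M.
  have := uM x; have := uM y; rewrite !ler_norml; clear; lra.
(* An a priori bound for |x1 - y1|: a positive [W] forces a |x1 - y1|^gam < 2M. The summand 1 keeps
   the base positive when M = 0. *)
pose rm := ((2 * M + 1) / a) `^ gam^-1.
have rm0 : 0 < rm by rewrite powR_gt0 // divr_gt0 //; clear -M0; lra.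
have gN2 : gam - 2 <= 0 by clear -g1; lra.
have gN1 : gam - 1 <= 0 by clear -g1; lra.
have ag0 : 0 < a * gam by rewrite mulr_gt0.
(* As gam < 1, h and |b| decrease with the distance, so their values at [rm] bound them from
   below. *)
pose hm := a * gam * rm `^ (gam - 2); pose bm := a * gam * rm `^ (gam - 1).
have hm0 : 0 < hm by rewrite mulr_gt0 // powR_gt0.
have bm0 : 0 < bm by rewrite mulr_gt0 // powR_gt0.
(* The three bounds serve the coupling gain, the closeness of the predicted gradients to b, and the
   positivity of the maximum; for the last, the barrier at (X, Y) uses up less than the other half
   of u X - u Y. *)
pose kap := Num.min (kap0 * hm) (Num.min (theta * bm / 4) ((u X - u Y) / 2)).
have kp0 : 0 < kap.
  by rewrite !lt_min e0 andbT (mulr_gt0 kap00 hm0) divr_gt0 // mulr_gt0.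
have kp1 : kap <= kap0 * hm by rewrite ge_min lexx.
have kp2 : kap <= theta * bm / 4 by rewrite !ge_min lexx !orbT.
have kp3 : kap <= (u X - u Y) / 2 by rewrite !ge_min lexx !orbT.
pose W (x y : 'rV[R]_N) := u x - u y - a * enorm (x - y) `^ gam.
have Wc : continuous (fun z : 'rV[R]_N * 'rV[R]_N => W z.1 z.2).
  (* [W] is [dblV] without quadratic penalties and at level 0. *)
  move=> z; have := @dblV_continuous R N u a gam 0 0 0 0 0 0 z (conj du cu) g0.
  rewrite (_ : (fun w : 'rV[R]_N * 'rV[R]_N => _) = (fun z => W z.1 z.2)); last first.
    by apply/funext => w; rewrite /dblV /W; clear; ring.
  by rewrite (_ : dblV _ _ _ _ _ _ _ _ _ _ - 0 = W z.1 z.2) //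
    /dblV /W; clear; ring.
have WB x y : W x y <= 2 * M.
  by apply: le_trans (uB x y); rewrite gerBl mulr_ge0 ?powR_ge0 // ltW.
have [x0 [y0 [x1 [y1 [X1 Y1 WL Wmax]]]]] := penalized_max X Y Wc WB kp0.
pose L := W x1 y1 - kap * (sqd x0 x1 + sqd y0 y1).
have L0 : 0 < L.
  apply: lt_le_trans WL; rewrite /W; move: ae kp3; clear; lra.
have W1 : 0 < W x1 y1.
  apply: lt_le_trans L0 _; rewrite /L gerBl mulr_ge0 ?(ltW kp0) //.
  by rewrite addr_ge0 // sqd_ge0.
have xy : x1 != y1.
  apply: contraTneq W1 => ->; rewrite -leNgt /W subrr sub0r oppr_le0.
  by rewrite mulr_ge0 ?powR_ge0 // ltW.
have r0 : 0 < enorm (x1 - y1) by rewrite enorm_gt0 subr_eq0.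
have rrm : enorm (x1 - y1) <= rm.
  have ar : enorm (x1 - y1) `^ gam <= (2 * M + 1) / a.
    rewrite ler_pdivlMr //; have := uB x1 y1; move: W1; rewrite /W mulrC; clear; lra.
  have gi : 0 <= gam^-1 by rewrite invr_ge0 ltW.
  have := @ge0_ler_powR _ _ gi _ _ (powR_ge0 _ _) (le_trans (powR_ge0 _ _) ar) ar.
  by rewrite -powRrM mulfV ?gt_eqF // powRr1 // ltW.
have hh : hm <= a * gam * enorm (x1 - y1) `^ (gam - 2).
  exact: (ler_wpM2l (ltW ag0) (le_powR_neg gN2 r0 rrm)).
have h0 : 0 < a * gam * enorm (x1 - y1) `^ (gam - 2) by exact: lt_le_trans hh.
have bb : bm <= enorm (bgrad a gam (x1 - y1)).
  rewrite bgrad_scale enormZ (ger0_norm (ltW h0)) -(mulrA (a * gam)).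
  rewrite (powR_mul_base _ r0) (_ : gam - 2 + 1 = gam - 1); last by clear; ring.
  exact: (ler_wpM2l (ltW ag0) (le_powR_neg gN1 r0 rrm)).
apply: (@doubling_contradiction R N p q del theta kap0 a gam kap L f u x0 y0 x1 y1
  sol fc p1 q1 a0 g0 del1 th1 kp0 MP CG xy _ _ X1 Y1 erefl L0 Wmax).
- by apply: le_trans kp1 _; rewrite ler_pM2l.
- have tb := ler_wpM2l (ltW th0) bb; have tbm := mulr_gt0 th0 bm0.
  move: tb tbm kp2; clear; lra.
- exact: (source_small p1 q1 qm a0 G0 (ltW th1) erefl small fG xy).
Qed.

Theorem theorem1p3 (R : realType) (N : nat) (p q m : R)
  (g : R -> R) (f : R -> 'rV[R]_N -> R) (u : 'rV[R]_N -> R) :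
  (2 <= N)%N -> 1 < q -> q < p -> q < m ->
  continuous g ->
  continuous (fun z : R * 'rV[R]_N => f z.1 z.2) ->
  (forall (t : R) (xi : 'rV[R]_N), `|f t xi| <= g t * enorm xi `^ m) ->
  is_solution p q f u ->
  (exists M : R, forall x, `|u x| <= M) ->
  exists c : R, forall x, u x = c.
Proof.
move=> _ q1 qp qm gc fc fg sol [M uM]; exists (u 0) => x.
by apply/eqP; rewrite eq_le !(oscillation_le0 _ _ q1 qp qm gc fc fg sol uM).
Qed.
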